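(* Given an instance $\mathcal{I}$ of Lottery Priority $\mathcal{F}$-Center and a black-box $\alpha$-approximation algorithm $\mathcal{A}$ for Fractional Priority $\mathcal{F}$-Center (for the same family $\mathcal{F}$) with running time $T(\mathcal{A})$, one can compute an $\alpha$-approximate solution for $\mathcal{I}$ (in the sense of an $\alpha$-approximation algorithm for Lottery Priority $\mathcal{F}$-Center) in time $\mathrm{poly}(|\mathcal{I}|)\cdot T(\mathcal{A})$.
   Context: Write $d(v,S)=\min_{s\in S}d(v,s)$. Lottery Priority $\mathcal{F}$-Center: the input is a finite metric space $(X,d)$ in which each point $v$ has a distance demand $r(v)>0$ and a probability demand $\mathrm{prob}(v)\in[0,1]$, together with a (possibly implicitly specified) family $\mathcal{F}\subseteq2^X$. A distribution over $\mathcal{F}$ is $\alpha$-approximate if for every $v\in X$, $\Pr_S[d(v,S)\le\alpha r(v)]\ge\mathrm{prob}(v)$; an $\alpha$-approximate solution either correctly asserts that no $1$-approximate distribution exists or gives an $\alpha$-approximate distribution. Fractional Priority $\mathcal{F}$-Center: the input is a finite metric space $(X,d)$, radii $r_v>0$ and weights $\mu_v\ge0$ for $v\in X$, a parameter $m\ge0$ and the family $\mathcal{F}\subseteq2^X$; the goal is to find $S\in\mathcal{F}$ minimizing $\alpha$ such that $\mu(\{v\in X: d(v,S)\le\alpha r_v\})>m$, where $\mu(A)=\sum_{v\in A}\mu_v$. An $\alpha$-approximation algorithm for it either returns $S\in\mathcal{F}$ with $\mu(\{v: d(v,S)\le\alpha r_v\})>m$ or correctly asserts that no $S\in\mathcal{F}$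 has $\mu(\{v: d(v,S)\le r_v\})>m$. *)

(* Defs.v *)
From mathcomp Require Import all_boot all_order all_algebra.
From mathcomp Require Import reals constructive_ereal ereal.

Set Implicit Arguments.
Unset Strict Implicit.
Unset Printing Implicit Defensive.

Import Order.TTheory GRing.Theory Num.Theory.

(* Machine model: a first-order call-by-value functional language over trees
   whose leaves are integers of arbitrary precision, with recursive
   procedures and a black box.  Structural steps have unit cost, arithmetic is
   charged for the bit lengths of its operands, so that the cost is
   polynomially related to Turing machine time. *)

Inductive data := VInt of int | VPair of data & data.

Definition bits (z : int) : nat := up_log 2 `|z|%N.+1.

Fixpoint dsize (v : data) : nat :=
  match v with
  | VInt z => (bits z).+1
  | VPair a b => (dsize a + dsize b).+1
  end.

Inductive prim := Add | Sub | Mul | Quo.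

Definition prim_sem (o : prim) (a b : int) : int :=
  match o with
  | Add => (a + b)%R
  | Sub => (a - b)%R
  | Mul => (a * b)%R
  | Quo => (a %/ b)%Z
  end.

(* Variables are de Bruijn indices.  [ECase e e1 e2] continues with [e1] if [e]
   is an integer, and with [e2] in the environment extended by the two
   components if it is a pair. *)
Inductive exp :=
  | EVar of nat
  | EInt of int
  | EPrim of prim & exp & exp
  | EPair of exp & exp
  | ELet of exp & exp
  | EIfLe of exp & exp & exp & exp
  | ECase of exp & exp & exp
  | ECall of nat & exp
  | EAsk of exp.

(* A program is its list of procedure bodies, each with one argument. *)
Definition program := seq exp.

Record blackbox := BlackBox { answer : data -> data; bbtime : data -> nat }.

(* [ceval A M env e v t]: in [env], [e] has value [v] and takes time [t].
   Asking the black box a query costs writing the query plus the time the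
   black box takes on it. *)
Inductive ceval (A : blackbox) (M : program) : seq data -> exp -> data -> nat -> Prop :=
  | eval_var env i v :
      onth env i = Some v -> ceval A M env (EVar i) v 1
  | eval_int env z :
      ceval A M env (EInt z) (VInt z) 1
  | eval_prim env o e1 e2 a b t1 t2 :
      ceval A M env e1 (VInt a) t1 -> ceval A M env e2 (VInt b) t2 ->
      ceval A M env (EPrim o e1 e2) (VInt (prim_sem o a b))
        (t1 + t2 + (bits a).+1 * (bits b).+1)
  | eval_pair env e1 e2 v1 v2 t1 t2 :
      ceval A M env e1 v1 t1 -> ceval A M env e2 v2 t2 ->
      ceval A M env (EPair e1 e2) (VPair v1 v2) (t1 + t2).+1
  | eval_let env e1 e2 v1 v2 t1 t2 :
      ceval A M env e1 v1 t1 -> ceval A M (v1 :: env) e2 v2 t2 ->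
      ceval A M env (ELet e1 e2) v2 (t1 + t2).+1
  | eval_ifle env e1 e2 e3 e4 a b v t1 t2 t3 :
      ceval A M env e1 (VInt a) t1 -> ceval A M env e2 (VInt b) t2 ->
      ceval A M env (if (a <= b)%R then e3 else e4) v t3 ->
      ceval A M env (EIfLe e1 e2 e3 e4) v
        (t1 + t2 + t3 + (bits a + bits b).+1)
  | eval_case_int env e e1 e2 z v t t1 :
      ceval A M env e (VInt z) t -> ceval A M env e1 v t1 ->
      ceval A M env (ECase e e1 e2) v (t + t1).+1
  | eval_case_pair env e e1 e2 a b v t t2 :
      ceval A M env e (VPair a b) t -> ceval A M (a :: b :: env) e2 v t2 ->
      ceval A M env (ECase e e1 e2) v (t + t2).+1
  | eval_call env f e body a v t1 t2 :
      ceval A M env e a t1 -> onth M f = Some body ->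
      ceval A M [:: a] body v t2 ->
      ceval A M env (ECall f e) v (t1 + t2).+1
  | eval_ask env e q t :
      ceval A M env e q t ->
      ceval A M env (EAsk e) (answer A q) (t + dsize q + bbtime A q).+1.

(* Procedure 0 is the entry point. *)
Definition run (A : blackbox) (M : program) (input output : data) (t : nat) : Prop :=
  ceval A M [:: input] (ECall 0 (EVar 0)) output t.

Definition enc_list (s : seq data) : data := foldr VPair (VInt 0) s.

Definition enc_option (T : Type) (enc : T -> data) (o : option T) : data :=
  if o is Some x then VPair (enc x) (VInt 0) else VInt 0.

Definition enc_rat (q : rat) : data := VPair (VInt (numq q)) (VInt (denq q)).

Definition enc_vec n (f : 'I_n -> rat) : data :=
  enc_list [seq enc_rat (f i) | i <- enum 'I_n].

Definition enc_set n (S : {set 'I_n}) : data :=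
  enc_list [seq VInt (Posz (nat_of_ord i)) | i <- enum S].

Local Open Scope ring_scope.

(* A finite metric space on the points 0, ..., npts - 1 (rational distances,
   since they are an input of algorithms) with a family of admissible sets.
   The family may be given implicitly: [fam_spec] is an arbitrary description
   of it, which is the form in which the family occurs in inputs.  Members of
   the family are nonempty, because d(v, S) is a minimum over S. *)
Record center_space := CenterSpace {
  npts : nat;
  dist : 'I_npts -> 'I_npts -> rat;
  fam : {set {set 'I_npts}};
  fam_spec : data;
  dist_eq0 : forall x y, (dist x y = 0) <-> (x = y);
  dist_sym : forall x y, dist x y = dist y x;
  dist_triangle : forall x y z, dist x z <= dist x y + dist y z;
  fam_nonempty : forall S, S \in fam -> S != set0 }.

Record lottery (E : center_space) := Lottery {
  lrad : 'I_(npts E) -> rat;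
  lprob : 'I_(npts E) -> rat;
  lrad_gt0 : forall v, 0 < lrad v;
  lprob_itv : forall v, 0 <= lprob v <= 1 }.

Record fractional (E : center_space) := Fractional {
  frad : 'I_(npts E) -> rat;
  fwt : 'I_(npts E) -> rat;
  fthr : rat;
  frad_gt0 : forall v, 0 < frad v;
  fwt_ge0 : forall v, 0 <= fwt v;
  fthr_ge0 : 0 <= fthr }.

Definition enc_dist (E : center_space) : data :=
  enc_list [seq enc_vec (@dist E i) | i <- enum 'I_(npts E)].

Definition enc_lottery E (I : lottery E) : data :=
  enc_list [:: VInt (Posz (npts E)); enc_dist E; enc_vec (lrad I);
               enc_vec (lprob I); fam_spec E].

Definition enc_fractional E (J : fractional E) : data :=
  enc_list [:: VInt (Posz (npts E)); enc_dist E; enc_vec (frad J);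
               enc_vec (fwt J); enc_rat (fthr J); fam_spec E].

Section Approximation.

Variables (R : realType) (E : center_space).

Definition set_dist (v : 'I_(npts E)) (S : {set 'I_(npts E)}) : \bar R :=
  \big[Order.min/+oo%E]_(s in S) (ratr (dist v s))%:E.

Definition covered (alpha : R) (r : 'I_(npts E) -> rat) (v : 'I_(npts E))
    (S : {set 'I_(npts E)}) : bool :=
  (set_dist v S <= (alpha * ratr (r v))%:E)%E.

Definition distribution (P : {set 'I_(npts E)} -> R) : Prop :=
  [/\ forall S, 0 <= P S, \sum_S P S = 1 & forall S, S \notin fam E -> P S = 0].

Definition lottery_approx (alpha : R) (I : lottery E)
    (P : {set 'I_(npts E)} -> R) : Prop :=
  distribution P /\
  forall v, ratr (lprob I v) <= \sum_(S | covered alpha (lrad I) v S) P S.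

(* Algorithms output a distribution as a list of sets with rational
   probabilities; the same set may be listed several times. *)
Definition lot_distr (L : seq ({set 'I_(npts E)} * rat))
    (S : {set 'I_(npts E)}) : R :=
  \sum_(x <- L | x.1 == S) ratr x.2.

Definition lottery_solution (alpha : R) (I : lottery E)
    (o : option (seq ({set 'I_(npts E)} * rat))) : Prop :=
  match o with
  | Some L => lottery_approx alpha I (lot_distr L)
  | None => ~ exists P : {set 'I_(npts E)} -> R, lottery_approx 1 I P
  end.

Definition weight_covered (alpha : R) (J : fractional E)
    (S : {set 'I_(npts E)}) : rat :=
  \sum_(v | covered alpha (frad J) v S) fwt J v.

Definition fractional_solution (alpha : R) (J : fractional E)
    (o : option {set 'I_(npts E)}) : Prop :=
  match o with
  | Some C => C \in fam E /\ fthr J < weight_covered alpha J C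
  | None => ~ exists2 S, S \in fam E & fthr J < weight_covered 1 J S
  end.

Definition fractional_approx_alg (alpha : R) (A : blackbox) : Prop :=
  forall J : fractional E, exists2 o : option {set 'I_(npts E)},
    answer A (enc_fractional J) = enc_option (@enc_set (npts E)) o &
    fractional_solution alpha J o.

End Approximation.

Definition enc_lot n (L : seq ({set 'I_n} * rat)) : data :=
  enc_list [seq VPair (enc_set x.1) (enc_rat x.2) | x <- L].

(* Main.v *)
(* Let D be a common denominator of the demands. A distribution P satisfies them
   exactly when the vectors D prob - D 1_C, weighted by P(S), where C is the set of
   points covered by S, add up to a vector without positive entries. Given an
   integral direction c, the black box with weights max(c, 0) either shows that no
   1-approximate distribution exists, or returns a set S from which a set C of
   alpha-covered points is computed with (D prob - D 1_C) . c <= 0, that is, a cut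
   through c.

   A simplex method of Yamnitsky and Levin asks at the center of a simplicial cone,
   and replaces the cone by a simplicial cone around the part that the cut leaves.
   The facets are kept as nonnegative combinations of the coordinate functionals
   and of the cuts. The determinant of the facets, normalized, grows by a factor
   1 + 1/(8 n^2) in each step, whereas it is bounded as long as the cuts have small
   total multiplicity; so after polynomially many steps the cuts, scaled to total
   weight 1, add up to a vector all of whose entries are nearly nonpositive. A conic
   Caratheodory reduction leaves n + 1 rows. Their weights are quotients of small
   integers, so that nearly nonpositive entries are nonpositive, and the weights of
   the remaining cuts form the distribution. *)

Require Import Defs.
From mathcomp Require Import all_boot all_order all_fingroup all_algebra.
From mathcomp Require Import zify ring lra.
From mathcomp Require Import reals constructive_ereal ereal.

Set Implicit Arguments.
Unset Strict Implicit.
Unset Printing Implicit Defensive.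

Import Order.TTheory GRing.Theory Num.Theory.

(** * Binding operators for the machine language *)

(* A term is an expression waiting for the depth of its environment, so that
   Rocq binders can stand for de Bruijn indices. *)
Definition term := nat -> exp.
(** A variable is remembered by its level, the depth at which it was bound; the de Bruijn index
    follows from the depth of its use. *)
Definition slot (l : nat) : term := fun d => EVar (d - l.+1).
Definition int_ z : term := fun=> EInt z.
Definition prim_ o (e1 e2 : term) : term := fun d => EPrim o (e1 d) (e2 d).
Definition pair_ (e1 e2 : term) : term := fun d => EPair (e1 d) (e2 d).
Definition let_ (e : term) (f : term -> term) : term :=
  fun d => ELet (e d) (f (slot d) d.+1).
Definition ifle_ (e1 e2 e3 e4 : term) : term :=
  fun d => EIfLe (e1 d) (e2 d) (e3 d) (e4 d).
(** The first component of the pair ends up on top of the environment, so its level is [d.+1] and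
    that of the second is [d]. *)
Definition case_ (e e1 : term) (f : term -> term -> term) : term :=
  fun d => ECase (e d) (e1 d) (f (slot d.+1) (slot d) d.+2).
Definition call_ k (e : term) : term := fun d => ECall k (e d).
Definition ask_ (e : term) : term := fun d => EAsk (e d).
Definition proc (f : term -> term) : exp := f (slot 0) 1.

Definition open2 e f := case_ e (int_ 0) f.
Definition open3 e f := open2 e (fun a r => open2 r (f a)).
Definition open4 e f := open2 e (fun a r => open3 r (f a)).
Definition open5 e f := open2 e (fun a r => open4 r (f a)).
Definition open6 e f := open2 e (fun a r => open5 r (f a)).
Definition open7 e f := open2 e (fun a r => open6 r (f a)).

Declare Scope machine_scope.
Delimit Scope machine_scope with MT.
Bind Scope machine_scope with term.
Notation "0" := (int_ 0) : machine_scope.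
Notation "1" := (int_ 1) : machine_scope.
Notation "x + y" := (prim_ Defs.Add x y) : machine_scope.
Notation "x - y" := (prim_ Defs.Sub x y) : machine_scope.
Notation "x * y" := (prim_ Defs.Mul x y) : machine_scope.
Notation "x %/ y" := (prim_ Defs.Quo x y) : machine_scope.
Notation "x ,, y" := (pair_ x y) (at level 60, right associativity) : machine_scope.
Notation "'LET' x := e 'IN' f" := (let_ e (fun x => f))
  (at level 200, x binder, f at level 200) : machine_scope.
Notation "'CASE' e 'INT' f 'PAIR' x y 'IN' g" := (case_ e f (fun x y => g))
  (at level 200, x binder, y binder, f at level 100, g at level 200) : machine_scope.
Notation "'IFLE' a b 'THEN' e1 'ELSE' e2" := (ifle_ a b e1 e2)
  (at level 200, a at level 9, b at level 9, e1 at level 100, e2 at level 200) : machine_scope.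

(** * The program *)

Definition f_main := 0.
Definition f_dot := 1.
Definition f_vcomb := 2.
Definition f_mcomb := 3.
Definition f_lincomb := 4.
Definition f_dots := 5.
Definition f_vmul := 6.
Definition f_iota := 7.
Definition f_consts := 8.
Definition f_unit := 9.
Definition f_units := 10.
Definition f_prod := 11.
Definition f_dens := 12.
Definition f_scale := 13.
Definition f_ratio := 14.
Definition f_pos := 15.
Definition f_wrap := 16.
Definition f_nth := 17.
Definition f_setdist := 18.
Definition f_rhos := 19.
Definition f_mass := 20.
Definition f_hvec := 21.
Definition f_hscale := 22.
Definition f_htot := 23.
Definition f_gcd := 24.
Definition f_setk := 25.
Definition f_finish := 26.
Definition f_pur := 27.
Definition f_purstart := 28.
Definition f_query := 29.
Definition f_update := 30.
Definition f_loop := 31.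

Local Open Scope machine_scope.

(** Evaluating the binding operators away leaves plain constructors, on which the evaluation tactics
    match. *)
Definition dot_body : exp := Eval vm_compute in proc (fun arg =>
  open2 arg (fun xs ys =>
  CASE xs INT 0 PAIR x xs' IN
  open2 ys (fun y ys' => x * y + call_ f_dot (xs' ,, ys')))).

(** Depending on [a], [b], [e], the same entrywise procedure scales, negates, builds constant
    vectors, or performs the exact divisions of fraction-free elimination. *)
Definition vcomb_body : exp := Eval vm_compute in proc (fun arg =>
  open5 arg (fun a b e xs ys =>
  CASE xs INT 0 PAIR x xs' IN
  open2 ys (fun y ys' =>
    (a * x + b * y) %/ e ,, call_ f_vcomb (a ,, b ,, e ,, xs' ,, ys')))).

Definition mcomb_body : exp := Eval vm_compute in proc (fun arg =>
  open5 arg (fun y xss cs gs es =>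
  CASE cs INT 0 PAIR c cs' IN
  open2 xss (fun x xss' => open2 gs (fun g gs' => open2 es (fun e es' =>
    call_ f_vcomb (c ,, g ,, e ,, x ,, y) ,,
    call_ f_mcomb (y ,, xss' ,, cs' ,, gs' ,, es')))))).

(** With a unit vector as coefficients and a zero base, this extracts a row of a matrix. *)
Definition lincomb_body : exp := Eval vm_compute in proc (fun arg =>
  open3 arg (fun base cs vs =>
  CASE cs INT base PAIR c cs' IN
  open2 vs (fun v vs' =>
    call_ f_vcomb (c ,, 1 ,, 1 ,, v ,, call_ f_lincomb (base ,, cs' ,, vs'))))).

Definition dots_body : exp := Eval vm_compute in proc (fun arg =>
  open2 arg (fun h vs =>
  CASE vs INT 0 PAIR v vs' IN
  call_ f_dot (h ,, v) ,, call_ f_dots (h ,, vs'))).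

Definition vmul_body : exp := Eval vm_compute in proc (fun arg =>
  open2 arg (fun xs ys =>
  CASE xs INT 0 PAIR x xs' IN
  open2 ys (fun y ys' => x * y ,, call_ f_vmul (xs' ,, ys')))).

Definition iota_body : exp := Eval vm_compute in proc (fun arg =>
  open2 arg (fun i k =>
  IFLE k 0 THEN 0 ELSE (i ,, call_ f_iota (i + 1 ,, k - 1)))).

Definition consts_body : exp := Eval vm_compute in proc (fun arg =>
  open2 arg (fun z k =>
  IFLE k 0 THEN 0 ELSE (z ,, call_ f_consts (z ,, k - 1)))).

Definition unit_body : exp := Eval vm_compute in proc (fun arg =>
  open2 arg (fun k ids =>
  CASE ids INT 0 PAIR i ids' IN
  (IFLE i k THEN (IFLE k i THEN 1 ELSE 0) ELSE 0) ,, call_ f_unit (k ,, ids'))).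

Definition units_body : exp := Eval vm_compute in proc (fun arg =>
  open2 arg (fun ks ids =>
  CASE ks INT 0 PAIR k ks' IN
  call_ f_unit (k ,, ids) ,, call_ f_units (ks' ,, ids))).

Definition prod_body : exp := Eval vm_compute in proc (fun xs =>
  CASE xs INT 1 PAIR x xs' IN x * call_ f_prod xs').

Definition dens_body : exp := Eval vm_compute in proc (fun rs =>
  CASE rs INT 1 PAIR r rs' IN
  open2 r (fun a b => b * call_ f_dens rs')).

Definition scale_body : exp := Eval vm_compute in proc (fun arg =>
  open2 arg (fun D rs =>
  CASE rs INT 0 PAIR r rs' IN
  open2 r (fun a b => a * (D %/ b) ,, call_ f_scale (D ,, rs')))).

(* Returns [(k, (- g_k, d_k))] where [k] minimizes [d_k / (- g_k)] among the
   indices with [g_k < 0]; the initial [(0, (0, 1))] stands for an infinite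
   ratio. *)
Definition ratio_body : exp := Eval vm_compute in proc (fun arg =>
  open3 arg (fun gs ds ids =>
  CASE gs INT (0 ,, 0 ,, 1) PAIR g gs' IN
  open2 ds (fun d ds' => open2 ids (fun i ids' =>
  LET best := call_ f_ratio (gs' ,, ds' ,, ids') IN
  IFLE 0 g THEN best ELSE
  open3 best (fun k bg bd =>
  IFLE (d * bg) ((0 - g) * bd) THEN (i ,, 0 - g ,, d) ELSE best))))).

Definition pos_body : exp := Eval vm_compute in proc (fun xs =>
  CASE xs INT 0 PAIR x xs' IN
  (IFLE 0 x THEN x ELSE 0) ,, call_ f_pos xs').

Definition wrap_body : exp := Eval vm_compute in proc (fun xs =>
  CASE xs INT 0 PAIR x xs' IN (x ,, 1) ,, call_ f_wrap xs').

Definition nth_body : exp := Eval vm_compute in proc (fun arg =>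
  open2 arg (fun xs k => open2 xs (fun x xs' =>
  IFLE k 0 THEN x ELSE call_ f_nth (xs' ,, k - 1)))).

Definition setdist_body : exp := Eval vm_compute in proc (fun arg =>
  open2 arg (fun row ss => open2 ss (fun s ss' =>
  LET x := call_ f_nth (row ,, s) IN
  CASE ss' INT x PAIR s' ss'' IN
  LET y := call_ f_setdist (row ,, ss') IN
  open2 x (fun a b => open2 y (fun a' b' =>
  IFLE (a * b') (a' * b) THEN x ELSE y))))).

Definition rhos_body : exp := Eval vm_compute in proc (fun arg =>
  open3 arg (fun ss rows rad =>
  CASE rows INT 0 PAIR row rows' IN
  open2 rad (fun r rad' => open2 r (fun c e =>
  open2 (call_ f_setdist (row ,, ss)) (fun a b =>
  (a * e ,, b * c) ,, call_ f_rhos (ss ,, rows' ,, rad')))))).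

(** Ratios are compared by cross multiplication; only points with a ratio strictly below [x / y]
    contribute their weight. *)
Definition mass_body : exp := Eval vm_compute in proc (fun arg =>
  open4 arg (fun x y rhos mu =>
  CASE rhos INT 0 PAIR r rhos' IN
  open2 r (fun xu yu => open2 mu (fun w mu' =>
  (IFLE (x * yu) (xu * y) THEN 0 ELSE w) + call_ f_mass (x ,, y ,, rhos' ,, mu'))))).

(** A point with negative [c] is never put into the covered set: subtracting [D] there would
    increase the product of the cut with [c]. *)
Definition hvec_body : exp := Eval vm_compute in proc (fun arg =>
  open7 arg (fun m D mu rhos0 rhos c pint =>
  CASE rhos INT 0 PAIR r rhos' IN
  open2 r (fun x y => open2 c (fun cv c' => open2 pint (fun pv pint' =>
  (IFLE 0 cv THEN
     (IFLE (call_ f_mass (x ,, y ,, rhos0 ,, mu)) m THEN pv - D ELSE pv)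
   ELSE pv) ,,
  call_ f_hvec (m ,, D ,, mu ,, rhos0 ,, rhos' ,, c' ,, pint')))))).

Definition hscale_body : exp := Eval vm_compute in proc (fun arg =>
  open2 arg (fun fs hs =>
  CASE hs INT 0 PAIR x hs' IN
  open2 x (fun y hS =>
  (call_ f_vmul (fs ,, y) ,, hS) ,, call_ f_hscale (fs ,, hs')))).

Definition htot_body : exp := Eval vm_compute in proc (fun arg =>
  open2 arg (fun ones hs =>
  CASE hs INT 0 PAIR x hs' IN
  open2 x (fun y hS => call_ f_dot (ones ,, y) + call_ f_htot (ones ,, hs')))).

Definition gcd_body : exp := Eval vm_compute in proc (fun arg =>
  open2 arg (fun a b =>
  IFLE b 0 THEN a ELSE call_ f_gcd (b ,, a - (a %/ b) * b))).

Definition setk_body : exp := Eval vm_compute in proc (fun arg =>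
  open4 arg (fun k x ids ts =>
  CASE ids INT 0 PAIR i ids' IN
  open2 ts (fun t ts' =>
  (IFLE i k THEN (IFLE k i THEN x ELSE t) ELSE t) ,,
  call_ f_setk (k ,, x ,, ids' ,, ts')))).

(** Rationals are encoded by reduced numerator and denominator, hence the gcd. Rows tagged by an
    integer are unit vectors and contribute no set. *)
Definition finish_body : exp := Eval vm_compute in proc (fun arg =>
  open3 arg (fun dl ts vs =>
  CASE ts INT 0 PAIR t ts' IN
  open2 vs (fun v vs' =>
  CASE t INT (call_ f_finish (dl ,, ts' ,, vs')) PAIR ss t0 IN
  open2 v (fun a v' =>
  LET g := call_ f_gcd (dl ,, a) IN
  (ss ,, a %/ g ,, dl %/ g) ,, call_ f_finish (dl ,, ts' ,, vs'))))).

(** A fraction-free simplex pivot. The first ratio call, with constant numerators, only detects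
    whether a coefficient of the new [rho] became negative; the second one chooses the row that
    leaves the basis. *)
Definition pur_body : exp := Eval vm_compute in proc (fun arg =>
  open6 arg (fun vs ts dl rho ctx hs =>
  CASE hs INT (call_ f_finish (dl ,, ts ,, vs)) PAIR item hs' IN
  open3 item (fun y h ss => open4 ctx (fun ones ones1 zeros1 ids1 =>
  LET v := 1 ,, h IN
  LET rho' := call_ f_vcomb (call_ f_dot (ones ,, y) ,, 1 ,, 1 ,, v ,, rho) IN
  open3 (call_ f_ratio (call_ f_dots (rho' ,, vs) ,, ones1 ,, ids1))
    (fun k0 g0 d0 =>
  IFLE g0 0 THEN call_ f_pur (vs ,, ts ,, dl ,, rho' ,, ctx ,, hs') ELSE
  LET G := call_ f_dots (v ,, vs) IN
  open3 (call_ f_ratio (G ,, call_ f_dots (rho ,, vs) ,, ids1))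
    (fun k g d =>
  LET u := call_ f_unit (k ,, ids1) IN
  LET vs' := call_ f_mcomb (call_ f_lincomb (zeros1 ,, u ,, vs) ,, vs ,,
     call_ f_vcomb (g ,, 0 ,, 1 ,, ones1 ,, ones1) ,,
     call_ f_vcomb (1 ,, 0 - dl ,, 1 ,, G ,, u) ,,
     call_ f_vcomb (dl ,, 0 ,, 1 ,, ones1 ,, ones1)) IN
  call_ f_pur (vs' ,, call_ f_setk (k ,, ss ,, ids1 ,, ts) ,, g ,, rho' ,,
    ctx ,, hs'))))))).

Definition purstart_body : exp := Eval vm_compute in proc (fun arg =>
  open3 arg (fun n phi hs =>
  open2 hs (fun item hs' => open3 item (fun y h ss =>
  LET n1 := n + 1 IN
  LET ones := call_ f_consts (1 ,, n) IN
  LET zeros := call_ f_consts (0 ,, n) IN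
  LET ones1 := call_ f_consts (1 ,, n1) IN
  LET zeros1 := call_ f_consts (0 ,, n1) IN
  LET ids1 := call_ f_iota (0 ,, n1) IN
  LET vs := call_ f_mcomb (call_ f_unit (0 ,, ids1) ,,
     call_ f_units (ids1 ,, ids1) ,, ones1 ,,
     (0 ,, call_ f_vcomb (int_ (-1) ,, 0 ,, 1 ,, h ,, h)) ,, ones1) IN
  LET rho := call_ f_vcomb (call_ f_dot (ones ,, y) ,, 1 ,, 1 ,,
     (1 ,, h) ,, (0 ,, phi)) IN
  call_ f_pur (vs ,, (ss ,, zeros) ,, 1 ,, rho ,,
    (ones ,, ones1 ,, zeros1 ,, ids1) ,, hs'))))).

Definition query_body : exp := Eval vm_compute in proc (fun arg =>
  open5 arg (fun c pint D ones inp =>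
  open6 inp (fun n dist rad prob spec nil =>
  LET mu0 := call_ f_pos c IN
  LET X := call_ f_dot (pint ,, mu0) IN
  open2 (IFLE X 0 THEN (ones ,, 0) ELSE (mu0 ,, (X - 1) %/ D)) (fun mu m =>
  LET ans := ask_ (n ,, dist ,, rad ,, call_ f_wrap mu ,, (m ,, 1) ,, spec ,, 0) IN
  CASE ans INT 0 PAIR ss t0 IN
  LET rh := call_ f_rhos (ss ,, dist ,, rad) IN
  call_ f_hvec (m ,, D ,, mu ,, rh ,, rh ,, c ,, pint) ,, ans)))).

(** The facets are not stored; [vs] is the transposed adjugate, whose rows are the vertices. Facet
    [K] is rotated, giving [vs1] with determinant [GK]; then the facets other than [K] are scaled,
    which multiplies the determinant by [P] and row [i] of [vs1] by [P / Ft i]. *)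
Definition update_body : exp := Eval vm_compute in proc (fun arg =>
  open4 arg (fun h ans st par =>
  open5 st (fun vs dl Qt phi hs => open6 par (fun q qN M2 ones zeros ids =>
  LET G := call_ f_dots (h ,, vs) IN
  open3 (call_ f_ratio (call_ f_vcomb (int_ (-1) ,, 0 ,, 1 ,, G ,, G) ,, ones ,, ids))
    (fun k g d =>
  LET B := IFLE (qN * (M2 * (Qt * g))) (q * dl) THEN qN
           ELSE ((q * dl) %/ (M2 * (Qt * g))) IN
  LET Bq := B * Qt IN
  LET nF := call_ f_vcomb (Bq ,, 0 - q * dl ,, dl ,, G ,, ones) IN
  LET F := call_ f_vcomb (int_ (-1) ,, 0 ,, 1 ,, nF ,, nF) IN
  LET u := call_ f_unit (k ,, ids) IN
  LET FK := call_ f_dot (F ,, u) IN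
  LET G' := call_ f_vcomb (Bq ,, FK * dl ,, 1 ,, G ,, u) IN
  LET GK := call_ f_dot (G' ,, u) IN
  LET vs1 := call_ f_mcomb (call_ f_lincomb (zeros ,, u ,, vs) ,, vs ,,
     call_ f_vcomb (GK ,, 0 ,, 1 ,, ones ,, ones) ,,
     call_ f_vcomb (int_ (-1) ,, dl ,, 1 ,, G' ,, u) ,,
     call_ f_vcomb (dl ,, 0 ,, 1 ,, ones ,, ones)) IN
  LET Ft := call_ f_vcomb (1 ,, 1 - FK ,, 1 ,, F ,, u) IN
  LET P := call_ f_prod Ft IN
  call_ f_mcomb (zeros ,, vs1 ,, call_ f_vcomb (P ,, 0 ,, 1 ,, ones ,, ones) ,,
     zeros ,, Ft) ,,
  P * GK ,, q * Qt ,, call_ f_vmul (F ,, phi) ,,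
  ((call_ f_vcomb (Bq ,, 0 ,, 1 ,, u ,, u) ,, h ,, ans) ,,
   call_ f_hscale (F ,, hs))))))).

Definition loop_body : exp := Eval vm_compute in proc (fun arg =>
  open6 arg (fun st par pint D N inp =>
  open5 st (fun vs dl Qt phi hs => open6 par (fun q qN M2 ones zeros ids =>
  CASE (call_ f_query (call_ f_lincomb (zeros ,, ones ,, vs) ,, pint ,, D ,,
    ones ,, inp)) INT 0 PAIR h ans IN
  LET st' := call_ f_update (h ,, ans ,, st ,, par) IN
  open5 st' (fun vs' dl' Qt' phi' hs' =>
  IFLE (N * Qt') (call_ f_htot (ones ,, hs')) THEN
    open2 inp (fun n r => (call_ f_purstart (n ,, phi' ,, hs') ,, 0))
  ELSE call_ f_loop (st' ,, par ,, pint ,, D ,, N ,, inp)))))).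

Definition main_body : exp := Eval vm_compute in proc (fun inp =>
  open6 inp (fun n dist rad prob spec nil =>
  LET D := call_ f_dens prob IN
  LET pint := call_ f_scale (D ,, prob) IN
  LET ones := call_ f_consts (1 ,, n) IN
  LET zeros := call_ f_consts (0 ,, n) IN
  LET ids := call_ f_iota (0 ,, n) IN
  LET b := int_ 4 * ((n + 1) * (D + 1)) IN
  LET N := call_ f_prod (call_ f_consts (b ,, n + 1)) IN
  LET q := call_ f_prod (call_ f_consts (b * N ,, n + int_ 4)) IN
  call_ f_loop
   ((call_ f_units (ids ,, ids) ,, 1 ,, 1 ,, ones ,, 0) ,,
    (q ,, q * N ,, int_ 2 * (n * n) ,, ones ,, zeros ,, ids) ,,
    pint ,, D ,, N ,, inp))).

Local Close Scope machine_scope.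

Definition prog : program := [:: main_body; dot_body; vcomb_body; mcomb_body;
  lincomb_body; dots_body; vmul_body; iota_body; consts_body; unit_body;
  units_body; prod_body; dens_body; scale_body; ratio_body; pos_body; wrap_body;
  nth_body; setdist_body; rhos_body; mass_body; hvec_body; hscale_body;
  htot_body; gcd_body; setk_body; finish_body; pur_body; purstart_body;
  query_body; update_body; loop_body].

(** * Bit lengths *)

Lemma bits_leE z k : (bits z <= k) = (`|z|%N < 2 ^ k).
Proof.
apply/idP/idP => [h|h]; last by apply: up_log_min.
have := @up_logP 2 `|z|%N.+1 isT; rewrite -/(bits z) => h'.
by apply: leq_trans h' _; rewrite leq_exp2l.
Qed.

Lemma bits_lt z : `|z|%N < 2 ^ bits z.
Proof. by rewrite -bits_leE. Qed.

Lemma bits0 : bits 0 = 0. Proof. by rewrite /bits /= up_log1. Qed.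
Lemma bits1 : bits 1 = 1. Proof. by rewrite /bits /= up_lognn. Qed.
Lemma bitsN z : bits (- z)%R = bits z. Proof. by rewrite /bits abszN. Qed.

Lemma bits_mono (a b : int) : (`|a|%N <= `|b|%N) -> bits a <= bits b.
Proof. by move=> h; rewrite /bits leq_up_log. Qed.

Lemma bits_D (a b : int) : bits (a + b)%R <= bits a + bits b.
Proof.
rewrite bits_leE expnD; have := bits_lt a; have := bits_lt b.
move: (2 ^ bits a) (2 ^ bits b) => x y hy hx.
have : `|(a + b)%R|%N <= `|a|%N + `|b|%N by lia.
nia.
Qed.

Lemma bits_B (a b : int) : bits (a - b)%R <= bits a + bits b.
Proof. by rewrite -(bitsN b); apply: bits_D. Qed.

Lemma bits_M (a b : int) : bits (a * b)%R <= bits a + bits b.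
Proof.
rewrite bits_leE expnD abszM; have := bits_lt a; have := bits_lt b.
move: (2 ^ bits a) (2 ^ bits b) => x y hy hx; nia.
Qed.

Lemma absz_divz_le (a b : int) : `|(a %/ b)%Z|%N <= `|a|%N.
Proof.
have [->|b0] := eqVneq b 0%R; first by rewrite divz0.
wlog: a b b0 / (0 < b)%R => [h|bp].
  have [bp|bn] := ltP 0%R b; first exact: h.
  have := h a (- b)%R; rewrite oppr_eq0 divzN abszN; apply=> //; lia.
have h := divz_eq a b; have h1 := modz_ge0 a b0; have h2 := ltz_pmod a bp.
nia.
Qed.

Lemma bits_Q (a b : int) : bits (a %/ b)%Z <= bits a.
Proof. exact/bits_mono/absz_divz_le. Qed.

Lemma bits_sum T (r : seq T) (f : T -> int) k :
  (forall i, bits (f i) <= k) -> bits (\sum_(i <- r) f i)%R <= k * size r.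
Proof.
move=> h; elim: r => [|x r IH]; first by rewrite big_nil bits0.
rewrite big_cons /= mulnS; apply: leq_trans (bits_D _ _) _.
by rewrite leq_add.
Qed.

Lemma bits_prod T (r : seq T) (f : T -> int) k :
  (forall i, bits (f i) <= k) -> bits (\prod_(i <- r) f i)%R <= (k * size r).+1.
Proof.
move=> h; elim: r => [|x r IH]; first by rewrite big_nil bits1.
rewrite big_cons /= mulnS; apply: leq_trans (bits_M _ _) _.
by rewrite -addnS leq_add.
Qed.

Lemma bits_nat n : bits n%:Z <= n.
Proof. by rewrite bits_leE /=; apply: ltn_expl. Qed.

Lemma bits_dot T (r : seq T) (f g : T -> int) k l :
  (forall i, bits (f i) <= k) -> (forall i, bits (g i) <= l) ->
  bits (\sum_(i <- r) f i * g i)%R <= (k + l) * size r.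
Proof.
move=> hf hg; apply: bits_sum => i.
by apply: leq_trans (bits_M _ _) _; apply: leq_add.
Qed.

(** * Symbolic evaluation *)

Notation posn n := (fun i : 'I_n => Posz i).
Notation "x ::: y" := (VPair x y) (at level 60, right associativity).

Definition encl T (f : T -> int) (r : seq T) : data :=
  enc_list [seq VInt (f i) | i <- r].
Definition encm T T' (f : T -> T' -> int) (r : seq T) (r' : seq T') : data :=
  enc_list [seq encl (f i) r' | i <- r].

Definition encq T (q : T -> rat) (r : seq T) : data :=
  enc_list [seq enc_rat (q i) | i <- r].
Definition encp T (X Y : T -> int) (r : seq T) : data :=
  enc_list [seq VInt (X i) ::: VInt (Y i) | i <- r].
Definition encd T (d : T -> data) (r : seq T) : data := enc_list [seq d i | i <- r].
Definition encx T T' (y : T -> T' -> int) (d : T -> data) (r : seq T)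
    (r' : seq T') : data :=
  enc_list [seq encl (y x) r' ::: (d x) | x <- r].

Lemma encl_cons T (f : T -> int) x r :
  encl f (x :: r) = VPair (VInt (f x)) (encl f r).
Proof. by []. Qed.

Lemma encl_nil T (f : T -> int) : encl f [::] = VInt 0. Proof. by []. Qed.

Lemma encm_cons T T' (f : T -> T' -> int) x r r' :
  encm f (x :: r) r' = VPair (encl (f x) r') (encm f r r').
Proof. by []. Qed.

Lemma encm_nil T T' (f : T -> T' -> int) r' : encm f [::] r' = VInt 0.
Proof. by []. Qed.

Lemma encl_ext T (f g : T -> int) r : f =1 g -> encl f r = encl g r.
Proof. by move=> h; congr enc_list; apply: eq_map => i; rewrite h. Qed.

Lemma encm_ext T T' (f g : T -> T' -> int) r r' :
  f =2 g -> encm f r r' = encm g r r'.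
Proof. by move=> h; congr enc_list; apply: eq_map => i; apply: encl_ext. Qed.

Section Evaluation.

Variables (A : blackbox) (Q : data -> Prop) (s : nat).

(* [s] bounds the bit length of every integer, so that every rule other than a
   query costs at most [(s + 2) ^ 2]; [Q] is the set of allowed queries. *)
Definition ev env e v n :=
  exists2 t, ceval A prog env e v t &
  forall T, (forall q, Q q -> bbtime A q <= T) -> t <= n * (s.+2 ^ 2 + T).

Definition pc f a v n :=
  exists body, onth prog f = Some body /\ ev [:: a] body v n.

Lemma ev_fin env e v n v' n' :
  ev env e v n -> v = v' -> n <= n' -> ev env e v' n'.
Proof.
move=> [t h1 h2] <- le; exists t => // T hT.
by apply: leq_trans (h2 T hT) _; rewrite leq_mul2r le orbT.
Qed.

Lemma ev_var env i v : onth env i = Some v -> ev env (EVar i) v 1.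
Proof. by move=> h; exists 1; [apply: eval_var | move=> T _; lia]. Qed.

Lemma ev_int env z : ev env (EInt z) (VInt z) 1.
Proof. by exists 1; [apply: eval_int | move=> T _; lia]. Qed.

Lemma ev_prim env o e1 e2 a b n1 n2 :
  ev env e1 (VInt a) n1 -> ev env e2 (VInt b) n2 ->
  bits a <= s -> bits b <= s ->
  ev env (EPrim o e1 e2) (VInt (prim_sem o a b)) (n1 + n2 + 1).
Proof.
move=> [t1 h1 c1] [t2 h2 c2] ba bb; eexists; first by apply: eval_prim h1 h2.
move=> T hT; have := c1 T hT; have := c2 T hT.
have : (bits a).+1 * (bits b).+1 <= s.+2 ^ 2 by rewrite -mulnn leq_mul //; lia.
lia.
Qed.

Lemma ev_pair env e1 e2 v1 v2 n1 n2 :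
  ev env e1 v1 n1 -> ev env e2 v2 n2 ->
  ev env (EPair e1 e2) (VPair v1 v2) (n1 + n2 + 1).
Proof.
move=> [t1 h1 c1] [t2 h2 c2]; eexists; first by apply: eval_pair h1 h2.
move=> T hT; have := c1 T hT; have := c2 T hT; lia.
Qed.

Lemma ev_let env e1 e2 v1 v2 n1 n2 :
  ev env e1 v1 n1 -> ev (v1 :: env) e2 v2 n2 ->
  ev env (ELet e1 e2) v2 (n1 + n2 + 1).
Proof.
move=> [t1 h1 c1] [t2 h2 c2]; eexists; first by apply: eval_let h1 h2.
move=> T hT; have := c1 T hT; have := c2 T hT; lia.
Qed.

Lemma ev_ifle env e1 e2 e3 e4 a b v n1 n2 n3 :
  ev env e1 (VInt a) n1 -> ev env e2 (VInt b) n2 ->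
  bits a <= s -> bits b <= s ->
  ev env (if (a <= b)%R then e3 else e4) v n3 ->
  ev env (EIfLe e1 e2 e3 e4) v (n1 + n2 + n3 + 1).
Proof.
move=> [t1 h1 c1] [t2 h2 c2] ba bb [t3 h3 c3].
eexists; first by apply: eval_ifle h1 h2 h3.
move=> T hT; have := c1 T hT; have := c2 T hT; have := c3 T hT.
have : (bits a + bits b).+1 <= s.+2 ^ 2 by rewrite -mulnn; nia.
lia.
Qed.

(** Postponing the choice of the branch lets the case rule be applied before the scrutinee is known
    to be an integer or a pair. *)
Definition ev_branch env v e1 e2 w m :=
  match v with VInt _ => ev env e1 w m | VPair a b => ev (a :: b :: env) e2 w m end.

Lemma ev_case env e e1 e2 v w n m :
  ev env e v n -> ev_branch env v e1 e2 w m ->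
  ev env (ECase e e1 e2) w (n + m + 1).
Proof.
case: v => [z|a b] [t1 h1 c1] [t2 h2 c2].
  eexists; first by apply: eval_case_int h1 h2.
  move=> T hT; have := c1 T hT; have := c2 T hT; lia.
eexists; first by apply: eval_case_pair h1 h2.
move=> T hT; have := c1 T hT; have := c2 T hT; lia.
Qed.

Lemma ev_call env f e a v n1 n2 :
  ev env e a n1 -> pc f a v n2 -> ev env (ECall f e) v (n1 + n2 + 1).
Proof.
move=> [t1 h1 c1] [body [hb [t2 h2 c2]]].
eexists; first by apply: eval_call h1 hb h2.
move=> T hT; have := c1 T hT; have := c2 T hT; lia.
Qed.

Lemma ev_ask env e q n :
  ev env e q n -> Q q -> dsize q <= s -> ev env (EAsk e) (answer A q) (n + 1).
Proof.
move=> [t1 h1 c1] hq hs; eexists; first by apply: eval_ask h1.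
move=> T hT; have := c1 T hT; have := hT _ hq.
have : s.+1 <= s.+2 ^ 2 by rewrite -mulnn; nia.
lia.
Qed.

Lemma pc_intro f body a v n v' n' :
  onth prog f = Some body -> ev [:: a] body v' n' -> v' = v -> n' <= n ->
  pc f a v n.
Proof. by move=> h1 h2 h3 h4; exists body; split=> //; apply: ev_fin h2 h3 h4. Qed.

End Evaluation.

(* Steps of evaluation; calls are left to their specification. *)
Ltac run1 :=
  lazymatch goal with
  | |- ev _ _ _ _ (EVar _) _ _ => eapply ev_var; reflexivity
  | |- ev _ _ _ _ (EInt _) _ _ => eapply ev_int
  | |- ev _ _ _ _ (EPair _ _) _ _ => eapply ev_pair
  | |- ev _ _ _ _ (ELet _ _) _ _ => eapply ev_let
  | |- ev _ _ _ _ (EPrim _ _ _) _ _ => eapply ev_prim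
  | |- ev _ _ _ _ (ECase _ _ _) _ _ => eapply ev_case
  | |- ev _ _ _ _ (ECall _ _) _ _ => eapply ev_call
  | |- ev _ _ _ _ (EIfLe _ _ _ _) _ _ => eapply ev_ifle
  | |- ev _ _ _ _ ?b _ _ => let b' := eval hnf in b in progress change b with b'
  | |- ev_branch _ _ _ _ (encl _ _) _ _ _ _ =>
      first [rewrite encl_nil | rewrite encl_cons]
  | |- ev_branch _ _ _ _ (encm _ _ _) _ _ _ _ =>
      first [rewrite encm_nil | rewrite encm_cons]
  | |- ev_branch _ _ _ _ (VInt _) _ _ _ _ => cbv beta iota delta [ev_branch]
  | |- ev_branch _ _ _ _ (VPair _ _) _ _ _ _ => cbv beta iota delta [ev_branch]
  end.
Ltac run := repeat run1.

(* Bounds the bit length of a compound integer by those of its parts. *)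
Ltac bnd1 :=
  match goal with
  | |- context [bits ?e] =>
    lazymatch e with
    | prim_sem _ _ _ => cbv beta iota delta [prim_sem]
    | GRing.opp ?a =>
        generalize (bitsN a : bits e = bits a); generalize (bits e)
    | GRing.add ?a ?b =>
        generalize (bits_D a b : bits e <= bits a + bits b); generalize (bits e)
    | GRing.mul ?a ?b =>
        generalize (bits_M a b : bits e <= bits a + bits b); generalize (bits e)
    | divz ?a ?b =>
        generalize (bits_Q a b : bits e <= bits a); generalize (bits e)
    | Posz 0 => rewrite bits0
    | Posz 1 => rewrite bits1
    | GRing.zero => generalize (bits0 : bits e = 0); generalize (bits e)
    | GRing.one _ => generalize (bits1 : bits e = 1); generalize (bits e)
    | ?f ?x ?y =>
        match goal with H : forall i j, is_true (bits (f i j) <= _) |- _ =>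
        generalize (H x y); generalize (bits e) end
    | ?f ?x =>
        match goal with H : forall i, is_true (bits (f i) <= _) |- _ =>
        generalize (H x); generalize (bits e) end
    end
  end.
Ltac bnd := repeat bnd1; intros; cbn [size] in *; first [lia | nia].
Ltac nil_case := by eapply pc_intro;
  [reflexivity | rewrite /encq /encp /encx /=; run | rewrite ?big_nil | simpl; lia].

(** * Specifications of the vector and matrix procedures *)

Section VectorProcedures.

Context {A : blackbox} {Q : data -> Prop} {s : nat}.
Notation pc := (pc A Q s).

(** The pattern of all specifications: a bound [k] on the bits of the inputs, enough room in [s] for
    the intermediate integers, and a generous count of steps, each of which stands for [(s + 2) ^ 2]
    plus the time of the black box. *)
Lemma spec_dot T (r : seq T) (f g : T -> int) k :
  (forall i, bits (f i) <= k) -> (forall i, bits (g i) <= k) ->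
  2 * k * (size r).+1 <= s ->
  pc f_dot (encl f r ::: encl g r) (VInt (\sum_(i <- r) f i * g i)%R)
     (30 * (size r).+1).
Proof.
move=> hf hg; elim: r => [|x r IH] hs; first by nil_case.
eapply pc_intro; first reflexivity.
- run; [bnd | bnd | apply: IH; bnd | bnd | ].
  by apply: leq_trans (bits_dot r hf hg) _; bnd.
- by rewrite /prim_sem big_cons.
- simpl; lia.
Qed.

Lemma spec_vcomb T (r : seq T) (f g : T -> int) (a b e : int) k :
  (forall i, bits (f i) <= k) -> (forall i, bits (g i) <= k) ->
  bits a <= k -> bits b <= k -> bits e <= k -> 4 * k <= s ->
  pc f_vcomb (VInt a ::: VInt b ::: VInt e :::
      encl f r ::: encl g r)
    (encl (fun i => (a * f i + b * g i) %/ e)%Z r) (40 * (size r).+1).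
Proof.
move=> hf hg ha hb he hs; elim: r => [|x r IH]; first by nil_case.
eapply pc_intro; [reflexivity | run; [bnd.. | exact: IH] | by [] | simpl; lia].
Qed.

Lemma spec_mcomb T T' (r : seq T) (r' : seq T') (f : T -> T' -> int)
    (y : T' -> int) (c g e : T -> int) k :
  (forall i j, bits (f i j) <= k) -> (forall j, bits (y j) <= k) ->
  (forall i, bits (c i) <= k) -> (forall i, bits (g i) <= k) ->
  (forall i, bits (e i) <= k) -> 4 * k <= s ->
  pc f_mcomb (encl y r' ::: encm f r r' ::: encl c r :::
      encl g r ::: encl e r)
    (encm (fun i j => (c i * f i j + g i * y j) %/ e i)%Z r r')
    (100 * (size r').+1 * (size r).+1).
Proof.
move=> hf hy hc hg he hs; elim: r => [|x r IH]; first by nil_case.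
eapply pc_intro; [reflexivity | run; [apply: (spec_vcomb r' (hf x) hy (hc x) (hg x) (he x) hs)
  | exact: IH] | by [] | simpl; lia].
Qed.

Lemma spec_lincomb T T' (r : seq T) (r' : seq T') (f : T -> T' -> int)
    (y : T' -> int) (c : T -> int) k :
  (forall i j, bits (f i j) <= k) -> (forall j, bits (y j) <= k) ->
  (forall i, bits (c i) <= k) -> (2 * k + 1) * (size r).+1 * 4 <= s ->
  pc f_lincomb (encl y r' ::: encl c r ::: encm f r r')
    (encl (fun j => y j + \sum_(i <- r) c i * f i j)%R r')
    (100 * (size r').+1 * (size r).+1).
Proof.
move=> hf hy hc; elim: r => [|x r IH] hs; eapply pc_intro.
- reflexivity.
- run.
- by apply: encl_ext => j; rewrite big_nil addr0.
- simpl; lia.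
- reflexivity.
- run; [apply: IH; simpl in hs; lia |].
  (* The partial sum has at most [k + 2 * k * size r] bits. *)
  apply: (@spec_vcomb _ _ _ _ _ _ _ ((2 * k + 1) * (size r).+1)).
  + by move=> j; bnd.
  + move=> j; have := bits_dot r hc (hf^~ j).
    by have := hy j; bnd.
  + by have := hc x; bnd.
  + bnd.
  + bnd.
  + simpl in hs; lia.
- apply: encl_ext => j; rewrite divz1 !mul1r big_cons; ring.
- simpl; lia.
Qed.
End VectorProcedures.

(** * Specifications of the procedures on lists, unit vectors and lists of rationals *)

Lemma encq_cons T (q : T -> rat) x r :
  encq q (x :: r) =
  (VInt (numq (q x)) ::: VInt (denq (q x))) ::: encq q r.
Proof. by []. Qed.

Lemma encp_cons T (X Y : T -> int) x r :
  encp X Y (x :: r) = (VInt (X x) ::: VInt (Y x)) ::: encp X Y r.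
Proof. by []. Qed.

Lemma encd_cons T (d : T -> data) x r :
  encd d (x :: r) = (d x) ::: encd d r.
Proof. by []. Qed.

Section ListProcedures.

Context {A : blackbox} {Q : data -> Prop} {s : nat}.
Notation pc := (pc A Q s).

Lemma spec_dots T T' (r : seq T) (r' : seq T') (f : T -> T' -> int)
    (h : T' -> int) k :
  (forall i j, bits (f i j) <= k) -> (forall j, bits (h j) <= k) ->
  2 * k * (size r').+1 <= s ->
  pc f_dots (encl h r' ::: encm f r r')
    (encl (fun i => \sum_(j <- r') h j * f i j)%R r)
    (60 * (size r').+1 * (size r).+1).
Proof.
move=> hf hh hs; elim: r => [|x r IH]; first by nil_case.
eapply pc_intro; [reflexivity | run; [exact: (spec_dot hh (hf x) hs) | exact: IH] | by [] |
  simpl; lia].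
Qed.

Lemma spec_vmul T (r : seq T) (f g : T -> int) k :
  (forall i, bits (f i) <= k) -> (forall i, bits (g i) <= k) -> k <= s ->
  pc f_vmul (encl f r ::: encl g r) (encl (fun i => f i * g i)%R r)
     (30 * (size r).+1).
Proof.
move=> hf hg hs; elim: r => [|x r IH]; first by nil_case.
eapply pc_intro; [reflexivity | run; [bnd.. | exact: IH] | by [] | simpl; lia].
Qed.

Lemma spec_iota i k : i + k < s ->
  pc f_iota (VInt i ::: VInt k) (encl Posz (iota i k)) (30 * k.+1).
Proof.
elim: k i => [|k IH] i hs; eapply pc_intro.
- reflexivity.
- by run; rewrite ?bits0 //=; run.
- by [].
- by [].
- reflexivity.
- have bi : bits i <= s by apply: leq_trans (bits_nat _) _; lia.
  have bk : bits k.+1 <= s by apply: leq_trans (bits_nat _) _; lia.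
  have b1 : bits 1 <= s by rewrite bits1; lia.
  have e1 : (i%:Z + 1 = i.+1)%R by lia.
  have e2 : (k.+1%:Z - 1 = k)%R by lia.
  run; rewrite ?bits0 //=; run; rewrite ?bits1 //=; try lia.
  rewrite e1 e2; apply: IH; lia.
- by [].
- simpl; lia.
Qed.

Lemma spec_consts T (r : seq T) z : size r < s ->
  pc f_consts (VInt z ::: VInt (size r)) (encl (fun=> z) r)
     (30 * (size r).+1).
Proof.
elim: r => [|x r IH] hs; eapply pc_intro.
- reflexivity.
- by run; rewrite ?bits0 //=; run.
- by [].
- by [].
- reflexivity.
- have bk : bits (size (x :: r)) <= s by apply: leq_trans (bits_nat _) _; lia.
  have e2 : ((size (x :: r))%:Z - 1 = size r)%R by rewrite /=; lia.
  run; rewrite ?bits0 //=; run; rewrite ?bits1 //=; try lia.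
  rewrite e2; apply: IH; simpl in hs; lia.
- by [].
- simpl; lia.
Qed.

Lemma spec_unit T (r : seq T) (f : T -> int) k l :
  (forall i, bits (f i) <= l) -> bits k <= s -> l <= s ->
  pc f_unit (VInt k ::: encl f r) (encl (fun i => Posz (f i == k)) r)
    (30 * (size r).+1).
Proof.
move=> hf hk hl; elim: r => [|x r IH]; first by nil_case.
eapply pc_intro; first reflexivity.
- have bx : bits (f x) <= s by apply: leq_trans (hf x) hl.
  run; [by [] .. | | exact: IH].
  instantiate (2 := VInt (f x == k)); instantiate (1 := 7).
  rewrite eq_le; case: (f x <= k)%R => /=; last by eapply ev_fin; [run | | ].
  eapply ev_fin; [run; [by [] ..|] | reflexivity | ].
    by case: (k <= f x)%R; run.
  by [].
- by [].
- simpl; lia.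
Qed.

Lemma spec_units T T' (r : seq T) (r' : seq T') (f : T -> int) (g : T' -> int) l :
  (forall i, bits (f i) <= l) -> (forall i, bits (g i) <= l) -> l <= s ->
  pc f_units (encl g r' ::: encl f r)
    (encm (fun j i => Posz (f i == g j)) r' r)
    (60 * (size r).+1 * (size r').+1).
Proof.
move=> hf hg hl; elim: r' => [|x r' IH]; first by nil_case.
eapply pc_intro; [reflexivity | run; [exact: (spec_unit _ hf (leq_trans (hg x) hl) hl) |
  exact: IH] | by [] | simpl; lia].
Qed.

Lemma spec_prod T (r : seq T) (f : T -> int) k :
  (forall i, bits (f i) <= k) -> (k * (size r).+1).+1 <= s ->
  pc f_prod (encl f r) (VInt (\prod_(i <- r) f i)%R) (20 * (size r).+1).
Proof.
move=> hf; elim: r => [|x r IH] hs; first by nil_case.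
eapply pc_intro; first reflexivity.
- run; [apply: IH; simpl in hs; nia | bnd |].
  by apply: leq_trans (bits_prod r hf) _; simpl in hs; nia.
- by rewrite /prim_sem big_cons.
- simpl; lia.
Qed.

Lemma spec_dens T (r : seq T) (q : T -> rat) k :
  (forall i, bits (denq (q i)) <= k) -> (k * (size r).+1).+1 <= s ->
  pc f_dens (encq q r) (VInt (\prod_(i <- r) denq (q i))%R) (30 * (size r).+1).
Proof.
move=> hf; elim: r => [|x r IH] hs; first by nil_case.
eapply pc_intro; first reflexivity.
- rewrite encq_cons; run; [apply: IH; simpl in hs; nia | |].
    by apply: leq_trans (hf x) _; simpl in hs; nia.
  by apply: leq_trans (bits_prod r hf) _; simpl in hs; nia.
- by rewrite /prim_sem big_cons.
- simpl; lia.
Qed.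

Lemma spec_scale T (r : seq T) (q : T -> rat) D k :
  (forall i, bits (denq (q i)) <= k) -> (forall i, bits (numq (q i)) <= k) ->
  bits D <= k -> k <= s ->
  pc f_scale (VInt D ::: encq q r)
    (encl (fun i => numq (q i) * (D %/ denq (q i))%Z)%R r) (40 * (size r).+1).
Proof.
move=> hd hn hD hk; elim: r => [|x r IH]; first by nil_case.
eapply pc_intro; first reflexivity.
- rewrite encq_cons; run; [| | | | exact: IH].
  + exact: leq_trans hD hk.
  + exact: leq_trans (hd x) hk.
  + exact: leq_trans (hn x) hk.
  + exact: leq_trans (bits_Q _ _) (leq_trans hD hk).
- by [].
- simpl; lia.
Qed.

Definition posz (x : int) : int := if (0 <= x)%R then x else 0.

Lemma spec_pos T (r : seq T) (f : T -> int) k :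
  (forall i, bits (f i) <= k) -> k <= s ->
  pc f_pos (encl f r) (encl (fun i => posz (f i)) r) (20 * (size r).+1).
Proof.
move=> hf hs; elim: r => [|x r IH]; first by nil_case.
eapply pc_intro; first reflexivity.
- run; [by rewrite bits0 | bnd | | exact: IH].
  instantiate (2 := VInt (posz (f x))); instantiate (1 := 1).
  by rewrite /posz; case: (0 <= f x)%R => /=; run.
- by [].
- simpl; lia.
Qed.

Lemma spec_wrap T (r : seq T) (f : T -> int) :
  pc f_wrap (encl f r) (encq (fun i => (f i)%:~R)%R r) (20 * (size r).+1).
Proof.
elim: r => [|x r IH]; first by nil_case.
eapply pc_intro; [reflexivity | run; exact: IH | by rewrite encq_cons numq_int denq_int |
  simpl; lia].
Qed.

Lemma spec_nth (vs : seq data) k : k < size vs -> k < s ->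
  pc f_nth (enc_list vs ::: VInt k) (nth (VInt 0) vs k) (20 * k.+1).
Proof.
elim: vs k => [|v vs IH] [|k] //= hk hs; eapply pc_intro.
- reflexivity.
- by run; rewrite ?bits0 //=; run.
- by [].
- by [].
- reflexivity.
- have bk : bits k.+1 <= s by apply: leq_trans (bits_nat _) _; lia.
  have e2 : (k.+1%:Z - 1 = k)%R by lia.
  run; rewrite ?bits0 //=; run; rewrite ?bits1 //=; try lia.
  rewrite e2.
  apply: IH; lia.
- by [].
- lia.
Qed.

End ListProcedures.

(** * Comparison of rationals, minima, the ratio test and the Euclidean algorithm *)

Lemma le_rat_cross (a b : rat) :
  (numq a * denq b <= numq b * denq a)%R = (a <= b)%R.
Proof.
rewrite -(divq_num_den a) -(divq_num_den b) ler_pdivrMr ?ltr0z ?denq_gt0 //.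
rewrite mulrAC ler_pdivlMr ?ltr0z ?denq_gt0 // -!intrM ler_int.
by rewrite !divq_num_den.
Qed.

(** After division by the gcd the pair is coprime with positive denominator, which is the normal
    form returned by [numq] and [denq]. *)
Lemma enc_rat_gcd (a d : nat) : 0 < d ->
  enc_rat (a%:~R / d%:~R)%R =
  VInt (a%:Z %/ (gcdn d a)%:Z)%Z ::: VInt (d%:Z %/ (gcdn d a)%:Z)%Z.
Proof.
move=> d0; have g0 : 0 < gcdn d a by rewrite gcdn_gt0 d0.
set g := gcdn d a in g0 *.
have [da ea] : exists a', a = a' * g by apply/dvdnP; apply: dvdn_gcdr.
have [dd ed] : exists d', d = d' * g by apply/dvdnP; apply: dvdn_gcdl.
have dd0 : 0 < dd by move: d0; rewrite ed muln_gt0 => /andP[].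
have co : coprime da dd.
  rewrite coprime_sym /coprime -(eqn_pmul2r g0) muln_gcdl -ed -ea mul1n.
  by rewrite /g.
rewrite !divz_nat {1 2}ea {1 2}ed !mulnK //.
have -> : ((da * g)%:Z%:~R / (dd * g)%:Z%:~R = da%:Z%:~R / dd%:Z%:~R :> rat)%R.
  rewrite !PoszM !intrM -mulf_div divff ?mulr1 // intr_eq0; lia.
rewrite /enc_rat coprimeq_num // coprimeq_den //.
rewrite (_ : (dd%:Z == 0)%R = false); last by lia.
by rewrite gtr0_sg ?mul1r ?ger0_norm //; lia.
Qed.

Lemma encx_cons T T' (y : T -> T' -> int) d x r (r' : seq T') :
  encx y d (x :: r) r' = (encl (y x) r' ::: (d x)) ::: encx y d r r'.
Proof. by []. Qed.

(** The head is a separate argument, so the minimum exists without a default value; the recursion is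
    that of the program. *)
Fixpoint setmin T (q : T -> rat) (x : T) (r : seq T) : rat :=
  if r is y :: r' then
    let m := setmin q y r' in if (q x <= m)%R then q x else m
  else q x.

Lemma setmin_le (T : eqType) (q : T -> rat) x r y :
  y \in x :: r -> (setmin q x r <= q y)%R.
Proof.
elim: r x => [|z r IH] x /=; first by rewrite inE => /eqP ->.
rewrite inE => /orP[/eqP ->|/IH h]; case: ifP => // hx.
  by rewrite ltW // ltNge hx.
exact: le_trans hx h.
Qed.

Lemma setmin_in (T : eqType) (q : T -> rat) x r :
  exists2 y, y \in x :: r & setmin q x r = q y.
Proof.
elim: r x => [|z r IH] x /=; first by exists x; rewrite ?mem_head.
have [y hy e] := IH z; case: ifP => _; first by exists x; rewrite ?mem_head.
by exists y; rewrite // inE hy orbT.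
Qed.

Section RatioProcedures.

Context {A : blackbox} {Q : data -> Prop} {s : nat}.
Notation pc := (pc A Q s).

(** One scan with three uses: the ratio test, the search for the most negative entry (all [d i]
    equal to 1), and the test whether a negative entry exists, which fails exactly when the returned
    [y] is 0. *)
Lemma spec_ratio (T : eqType) (r : seq T) (g d id : T -> int) k :
  (forall i, bits (g i) <= k) -> (forall i, bits (d i) <= k) ->
  (forall i, (0 <= d i)%R) -> 2 * k + 2 <= s ->
  exists x y z : int,
    pc f_ratio (encl g r ::: encl d r ::: encl id r)
      (VInt x ::: VInt y ::: VInt z) (60 * (size r).+1) /\
    ([/\ {in r, forall i, 0 <= g i}, x = 0, y = 0 & z = 1]%R \/
     exists K, [/\ K \in r, (g K < 0)%R,
       [/\ x = id K, y = - g K & z = d K]%R &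
       {in r, forall i, (g i < 0 -> d K * - g i <= d i * - g K)%R}]).
Proof.
move=> hg hd d0 hs; elim: r => [|a r [x [y [z [IH hok]]]]].
  exists 0, 0, 1; split; last by left.
  by eapply pc_intro; [reflexivity | run | by [] | by []].
have [by_ bz_] : bits y <= k.+1 /\ bits z <= k.+1.
  by case: hok => [[_ _ -> ->]|[K [_ _ [_ -> ->] _]]]; rewrite ?bits0 ?bits1 ?bitsN;
    split=> //; apply: leqW.
have [ga|ga] := leP 0%R (g a).
  exists x, y, z; split.
    eapply pc_intro; [reflexivity | | by [] | ].
      run; [exact: IH | by rewrite bits0 | by have := hg a; lia | ].
      by rewrite ga; run.
    simpl; lia.
  case: hok => [[h -> -> ->]|[K [hK gK e h]]]; [left|right].
    by split=> // i; rewrite inE => /orP[/eqP -> //|/h].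
  exists K; split; rewrite ?inE ?hK ?orbT // => i.
  by rewrite inE => /orP[/eqP ->|/h //]; rewrite ltNge ga.
have := leP (d a * y)%R ((0 - g a) * z)%R => cmp.
have xyz1 : pc f_ratio (encl g (a :: r) ::: encl d (a :: r) ::: encl id (a :: r))
   (if (d a * y <= (0 - g a) * z)%R then
      VInt (id a) ::: VInt (0 - g a)%R ::: VInt (d a)
    else VInt x ::: VInt y ::: VInt z)
   (60 * (size (a :: r)).+1).
  eapply pc_intro; [reflexivity | | reflexivity | ].
    run; [exact: IH | by rewrite bits0 | by have := hg a; lia | ].
    rewrite leNgt ga /=; run.
    1-6: by have := hg a; have := hd a; rewrite ?bits0; bnd.
    1-2: by have := hg a; have := hd a; bnd.
    instantiate (1 := 7); case: ifP => _; first by eapply ev_fin; [run; have := hg a;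
      rewrite ?bits0; bnd | reflexivity | ].
    by eapply ev_fin; [run | reflexivity | ].
  simpl; lia.
case: cmp xyz1 => cmp xyz1.
  exists (id a), (0 - g a)%R, (d a); split=> //; right; exists a.
  split; rewrite ?mem_head ?sub0r // => i; rewrite inE => /orP[/eqP -> //|hi gi].
  case: hok => [[h _ _ _]|[K [hK gK [_ e1 e2] h]]]; first by have := h _ hi; lia.
  (* Transitivity of the order of ratios: the two cross-multiplied inequalities are multiplied by
     [- g i] and [- g a], and the positive factor [- g K] is cancelled. *)
  have := h i hi gi; move: cmp; rewrite e1 e2 sub0r => c1 c2.
  have gK' : (0 < - g K)%R by lia.
  rewrite -(ler_pM2r gK'); have ga' : (0 < - g a)%R by lia.
  have c3 : (d a * - g K * - g i <= - g a * d K * - g i)%R by rewrite ler_pM2r //; lia.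
  have c4 : (- g a * (d K * - g i) <= - g a * (d i * - g K))%R by rewrite ler_pM2l.
  lia.
exists x, y, z; split=> //; case: hok => [[h ex ey ez]|[K [hK gK [ex ey ez] h]]].
  by move: cmp; rewrite ey ez; lia.
right; exists K; split; rewrite ?inE ?hK ?orbT // => i.
rewrite inE => /orP[/eqP -> _|/h //].
by move: cmp; rewrite ey ez sub0r; lia.
Qed.

(** Since [b <= a], the remainder [r] satisfies [2 r < b + r <= a], so the product of the two
    arguments more than halves in each call, and [j] bounds the depth of the recursion. *)
Lemma spec_gcd (a b : nat) j : b <= a -> a * b < 2 ^ j -> bits a <= s ->
  pc f_gcd (VInt a ::: VInt b) (VInt (gcdn a b)) (30 * j.+1).
Proof.
elim: j a b => [|j IH] a b hba hab hs.
  have -> : b = 0 by move: hab; rewrite expn0 ltnS leqn0 muln_eq0 => /orP[] /eqP; lia.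
  eapply pc_intro; [reflexivity | | reflexivity | ].
    by run; rewrite ?bits0 ?gcdn0 //=; run.
  by [].
have bb : bits b <= s by apply: leq_trans hs; apply: bits_mono; rewrite /=.
case: (posnP b) hba hab bb => [-> _ _ _|b0 hba hab bb].
  eapply pc_intro; [reflexivity | | reflexivity | ].
    by run; rewrite ?bits0 ?gcdn0 //=; run.
  lia.
have e1 : (a%:Z - (a%:Z %/ b%:Z)%Z * b%:Z = (a %% b)%N)%R.
  by rewrite divz_nat; have := divn_eq a b; lia.
have hm : b * (a %% b) < 2 ^ j.
  have := ltn_pmod a b0; move: hab; rewrite expnS {1}(divn_eq a b).
  have : 0 < a %/ b by rewrite divn_gt0.
  move: (a %/ b) (a %% b) => q m; nia.
eapply pc_intro; [reflexivity | | reflexivity | ].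
  run; rewrite ?bits0 //; rewrite leNgt ltz_nat b0 /=; run => //=.
  - exact: leq_trans (bits_Q _ _) hs.
  - apply: leq_trans hs; apply: bits_mono; rewrite divz_nat /=; exact: leq_divM.
  - rewrite e1 (gcdnC a) -gcdn_modr; apply: IH; rewrite ?(ltnW (ltn_pmod _ _)) //.
lia.
Qed.

End RatioProcedures.

(** * Specifications of the procedures for covered points, items and the final output *)

Section CoverProcedures.

Context {A : blackbox} {Q : data -> Prop} {s : nat}.
Notation pc := (pc A Q s).

Lemma spec_setdist n (q : 'I_n -> rat) x (r : seq 'I_n) k :
  (forall i, bits (numq (q i)) <= k) -> (forall i, bits (denq (q i)) <= k) ->
  2 * k <= s -> n < s ->
  pc f_setdist (encq q (enum 'I_n) ::: encl (posn n) (x :: r))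
    (enc_rat (setmin q x r)) (20 * (n + 5) * (size r).+1).
Proof.
move=> hn hd hk ns.
have hnth (i : 'I_n) :
    pc f_nth (encq q (enum 'I_n) ::: VInt (Posz i)) (enc_rat (q i)) (20 * i.+1).
  have -> : enc_rat (q i) = nth (VInt 0) [seq enc_rat (q j) | j <- enum 'I_n] i.
    by rewrite (nth_map i) ?nth_ord_enum ?size_enum_ord.
  apply: spec_nth; first by rewrite size_map size_enum_ord.
  exact: ltn_trans (ltn_ord i) ns.
elim: r x => [|y r IH] x.
  eapply pc_intro; [reflexivity | | reflexivity | ].
    rewrite encl_cons encl_nil; run; exact: hnth.
  by have := ltn_ord x; simpl; lia.
have [z _ e] := setmin_in q y r.
eapply pc_intro; [reflexivity | | reflexivity | ].
  rewrite !encl_cons; run; [exact: hnth | exact: IH | ].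
  rewrite e /enc_rat; run.
  1-4: by have := hn z; have := hd z; have := hn x; have := hd x; lia.
  1-2: by have := hn z; have := hd z; have := hn x; have := hd x; bnd.
  instantiate (1 := 1).
  by rewrite /prim_sem le_rat_cross /= e; case: ifP => _; run.
by have := ltn_ord x; simpl; lia.
Qed.

Lemma spec_rhos T n (r : seq T) (D : T -> 'I_n -> rat) (rad : T -> rat) x S k :
  (forall i j, bits (numq (D i j)) <= k) -> (forall i j, bits (denq (D i j)) <= k) ->
  (forall i, bits (numq (rad i)) <= k) -> (forall i, bits (denq (rad i)) <= k) ->
  2 * k <= s -> n < s ->
  pc f_rhos (encl (posn n) (x :: S) :::
      enc_list [seq encq (D i) (enum 'I_n) | i <- r] ::: encq rad r)
    (encp (fun i => numq (setmin (D i) x S) * denq (rad i))%R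
          (fun i => denq (setmin (D i) x S) * numq (rad i))%R r)
    (100 * (n + 5) * (size S).+1 * (size r).+1).
Proof.
move=> hn hd hrn hrd hk ns; elim: r => [|a r IH].
  eapply pc_intro; [reflexivity | | reflexivity | ].
    by rewrite /=; run.
  by simpl; lia.
have [z _ e] := setmin_in (D a) x S.
eapply pc_intro; [reflexivity | | | ].
- rewrite encq_cons /=; run.
  + exact: (spec_setdist x S (hn a) (hd a) hk ns).
  + rewrite e /enc_rat; run; [by have := hn a z; have := hd a z; have := hrn a; have := hrd a;
      lia .. | exact: IH].
- by rewrite encp_cons e.
- simpl; nia.
Qed.

Lemma spec_mass T (r : seq T) (X Y mu : T -> int) (x y : int) k :
  (forall i, bits (X i) <= k) -> (forall i, bits (Y i) <= k) ->
  (forall i, bits (mu i) <= k) -> bits x <= k -> bits y <= k ->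
  2 * k * (size r).+1 <= s ->
  pc f_mass (VInt x ::: VInt y ::: encp X Y r ::: encl mu r)
    (VInt (\sum_(i <- r) if (x * Y i <= X i * y)%R then 0 else mu i)%R)
    (60 * (size r).+1).
Proof.
move=> hX hY hmu hx hy; elim: r => [|a r IH] hs; first by nil_case.
eapply pc_intro; first reflexivity.
- rewrite encp_cons; run.
  1-4: by have := hX a; have := hY a; simpl in hs; nia.
  1-2: by have := hX a; have := hY a; bnd.
  + instantiate (2 := if (x * Y a <= X a * y)%R then 0%R else mu a).
    instantiate (1 := 1).
    by rewrite /prim_sem; case: ifP => _; run.
  + by apply: IH; simpl in hs; nia.
  + by case: (x * Y a <= X a * y)%R; rewrite ?bits0 //; have := hmu a; simpl in hs; nia.
  + apply: leq_trans (@bits_sum _ _ _ k _) _; last by simpl in hs; nia.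
    by move=> i; case: ifP => _; rewrite ?bits0.
- by rewrite big_cons.
- simpl; lia.
Qed.

(** For positive [Y], this is the weight of the points whose ratio [X / Y] is strictly below that of
    [i]. *)
Definition lighter T (r : seq T) (X Y mu : T -> int) i : int :=
  (\sum_(u <- r) if X i * Y u <= X u * Y i then 0 else mu u)%R.

Lemma spec_hvec T (r0 r : seq T) (X Y mu c pint : T -> int) (m D : int) k :
  (forall i, bits (X i) <= k) -> (forall i, bits (Y i) <= k) ->
  (forall i, bits (mu i) <= k) -> (forall i, bits (c i) <= k) ->
  (forall i, bits (pint i) <= k) -> bits m <= k -> bits D <= k ->
  2 * k * (size r0).+1 <= s ->
  pc f_hvec (VInt m ::: VInt D ::: encl mu r0 :::
      encp X Y r0 ::: encp X Y r ::: encl c r ::: encl pint r)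
    (encl (fun i => if ((0 <= c i) && (lighter r0 X Y mu i <= m))%R
                    then pint i - D else pint i)%R r)
    (200 * (size r0).+1 * (size r).+1).
Proof.
move=> hX hY hmu hc hp hm hD hs; elim: r => [|a r IH]; first by nil_case.
eapply pc_intro; first reflexivity.
- rewrite encp_cons; run; [by rewrite bits0 | by have := hc a; nia | | exact: IH].
  instantiate (2 := VInt (if ((0 <= c a) && (lighter r0 X Y mu a <= m))%R
     then pint a - D else pint a)%R).
  instantiate (1 := 60 * (size r0).+1 + 20).
  case: (0 <= c a)%R => /=; last by eapply ev_fin; [run | reflexivity | lia].
  eapply ev_fin; [run | reflexivity | ].
  + exact: (spec_mass hX hY hmu (hX a) (hY a) hs).
  + apply: leq_trans (@bits_sum _ _ _ k _) _; last by nia.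
    by move=> i; case: ifP => _; rewrite ?bits0.
  + by nia.
  + instantiate (1 := 3); rewrite -/(lighter r0 X Y mu a).
    case: ifP => _; last by eapply ev_fin; [run | reflexivity | lia].
    by eapply ev_fin; [run; have := hp a; nia | reflexivity | lia].
  + lia.
- by [].
- simpl; lia.
Qed.

Lemma spec_hscale (T : eqType) T' (r : seq T) (r' : seq T') (y : T -> T' -> int)
    (d : T -> data) (F : T' -> int) k :
  (forall x, x \in r -> forall i, bits (y x i) <= k) ->
  (forall i, bits (F i) <= k) -> k <= s ->
  pc f_hscale (encl F r' ::: encx y d r r')
    (encx (fun x i => F i * y x i)%R d r r') (60 * (size r').+1 * (size r).+1).
Proof.
move=> hy hF hk; elim: r hy => [|a r IH] hy; first by nil_case.
eapply pc_intro; first reflexivity.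
- rewrite encx_cons; run.
  + exact: (spec_vmul r' hF (hy a (mem_head _ _)) hk).
  + by apply: IH => x hx; apply: hy; rewrite inE hx orbT.
- by [].
- simpl; lia.
Qed.

Lemma spec_htot (T : eqType) T' (r : seq T) (r' : seq T') (y : T -> T' -> int)
    (d : T -> data) k :
  (forall x, x \in r -> forall i, bits (y x i) <= k) ->
  2 * k.+1 * (size r').+1 * (size r).+1 <= s ->
  pc f_htot (encl (fun=> 1%R) r' ::: encx y d r r')
    (VInt (\sum_(x <- r) \sum_(i <- r') y x i)%R) (60 * (size r').+1 * (size r).+1).
Proof.
move=> hy; elim: r hy => [|a r IH] hy hs; first by nil_case.
eapply pc_intro; first reflexivity.
- have hya := hy a (mem_head _ _).
  have hyr x : x \in r -> forall i, bits (y x i) <= k.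
    by move=> hx; apply: hy; rewrite inE hx orbT.
  rewrite encx_cons; run.
  + apply: (@spec_dot _ _ _ _ _ _ _ k.+1).
    * by move=> i; rewrite bits1.
    * by move=> i; apply: leqW.
    * by simpl in hs; nia.
  + by apply: IH => //; simpl in hs; nia.
  + under eq_bigr do rewrite mul1r.
    by apply: leq_trans (bits_sum _ hya) _; simpl in hs; nia.
  + rewrite big_seq_cond big_mkcond /=.
    apply: leq_trans (@bits_sum _ _ _ (k * size r') _) _; last by simpl in hs; nia.
    move=> x; rewrite andbT; case: ifP => hx; last by rewrite bits0.
    exact: (bits_sum _ (hyr x hx)).
- rewrite big_cons; congr VInt; congr GRing.add.
  by apply: eq_bigr => i _; rewrite mul1r.
- simpl; lia.
Qed.

Lemma spec_setk T (r : seq T) (id : T -> int) (t : T -> data) v (j : int) k :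
  (forall i, bits (id i) <= k) -> bits j <= k -> k <= s ->
  pc f_setk (VInt j ::: v ::: encl id r ::: encd t r)
    (encd (fun i => if id i == j then v else t i) r) (40 * (size r).+1).
Proof.
move=> hid hj hk; elim: r => [|a r IH]; first by nil_case.
eapply pc_intro; first reflexivity.
- rewrite encd_cons; run; [by have := hid a; lia | lia | | exact: IH].
  instantiate (2 := if id a == j then v else t a); instantiate (1 := 7).
  rewrite eq_le; case: (id a <= j)%R => /=; last by eapply ev_fin; [run | | ].
  eapply ev_fin; [run; [by have := hid a; lia.. | ] | reflexivity | ].
    by instantiate (1 := 1); case: ifP => _; run.
  by [].
- by rewrite encd_cons.
- simpl; lia.
Qed.

Definition weighted T T' (f : T -> T' -> int) (x0 : T') (dl : nat)
    (o : T -> option data) (r : seq T) : seq data :=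
  pmap (fun i => omap (fun S => S ::: enc_rat ((f i x0)%:~R / dl%:~R)%R) (o i)) r.

Lemma spec_finish T T' (r : seq T) (r' : seq T') (f : T -> T' -> int) (x0 : T')
    (dl : nat) (o : T -> option data) k :
  0 < dl -> bits dl <= k -> (forall i, o i -> 0 <= f i x0 <= dl%:Z)%R -> k <= s ->
  pc f_finish (VInt dl ::: encd (fun i => enc_option id (o i)) r :::
      encm f r (x0 :: r'))
    (enc_list (weighted f x0 dl o r)) (100 * k.+1 * (size r).+1).
Proof.
move=> dl0 hdl hf hk; elim: r => [|a r IH].
  eapply pc_intro; [reflexivity | | reflexivity | ]; first by rewrite /encd /=; run.
  by simpl; lia.
eapply pc_intro; [reflexivity | | reflexivity | ].
  rewrite encd_cons encm_cons; run.
  instantiate (1 := 80 * k.+1 + 100 * k.+1 * (size r).+1).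
  rewrite {1}/enc_option /weighted /=; case ea : (o a) => [S|] /=; last first.
    eapply ev_fin; [run; exact: IH | reflexivity | lia].
  have [v [ev vdl]] : exists v : nat, f a x0 = Posz v /\ v <= dl.
    by exists `|f a x0|%N; have := hf a; rewrite ea => /(_ isT); lia.
  have g0 : 0 < gcdn dl v by rewrite gcdn_gt0 dl0.
  have bg : bits (gcdn dl v) <= s.
    by apply: leq_trans (leq_trans hdl hk); apply: bits_mono; rewrite /= dvdn_leq ?dvdn_gcdl.
  have bv : bits v <= s by apply: leq_trans (leq_trans hdl hk); apply: bits_mono.
  rewrite encl_cons ev; eapply ev_fin; [run | | ].
  + apply: (@spec_gcd _ _ _ _ _ (bits dl + bits v)) => //.
      rewrite expnD; apply: ltn_mul; [exact: (bits_lt dl) | exact: (bits_lt v)].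
    exact: leq_trans hdl hk.
  + by [].
  + by [].
  + exact: leq_trans hdl hk.
  + by [].
  + exact: IH.
  + by rewrite enc_rat_gcd.
  + have : bits v <= k by apply: leq_trans hdl; apply: bits_mono.
    nia.
simpl; lia.
Qed.

End CoverProcedures.

(** * Determinants *)

Section Determinants.

Local Open Scope ring_scope.

(** Multiplication by [\adj W] from the left scales both sides by [\det W], which cancels in an
    integral domain. *)
Lemma adj_unique (R : idomainType) n (W X : 'M[R]_n) :
  \det W != 0 -> W *m X = (\det W)%:M -> X = \adj W.
Proof.
move=> d0 h; have : \adj W *m (W *m X) = \adj W *m (\det W)%:M by rewrite h.
rewrite mulmxA mul_adj_mx mul_scalar_mx mul_mx_scalar => e.
apply/matrixP => i j; move/matrixP/(_ i j): e; rewrite !mxE.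
exact: mulfI.
Qed.

Definition setrow (R : Type) n (W : 'M[R]_n) K (h : 'I_n -> R) : 'M[R]_n :=
  \matrix_(i, j) if i == K then h j else W i j.

Lemma cofactor_setrow (R : comNzRingType) n (W : 'M[R]_n) K h j :
  cofactor (setrow W K h) K j = cofactor W K j.
Proof.
rewrite /cofactor; congr (_ * \det _); apply/matrixP => a b.
by rewrite !mxE eq_sym (negbTE (neq_lift _ _)).
Qed.

Lemma det_setrow (R : comNzRingType) n (W : 'M[R]_n) K h :
  \det (setrow W K h) = \sum_j h j * \adj W j K.
Proof.
rewrite (expand_det_row _ K); apply: eq_bigr => j _.
by rewrite cofactor_setrow !mxE eqxx.
Qed.

Lemma mul_adj_sum (R : comNzRingType) n (W : 'M[R]_n) a i :
  \sum_j W a j * \adj W j i = \det W *+ (a == i).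
Proof. by have /matrixP/(_ a i) := mul_mx_adj W; rewrite !mxE. Qed.

Lemma adj_mul_sum (R : comNzRingType) n (W : 'M[R]_n) a i :
  \sum_j \adj W a j * W j i = \det W *+ (a == i).
Proof. by have /matrixP/(_ a i) := mul_adj_mx W; rewrite !mxE. Qed.

(** The Sherman-Morrison update of an inverse, without fractions. The right-hand side [X] satisfies
    [W' X = \det W \det W'] row by row; multiplying by [\adj W'] and cancelling [G K = \det W']
    gives the claim. It shows that dividing the updated integer matrix by [\det W] is exact. *)
Lemma adj_setrow (R : idomainType) n (W : 'M[R]_n) K h :
  let G i := \sum_j h j * \adj W j i in
  \det W != 0 -> G K != 0 -> forall i j,
  \adj (setrow W K h) j i * \det W =
  G K * \adj W j i - (G i - \det W *+ (i == K)) * \adj W j K.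
Proof.
move=> G dW GK i0 j0; set W' := setrow W K h.
have dW' : \det W' = G K by rewrite det_setrow.
pose c i := G i - \det W *+ (i == K).
pose X : 'M[R]_n := \matrix_(j, i) (G K * \adj W j i - c i * \adj W j K).
have XE j i : X j i = G K * \adj W j i - c i * \adj W j K by rewrite mxE.
have hX : W' *m X = (\det W * \det W')%:M.
  apply/matrixP => a i; rewrite [LHS]mxE [RHS]mxE.
  under eq_bigr do rewrite XE [W' _ _]mxE.
  have [->|ne] := eqVneq a K.
    rewrite (eq_bigr (fun j => G K * (h j * \adj W j i) -
      c i * (h j * \adj W j K))); last by move=> j _; rewrite -/G; ring.
    rewrite sumrB -!mulr_sumr -!/(G _) dW' (eq_sym K) /c.
    by case: (i == K); rewrite ?mulr1n ?mulr0n; ring.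
  rewrite (eq_bigr (fun j => G K * (W a j * \adj W j i) -
      c i * (W a j * \adj W j K))); last by move=> j _; ring.
  rewrite sumrB -!mulr_sumr !mul_adj_sum (negbTE ne) dW'.
  by case: (a == i); rewrite ?mulr1n ?mulr0n; ring.
have := congr1 (mulmx (\adj W')) hX.
rewrite mulmxA mul_adj_mx mul_scalar_mx mul_mx_scalar => /matrixP/(_ j0 i0).
rewrite [LHS]mxE [RHS]mxE XE dW' => e.
apply: (mulfI GK); rewrite /c in e; rewrite e; ring.
Qed.

Definition scalerows (R : comNzRingType) n (F : 'I_n -> R) (W : 'M[R]_n) : 'M[R]_n :=
  \matrix_(i, j) (F i * W i j).

Lemma det_scalerows (R : comNzRingType) n (F : 'I_n -> R) (W : 'M[R]_n) :
  \det (scalerows F W) = (\prod_i F i) * \det W.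
Proof.
have -> : scalerows F W = diag_mx (\row_i F i) *m W.
  by apply/matrixP => i j; rewrite mul_diag_mx !mxE.
by rewrite det_mulmx det_diag; congr (_ * _); apply: eq_bigr => i _; rewrite mxE.
Qed.

(** Each entry acquires the product of all factors other than [F i]; keeping [F i] on the left
    yields the exact quotient that the program computes. *)
Lemma adj_scalerows (R : idomainType) n (F : 'I_n -> R) (W : 'M[R]_n) i j :
  (forall i, F i != 0) -> \det W != 0 ->
  F i * \adj (scalerows F W) j i = (\prod_i F i) * \adj W j i.
Proof.
move=> F0 dW; pose X : 'M[R]_n := \matrix_(j, i) ((\prod_(l | l != i) F l) * \adj W j i).
have PF k : \prod_i F i = F k * \prod_(l | l != k) F l by rewrite (bigD1 k).
have -> : \adj (scalerows F W) = X.
  apply/esym/adj_unique; first by rewrite det_scalerows mulf_neq0 // prodf_seq_neq0;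
    apply/allP => l _; rewrite F0.
  apply/matrixP => a b; rewrite det_scalerows [LHS]mxE [RHS]mxE.
  rewrite (eq_bigr (fun l => (F a * \prod_(l | l != b) F l) * (W a l * \adj W l b))).
    by rewrite -mulr_sumr mul_adj_sum; case: eqP => [->|_];
      rewrite ?mulr0n ?mulr0 // (PF b) !mulr1n.
  by move=> l _; rewrite [scalerows _ _ _ _]mxE [X _ _]mxE; ring.
by rewrite [X _ _]mxE (PF i); ring.
Qed.

(** The crude bound from the Leibniz expansion suffices, as only its bit length matters. *)
Lemma det_bound n (W : 'M[int]_n) (M : int) :
  (forall i j, `|W i j| <= M) -> `|\det W| <= n`!%:R * M ^+ n.
Proof.
move=> hW; rewrite /determinant; apply: le_trans (ler_norm_sum _ _ _) _.
have -> : n`!%:R * M ^+ n = \sum_(s : 'S_n) M ^+ n.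
  by rewrite sumr_const card_Sn mulr_natl.
apply: ler_sum => s _; rewrite normrM normrX normrN1 expr1n mul1r normr_prod.
have -> : M ^+ n = \prod_(i < n) M by rewrite prodr_const card_ord.
by apply: ler_prod => i _; rewrite normr_ge0 hW.
Qed.

Lemma adj_bound n (W : 'M[int]_n) (M : int) i j : 1 <= M ->
  (forall i j, `|W i j| <= M) -> `|\adj W i j| <= n`!%:R * M ^+ n.-1.
Proof.
move=> M1 hW; rewrite mxE /cofactor normrM normrX normrN1 expr1n mul1r.
apply: le_trans (_ : n.-1`!%:R * M ^+ n.-1 <= _).
  by apply: det_bound => a b; rewrite !mxE.
rewrite ler_wpM2r ?exprn_ge0 ?(le_trans ler01) // ler_nat.
by case: n W i j hW => // n *; rewrite /= factS leq_pmull.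
Qed.

(* Here [e = s * s' = 1] or [-1]: the adjugate is carried up to a sign. *)
Lemma adj_update n (W : 'M[int]_n) (A : 'I_n -> 'I_n -> int) K h (sg s dl : int) :
  let G i := \sum_j h j * A i j in
  sg ^+ 2 = 1 -> s ^+ 2 = 1 ->
  (forall i j, A i j = sg * \adj W j i) -> dl = sg * \det W ->
  dl != 0 -> G K != 0 ->
  G K = sg * \det (setrow W K h) /\
  forall i j, s * G K * A i j + - s * (G i - dl * (i == K)%:Z) * A K j =
    s * sg * \adj (setrow W K h) j i * dl.
Proof.
move=> G sg2 s2 hA hdl dl0 GK.
pose g i := \sum_j h j * \adj W j i.
have eG i : G i = sg * g i.
  by rewrite mulr_sumr; apply: eq_bigr => j _; rewrite hA; ring.
split; first by rewrite eG det_setrow.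
move=> i j; have dW : \det W != 0 by apply: contraNneq dl0; rewrite hdl => ->; rewrite mulr0.
have GK' : g K != 0.
  by apply: contraNneq GK; rewrite eG => ->; rewrite mulr0.
have e : \adj (setrow W K h) j i * \det W =
    g K * \adj W j i - (g i - \det W *+ (i == K)) * \adj W j K by exact: adj_setrow.
rewrite hdl !eG !hA.
transitivity (s * sg ^+ 2 * (\adj (setrow W K h) j i * \det W)); last by ring.
rewrite e; move: (g K) (g i) (\adj _ _ _) (\adj _ _ _) => gK gi a1 a2.
case: (i == K); rewrite ?mulr1n ?mulr0n /= ?mulr1 ?mulr0; ring.
Qed.

End Determinants.

(** * Shrinking simplices *)

Section Growth.

Local Open Scope ring_scope.

Lemma bernoulli_prod (R : realFieldType) I (r : seq I) (P : pred I) (e : I -> R) :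
  (forall i, P i -> 0 <= e i) ->
  1 + \sum_(i <- r | P i) e i <= \prod_(i <- r | P i) (1 + e i).
Proof.
move=> he; elim: r => [|x r IH]; first by rewrite !big_nil addr0.
rewrite !big_cons; case: ifP => // /he ex.
have : 0 <= \sum_(i <- r | P i) e i by apply: sumr_ge0.
move: IH; move: (\sum_(i <- r | P i) _) (\prod_(i <- r | P i) _) => S0 P0 h1 h2.
nra.
Qed.

Lemma bernoulli_exp (R : realFieldType) (x : R) m :
  0 <= x <= 1 -> 1 - m%:R * x <= (1 - x) ^+ m.
Proof.
move=> /andP[x0 x1]; elim: m => [|m IH]; first by rewrite mul0r subr0 expr0.
rewrite exprS.
have : (1 - x) * (1 - m%:R * x) <= (1 - x) * (1 - x) ^+ m.
  by apply: ler_wpM2l => //; rewrite subr_ge0.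
apply: le_trans; have : 0 <= (m%:R : R) by rewrite ler0n.
rewrite -natr1; nra.
Qed.

(* The factor by which a cut through the center shrinks the simplex, once the
   facet opposite to vertex [K] is rotated. *)
Lemma simplex_growth (R : realFieldType) n (x : 'I_n -> R) K :
  0 <= x K -> 2%:R * n%:R ^+ 2 * x K <= 1 -> (forall i, x i <= x K) ->
  \sum_i x i <= 0 ->
  1 + x K / 2%:R <= \prod_(i | i != K) (1 - x i).
Proof.
move=> x0 xn hx hs; set c := x K in x0 xn hx *.
have n1 : 1 <= n%:R :> R by rewrite ler1n (leq_ltn_trans _ (ltn_ord K)).
have c1 : c <= 1 by nra.
have e0 i : 0 <= c - x i by rewrite subr_ge0.
(* The product [(1 - c) (1 + (c - x i))] equals [1 - x i - c (c - x i)], so passing to it isolates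
   the nonnegative excesses [c - x i]. *)
have h1 : \prod_(i | i != K) ((1 - c) * (1 + (c - x i))) <= \prod_(i | i != K) (1 - x i).
  apply: ler_prod => i _; have := e0 i => ei.
  apply/andP; split; first by apply: mulr_ge0; lra.
  nra.
apply: le_trans h1; rewrite big_split /= prodr_const.
have cardK : #|[pred i : 'I_n | i != K]| = n.-1 by rewrite cardC1 card_ord.
rewrite [X in _ ^+ X](_ : _ = n.-1); last by rewrite -cardK; apply: eq_card.
have h2 := @bernoulli_exp _ c n.-1 _; have {}h2 := h2 ltac:(by rewrite x0).
have h3 := @bernoulli_prod _ _ (index_enum 'I_n) (fun i => i != K) _ (fun i _ => e0 i).
(* As all [x i] sum to at most 0, those with [i != K] sum to at most [- c]. *)
have h4 : n%:R * c <= \sum_(i | i != K) (c - x i).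
  rewrite sumrB sumr_const [X in c *+ X](_ : _ = n.-1); last by rewrite -cardK; apply: eq_card.
  move: hs; rewrite (bigD1 K) //= -/c => hs.
  have -> : n%:R * c = c + c *+ n.-1.
    by rewrite -mulrS prednK ?mulr_natl // (leq_ltn_trans _ (ltn_ord K)).
  lra.
have en : (n%:R = n.-1%:R + 1 :> R) by rewrite natr1 prednK // (leq_ltn_trans _ (ltn_ord K)).
have m0 : 0 <= (n.-1%:R : R) by rewrite ler0n.
have p1 : 1 + n%:R * c <= \prod_(i | i != K) (1 + (c - x i)) by apply: le_trans h3; lra.
(* This product is [1 + c - n (n - 1) c ^ 2], and [2 n ^ 2 c <= 1] limits the loss to [c / 2]. *)
apply: le_trans (_ : (1 - n.-1%:R * c) * (1 + n%:R * c) <= _); last first.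
  apply: ler_pM => //; last by nra.
  nra.
rewrite en in xn *; move: (n.-1%:R : R) m0 xn => m m0 xn; nra.
Qed.

End Growth.

(* A cut [h] found with the set [S], and the multiplicities [y] with which it
   enters the facets of the current simplex. *)
Definition item n := ({ffun 'I_n -> int} * {ffun 'I_n -> int} * {set 'I_n})%type.

(** The inequality [(1 + 1 / m) ^ m >= 2], raised to the power [k] and cleared of denominators. *)
Lemma exp2_le_succ (m k : nat) : 0 < m ->
  (2 ^+ k * m%:Z ^+ (m * k)%N <= (m%:Z + 1) ^+ (m * k)%N)%R.
Proof.
move=> m0; rewrite !exprM -exprMn; apply: lerXn2r; rewrite ?nnegrE.
- by apply: mulr_ge0 => //; apply: exprn_ge0.
- by apply: exprn_ge0.
have m0' : (0 < m%:R :> rat)%R by rewrite ltr0n.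
have h := @bernoulli_prod rat _ (index_enum 'I_m) xpredT (fun=> m%:R^-1)%R
  (fun _ _ => ltac:(by rewrite invr_ge0 ltW)).
rewrite sumr_const prodr_const card_ord -[X in (1 + X)%R]mulr_natl mulfV ?gt_eqF // in h.
rewrite -(ler_int rat) intrM !rmorphXn /= intrD.
have -> : (m%:Z%:~R + 1%:~R = m%:Z%:~R * (1 + m%:R^-1) :> rat)%R.
  by rewrite mulrDr mulr1 pmulrn divff ?gt_eqF.
by rewrite exprMn mulrC ler_wpM2l // exprn_ge0 // ler0z.
Qed.

Definition scale_item n (F : 'I_n -> int) (x : item n) : item n :=
  ([ffun i => (F i * x.1.1 i)%R], x.1.2, x.2).

Section Simplices.

Local Open Scope ring_scope.

Variables (n : nat) (D N Wm q : int) (kap : nat).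

(* Row [i] is the functional of the facet opposite to vertex [i]. *)
Definition facets (phi : 'I_n -> int) (Hs : seq (item n)) : 'M[int]_n :=
  \matrix_(i, j) (phi i *+ (i == j) + \sum_(x <- Hs) x.1.1 i * x.1.2 j).

Definition ytot (Hs : seq (item n)) : int := \sum_(x <- Hs) \sum_i x.1.1 i.

(** Growth by [1 + 1 / (8 n ^ 2)] at least doubles the determinant in [8 n ^ 2] steps, and [kap]
    doublings exceed its bound. *)
Definition tmax := (8 * n ^ 2 * kap)%N.

(* [q] is the precision to which the scaling factors are rounded, and [Wm] bounds
   the normalized entries of [facets] as long as the cuts have multiplicity
   less than [N] in total. *)
Record params : Prop := Params {
  par_D : 1 <= D;
  par_N : 1 <= N;
  par_q : 1 <= q;
  par_Wm : 2 + 2 * D * N <= Wm;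
  par_time : tmax%:Z * n%:Z * Wm <= q;
  par_slope : 2 * n%:Z ^+ 2 * n%:Z * D * n`!%:R * Wm ^+ n.-1 <= q;
  par_kap : n`!%:R * Wm ^+ n < 2 ^+ kap }.

Hypothesis par : params.
Let D_ge1 := par_D par.
Let N_ge1 := par_N par.
Let q_ge1 := par_q par.
Let Wm_ge := par_Wm par.
Let q_ge_time := par_time par.
Let q_ge_slope := par_slope par.
Let kap_ge := par_kap par.

Record cuts_ok (phi : 'I_n -> int) (Hs : seq (item n)) : Prop := CutsOk {
  phi_gt0 : forall i, 0 < phi i;
  y_ge0 : forall x, x \in Hs -> forall i, 0 <= x.1.1 i;
  h_le : forall x, x \in Hs -> forall j, `|x.1.2 j| <= D }.

(** All column sums equal [q ^ t] up to the relative error [t n Wm / q]: the normalization of the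
    simplex, with an error of [n Wm / q] for the rounding of each step. *)
Definition centered t phi Hs := forall j,
  q * `|\sum_i facets phi Hs i j - q ^+ t| <= t%:Z * n%:Z * Wm * q ^+ t.

Definition grown t phi Hs :=
  (8 * n%:Z ^+ 2 + 1) ^+ t * q ^+ (t * n) <= (8 * n%:Z ^+ 2) ^+ t * \det (facets phi Hs).

Let q_gt0 : 0 < q. Proof. lia. Qed.
Let qt_gt0 t : 0 < q ^+ t. Proof. exact: exprn_gt0. Qed.

Lemma y_le_ytot phi Hs x i : cuts_ok phi Hs -> x \in Hs -> x.1.1 i <= ytot Hs.
Proof.
move=> ok hx; rewrite /ytot (big_rem x) //= (bigD1 i) //= -addrA lerDl.
apply: addr_ge0; first by apply: sumr_ge0 => j _; apply: (y_ge0 ok).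
rewrite big_seq; apply: sumr_ge0 => z /mem_rem hz.
by apply: sumr_ge0 => j _; apply: (y_ge0 ok).
Qed.

Lemma colsumE phi Hs j :
  \sum_i facets phi Hs i j = phi j + \sum_(x <- Hs) (\sum_i x.1.1 i) * x.1.2 j.
Proof.
under eq_bigr do rewrite mxE.
rewrite big_split /= exchange_big /= (bigD1 j) //= eqxx mulr1n big1 => [|i ij]; last first.
  by rewrite (negbTE ij).
by rewrite addr0; congr (_ + _); apply: eq_bigr => x _; rewrite mulr_suml.
Qed.

(** The coefficients are left free because two choices occur: the total multiplicity of an item for
    column sums, and its multiplicity in one row for single entries. *)
Lemma cutsum_le phi Hs (c : item n -> int) j : cuts_ok phi Hs ->
  {in Hs, forall x, 0 <= c x <= \sum_i x.1.1 i} ->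
  `|\sum_(x <- Hs) c x * x.1.2 j| <= D * ytot Hs.
Proof.
move=> ok hc; apply: le_trans (ler_norm_sum _ _ _) _.
rewrite /ytot mulr_sumr big_seq [X in _ <= X]big_seq; apply: ler_sum => x hx.
have /andP[c0 c1] := hc x hx; rewrite normrM (ger0_norm c0) mulrC.
by apply: ler_pM => //; apply: (h_le ok hx).
Qed.

(** By [par_time] the rounding errors of all [tmax] steps together stay below [q ^ t], so column
    sums lie between 0 and [2 q ^ t]. *)
Lemma centered_sum t phi Hs j : centered t phi Hs -> (t <= tmax)%N ->
  `|\sum_i facets phi Hs i j - q ^+ t| <= q ^+ t.
Proof.
move=> hc ht; rewrite -(ler_pM2l q_gt0); apply: le_trans (hc j) _.
rewrite ler_pM2r //; apply: le_trans q_ge_time.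
rewrite -!mulrA ler_wpM2r ?mulr_ge0 ?lez_nat //; nia.
Qed.

Lemma phi_le t phi Hs j : cuts_ok phi Hs -> centered t phi Hs -> (t <= tmax)%N ->
  phi j <= 2 * q ^+ t + D * ytot Hs.
Proof.
move=> ok hc ht; have := centered_sum j hc ht; rewrite colsumE.
have := @cutsum_le _ _ (fun x => \sum_i x.1.1 i) j ok.
set S := \sum_(x <- Hs) _ => h.
have : `|S| <= D * ytot Hs.
  by apply: h => x hx; rewrite lexx andbT sumr_ge0 // => i _; apply: (y_ge0 ok).
lia.
Qed.

(** A diagonal term is at most [2 q ^ t + D ytot] and the cuts add at most [D ytot], whence the
    value [2 + 2 D N] in [par_Wm]. *)
Lemma facets_le t phi Hs i j : cuts_ok phi Hs -> centered t phi Hs ->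
  (t <= tmax)%N -> ytot Hs < N * q ^+ t -> `|facets phi Hs i j| <= Wm * q ^+ t.
Proof.
move=> ok hc ht hy; rewrite mxE.
have h1 := phi_le i ok hc ht; have h0 := phi_gt0 ok i.
have h2 := @cutsum_le _ _ (fun x => x.1.1 i) j ok.
have {}h2 : `|\sum_(x <- Hs) x.1.1 i * x.1.2 j| <= D * ytot Hs.
  apply: h2 => x hx; rewrite (y_ge0 ok hx) /= (bigD1 i) //= lerDl sumr_ge0 // => k _.
  exact: (y_ge0 ok hx).
have h3 : `|phi i *+ (i == j)| <= phi i.
  by case: (i == j); rewrite ?mulr1n ?mulr0n ?normr0 ?gtr0_norm // ltW.
apply: le_trans (ler_normD _ _) _.
have h4 : D * ytot Hs <= D * N * q ^+ t by rewrite -mulrA ler_wpM2l ?ltW //; lia.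
have h5 : (2 + 2 * D * N) * q ^+ t <= Wm * q ^+ t by rewrite ler_pM2r.
lia.
Qed.

(** At time [tmax] the normalized determinant would be at least [2 ^ kap], whereas the entries
    bounded by [Wm] allow at most [n! Wm ^ n]. *)
Lemma grown_time t phi Hs : (0 < n)%N -> cuts_ok phi Hs -> centered t phi Hs ->
  (t <= tmax)%N -> ytot Hs < N * q ^+ t -> grown t phi Hs -> (t < tmax)%N.
Proof.
move=> n0 ok hc ht hy hg; rewrite ltnNge; apply/negP => ht'.
have {ht ht'} e : t = tmax by apply/eqP; rewrite eqn_leq ht.
have h1 := det_bound (fun i j => @facets_le t phi Hs i j ok hc (eq_leq e) hy).
have {}h1 : \det (facets phi Hs) <= n`!%:R * Wm ^+ n * q ^+ (t * n).
  by apply: le_trans (ler_norm _) _; rewrite exprM -mulrA -exprMn.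
set m := 8 * n%:Z ^+ 2 in hg; have m0 : 1 <= m by rewrite /m; nia.
have h2 : 2 ^+ kap * m ^+ t <= (m + 1) ^+ t.
  rewrite (_ : t = (`|m|%N * kap)%N); last by rewrite e /tmax /m; congr muln; lia.
  rewrite (_ : m = `|m|%N%:Z); last by lia.
  by apply: exp2_le_succ; lia.
have h3 : (m + 1) ^+ t <= n`!%:R * Wm ^+ n * m ^+ t.
  rewrite -(ler_pM2r (qt_gt0 (t * n))); apply: le_trans hg _.
  by rewrite mulrAC mulrC ler_wpM2r // exprn_ge0 //; lia.
have h4 : 2 ^+ kap * m ^+ t <= n`!%:R * Wm ^+ n * m ^+ t by apply: le_trans h2 h3.
by move: h4; rewrite ler_pM2r ?exprn_gt0 // leNgt kap_ge.
Qed.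

Section Step.

Variables (t : nat) (phi : 'I_n -> int) (Hs : seq (item n)).
Variables (h : 'I_n -> int) (S : {set 'I_n}) (K : 'I_n) (g : int).

Let W := facets phi Hs.
Let dl := \det W.
Let Qt := q ^+ t.
Let M2 := 2 * (n%:Z * n%:Z).

(** The value of the cut at vertex [i], which is column [i] of the adjugate. *)
Definition step_G i := \sum_j h j * \adj W j i.
Notation G := step_G.
(** The new cut enters facet [K] with multiplicity [B * Qt], as large as [2 n ^ 2 Bq G i <= q dl]
    permits. The cap [q * N] is the value at which the new cut alone has multiplicity
    [N q ^ (t + 1)], so that the loop ends; it also covers [g = 0], where no vertex lies on the
    positive side of the cut. *)
Definition step_B :=
  if q * N * (M2 * (Qt * g)) <= q * dl then q * N else ((q * dl) %/ (M2 * (Qt * g)))%Z.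
Definition step_Bq := step_B * Qt.
Notation Bq := step_Bq.
(** The ceiling of [q - Bq G i / dl]. Without rounding, these factors would multiply all column sums
    by exactly [q], because the rows of [W] weighted by [G] add up to [dl h]. *)
Definition step_F i : int := - ((Bq * G i - q * dl) %/ dl)%Z.
Notation F := step_F.
Definition step_phi i := F i * phi i.
Definition step_Hs : seq (item n) :=
  (([ffun i => Bq * (i == K)%:Z], finfun h, S) : item n) ::
  map (scale_item F) Hs.
Definition step_row j := F K * W K j + Bq * h j.
(** Row [K] is not scaled again, since [step_row] already contains its factor. *)
Definition step_scale i := if i == K then 1 else F i.

Hypotheses (ok : cuts_ok phi Hs) (hc : centered t phi Hs) (ht : (t <= tmax)%N).
Hypotheses (hy : ytot Hs < N * q ^+ t) (hg : grown t phi Hs).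
Hypotheses (h_bound : forall j, `|h j| <= D) (G_le : forall i, G i <= g).
Hypothesis g_eq : g = 0 \/ 0 < g /\ g = G K.
Hypothesis G_sum : \sum_i G i <= 0.

Let n_gt0 : (0 < n)%N. Proof. exact: leq_ltn_trans (ltn_ord K). Qed.

Lemma qtn_le_det : Qt ^+ n <= dl.
Proof.
have m1 : 0 < (8 * n%:Z ^+ 2) ^+ t by apply: exprn_gt0; nia.
rewrite -(ler_pM2l m1); apply: le_trans hg; rewrite /Qt -exprM.
apply: ler_wpM2r; first by rewrite exprn_ge0 // ltW.
by have m0 : 0 <= 8 * n%:Z ^+ 2 by []; apply: lerXn2r; rewrite ?nnegrE //; lia.
Qed.

Lemma det_facets_gt0 : 0 < dl.
Proof. by apply: lt_le_trans qtn_le_det; apply: exprn_gt0; apply: qt_gt0. Qed.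
Let dl_gt0 := det_facets_gt0.
Let Qt_gt0 : 0 < Qt. Proof. exact: qt_gt0. Qed.
Let M2_gt0 : 0 < M2. Proof. by rewrite /M2; nia. Qed.
Let qdl_ge0 : 0 <= q * dl. Proof. by rewrite mulr_ge0 // ltW. Qed.

Lemma step_B_ge0 : 0 <= step_B.
Proof.
rewrite /step_B; case: ifP => // hh; first by apply: mulr_ge0; lia.
case: g_eq => [g0|[gp _]]; first by move: hh; rewrite g0 !mulr0 qdl_ge0.
rewrite divz_ge0 ?qdl_ge0 //.
by rewrite mulr_gt0 ?mulr_gt0 // /M2; nia.
Qed.

Lemma step_slope i : M2 * (Bq * G i) <= q * dl.
Proof.
have B0 := step_B_ge0; have Qt0 := Qt_gt0.
have M20 := M2_gt0.
have h1 : M2 * (Bq * G i) <= step_B * (M2 * (Qt * g)).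
  have -> : step_B * (M2 * (Qt * g)) = M2 * (step_B * Qt * g) by ring.
  rewrite /step_Bq ler_pM2l //; apply: ler_wpM2l => //.
  by rewrite mulr_ge0 // ltW.
apply: le_trans h1 _; rewrite /step_B; case: ifP => // hh.
have z0 : 0 < M2 * (Qt * g).
  case: g_eq => [g0|[gp _]]; first by move: hh; rewrite g0 !mulr0 qdl_ge0.
  by rewrite !mulr_gt0.
by rewrite lez_floor ?gt_eqF.
Qed.

Lemma step_F_floor i : exists2 r, 0 <= r < dl & F i * dl = q * dl - Bq * G i + r.
Proof.
exists ((Bq * G i - q * dl) %% dl)%Z.
  by rewrite modz_ge0 ?gt_eqF //= ltz_pmod.
have := divz_eq (Bq * G i - q * dl) dl; rewrite /step_F.
move: (_ %/ dl)%Z (_ %% dl)%Z => a b e; rewrite mulNr; lia.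
Qed.

Lemma step_F_gt0 i : 0 < F i.
Proof.
have [r /andP[r0 _] e] := step_F_floor i.
rewrite -(pmulr_lgt0 _ dl_gt0) e.
have := step_slope i; have : 0 < q * dl by rewrite mulr_gt0.
have : 2 <= M2 by rewrite /M2; nia.
move: (Bq * G i) (q * dl) M2 => x y m hm hy' hx; nia.
Qed.

Lemma facets_step i j :
  facets step_phi step_Hs i j = F i * W i j + Bq * (i == K)%:Z * h j.
Proof.
rewrite /W !mxE /step_Hs big_cons big_map /= !ffunE mulrDr mulr_sumr -addrA.
congr (_ + _); first by rewrite /step_phi -mulrnAr.
rewrite addrC; congr (_ + _); apply: eq_bigr => x _; rewrite !ffunE; ring.
Qed.

Lemma facets_stepE :
  facets step_phi step_Hs = scalerows step_scale (setrow W K step_row).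
Proof.
apply/matrixP => i j; rewrite facets_step [RHS]mxE [setrow _ _ _ _ _]mxE.
rewrite /step_scale /step_row.
by case: eqP => [->|_] /=; rewrite ?mulr1 ?mul1r ?mulr0 ?mul0r ?addr0.
Qed.

Lemma step_row_adj i :
  \sum_j step_row j * \adj W j i = Bq * G i + F K * dl * (i == K)%:Z.
Proof.
under eq_bigr do rewrite /step_row mulrDl -!mulrA.
rewrite big_split /= -!mulr_sumr mul_adj_sum -/(G i) (eq_sym K) -/dl.
rewrite /step_Bq; case: (i == K); rewrite ?mulr1n ?mulr0n /= ?mulr1 ?mulr0; ring.
Qed.

Lemma det_facets_step : \det (facets step_phi step_Hs) =
  (\prod_(i | i != K) F i) * (F K * dl + Bq * G K).
Proof.
rewrite facets_stepE det_scalerows det_setrow step_row_adj eqxx mulr1 addrC.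
congr (_ * _); rewrite (bigD1 K) //= /step_scale eqxx mul1r.
by apply: eq_bigr => i /negbTE ->.
Qed.

Lemma cuts_ok_step : cuts_ok step_phi step_Hs.
Proof.
split.
- by move=> i; rewrite mulr_gt0 ?step_F_gt0 ?(phi_gt0 ok).
- move=> x; rewrite inE => /orP[/eqP -> i|/mapP[z hz -> i]]; rewrite ffunE.
    by apply: mulr_ge0 => //; apply: mulr_ge0; [exact: step_B_ge0 | exact: ltW].
  by rewrite mulr_ge0 ?(y_ge0 ok) // ltW ?step_F_gt0.
- move=> x; rewrite inE => /orP[/eqP -> j|/mapP[z hz -> j]]; rewrite ?ffunE //=.
  exact: (h_le ok).
Qed.

(** Only the ceilings disturb the column sums: each adds less than one copy of its row, whose
    entries are at most [Wm q ^ t]. The old error is multiplied by [q]. *)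
Lemma centered_step : centered t.+1 step_phi step_Hs.
Proof.
move=> j; set s' := \sum_i _; have hcj := hc j; set s0 := \sum_i _ in hcj.
have e1 : dl * (s' - q * s0) = \sum_i ((F i - q) * dl + Bq * G i) * W i j.
  (* Cramer's rule: the coordinates of [h] in the rows of [W] are the [G i / dl]. *)
  have eh : \sum_i G i * W i j = dl * h j.
    rewrite /step_G; under eq_bigr do rewrite mulr_suml.
    rewrite exchange_big /= (eq_bigr (fun k => h k * (dl *+ (k == j)))).
      rewrite (bigD1 j) //= eqxx mulr1n big1 ?addr0 1?mulrC // => k kj.
      by rewrite (negbTE kj) mulr0.
    by move=> k _; rewrite -adj_mul_sum mulr_sumr; apply: eq_bigr => i _; rewrite mulrA.
  rewrite /s' /s0; under eq_bigr do rewrite facets_step.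
  rewrite big_split /= -/W.
  have -> : \sum_i Bq * (i == K)%:Z * h j = Bq * h j.
    by rewrite (bigD1 K) //= eqxx mulr1 big1 ?addr0 // => i /negbTE ->; rewrite mulr0 mul0r.
  transitivity (dl * (\sum_i F i * W i j - q * \sum_i W i j) + Bq * (dl * h j)); first by ring.
  rewrite -eh !mulr_sumr -sumrB mulr_sumr -big_split /=.
  by apply: eq_bigr => i _; ring.
have e2 : `|s' - q * s0| <= n%:Z * (Wm * Qt).
  rewrite -(ler_pM2l dl_gt0) -[X in X * _ <= _](gtr0_norm dl_gt0) -normrM e1.
  apply: le_trans (ler_norm_sum _ _ _) _.
  have -> : dl * (n%:Z * (Wm * Qt)) = \sum_(i < n) dl * (Wm * Qt).
    by rewrite sumr_const card_ord -(natz n) -[RHS]mulr_natl; ring.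
  apply: ler_sum => i _; rewrite normrM.
  have [r /andP[r0 r1] e] := step_F_floor i.
  have -> : (F i - q) * dl + Bq * G i = r by rewrite mulrBl e; ring.
  rewrite ger0_norm //; apply: ler_pM => //; first exact: ltW.
  exact: facets_le ok hc ht hy.
have e3 : q * `|s' - q ^+ t.+1| <= q * `|s' - q * s0| + q * (q * `|s0 - q ^+ t|).
  rewrite -mulrDr ler_pM2l // -[X in X * `|_|](gtr0_norm q_gt0) -normrM.
  have -> : s' - q ^+ t.+1 = (s' - q * s0) + q * (s0 - q ^+ t) by rewrite exprS; ring.
  exact: ler_normD.
apply: le_trans e3 _.
have h4 : q * `|s' - q * s0| <= q * (n%:Z * (Wm * Qt)) by rewrite ler_pM2l.
have h5 : q * (q * `|s0 - q ^+ t|) <= q * (t%:Z * n%:Z * Wm * q ^+ t) by rewrite ler_pM2l.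
apply: le_trans (lerD h4 h5) _; rewrite exprS -/Qt.
have -> : (t.+1%:Z = t%:Z + 1) by lia.
by rewrite le_eqVlt; apply/orP; left; apply/eqP; ring.
Qed.

Lemma ytot_step : Bq <= ytot step_Hs.
Proof.
apply: le_trans (y_le_ytot K cuts_ok_step (mem_head _ _)).
by rewrite /= ffunE eqxx mulr1.
Qed.

(** If the loop goes on, the cap was not taken. The quotient defining [B] is then at least 1, by
    [par_slope] and the lower bound [Qt ^ n] on the determinant, so its floor loses at most a factor
    of two, and [Bq G K / (q dl)] lies between [1 / (4 n ^ 2)] and [1 / (2 n ^ 2)]. *)
Lemma step_slope_large : ytot step_Hs < N * q ^+ t.+1 ->
  [/\ 0 < g, g = G K & q * dl <= 2 * (M2 * (Bq * G K))].
Proof.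
move=> hN; have Qt0 := Qt_gt0.
have hB : ~~ (q * N * (M2 * (Qt * g)) <= q * dl).
  apply: contraL hN => hh; rewrite -leNgt; apply: le_trans ytot_step.
  by rewrite /step_Bq /step_B hh exprS -/Qt le_eqVlt; apply/orP; left; apply/eqP; ring.
case: g_eq => [g0|[gp gK]].
  by case/negP: hB; rewrite g0 !mulr0 qdl_ge0.
split=> //; set z := M2 * (Qt * g).
have M20 := M2_gt0.
have z0 : 0 < z by rewrite !mulr_gt0.
have Wm1 : 1 <= Wm by apply: le_trans Wm_ge;
  have := mulr_ge0 (ltW (D_ge1 : 0 < D)) (ltW (N_ge1 : 0 < N)); lia.
have zle : z <= q * dl.
  have hGK : g <= n%:Z * (D * (n`!%:R * (Wm * Qt) ^+ n.-1)).
    rewrite gK; apply: le_trans (ler_norm _) _; apply: le_trans (ler_norm_sum _ _ _) _.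
    have -> : n%:Z * (D * (n`!%:R * (Wm * Qt) ^+ n.-1)) =
        \sum_(i < n) D * (n`!%:R * (Wm * Qt) ^+ n.-1).
      by rewrite sumr_const card_ord -(natz n) mulr_natl.
    apply: ler_sum => i _; rewrite normrM; apply: ler_pM => //.
    apply: adj_bound; last by move=> a b; apply: facets_le ok hc ht hy.
    by nia.
  have h1 : z <= 2 * n%:Z ^+ 2 * n%:Z * D * n`!%:R * Wm ^+ n.-1 * Qt ^+ n.
    rewrite /z; apply: le_trans (_ : M2 * (Qt * (n%:Z * (D * (n`!%:R * (Wm * Qt) ^+ n.-1))))
      <= _).
      by rewrite !ler_pM2l.
    have -> : Qt ^+ n = Qt * Qt ^+ n.-1 by rewrite -exprS prednK.
    rewrite exprMn /M2 le_eqVlt; apply/orP; left; apply/eqP.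
    move: (Qt ^+ n.-1) (Wm ^+ n.-1) (n`!%:R : int) => a b c; ring.
  apply: le_trans h1 _; apply: le_trans (_ : q * Qt ^+ n <= _).
    by rewrite ler_wpM2r // exprn_ge0 // ltW.
  by rewrite ler_pM2l // qtn_le_det.
have -> : 2 * (M2 * (Bq * G K)) = 2 * step_B * z.
  by rewrite -gK /step_Bq /z; ring.
rewrite /step_B (negbTE hB) -/z.
have := divz_eq (q * dl) z; have := ltz_pmod (q * dl) z0;
  have := modz_ge0 (q * dl) (negbT (gt_eqF z0)).
have : 1 <= ((q * dl) %/ z)%Z by rewrite lez_divRL // mul1r.
clear -z0; move: z (q * dl) z0 => w c w0; rewrite /modz.
move: (c %/ w)%Z => a; nia.
Qed.

(** Put [x i = Bq G i / (q dl)]. The factors with [i != K] are at least [q (1 - x i)], and row [K]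
    contributes at least [q dl], so the normalized determinant grows by [1 + x K / 2], where
    [x K >= 1 / (4 n ^ 2)]. *)
Lemma grown_step : ytot step_Hs < N * q ^+ t.+1 -> grown t.+1 step_phi step_Hs.
Proof.
move=> hN; have [g0 gK hlarge] := step_slope_large hN.
pose f (z : int) : rat := z%:~R.
pose x i : rat := f (Bq * G i) / f (q * dl).
have qd0 : 0 < f (q * dl) by rewrite ltr0z mulr_gt0.
have B0 := step_B_ge0; have Bq0 : 0 <= Bq by rewrite mulr_ge0 // ltW.
have n0 : 0 < (n%:R : rat) by rewrite ltr0n.
have fM2 : f M2 = 2%:R * n%:R ^+ 2 by rewrite /f /M2 !intrM expr2.
have x0 : 0 <= x K.
  apply: divr_ge0; last exact: ltW.
  by rewrite ler0z -gK mulr_ge0 // ltW.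
have x1 : 2%:R * n%:R ^+ 2 * x K <= 1.
  rewrite -fM2 mulrA ler_pdivrMr // mul1r -intrM ler_int; exact: step_slope.
have xle i : x i <= x K.
  rewrite ler_pM2r ?invr_gt0 // ler_int -gK; exact: ler_wpM2l.
have xs : \sum_i x i <= 0.
  rewrite -mulr_suml pmulr_lle0 ?invr_gt0 // -rmorph_sum /= -mulr_sumr lerz0.
  exact: mulr_ge0_le0.
have key := simplex_growth x0 x1 xle xs.
have x2 : 1 <= 4%:R * n%:R ^+ 2 * x K.
  have -> : 4%:R * n%:R ^+ 2 = f (2 * M2) by rewrite /f intrM -/(f M2) fM2; lra.
  rewrite mulrA ler_pdivlMr // mul1r /f -intrM ler_int -mulrA; exact: hlarge.
have hF i : f q * (1 - x i) <= f (F i).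
  have [r /andP[r0 _] e] := step_F_floor i.
  rewrite -(ler_pM2r (_ : 0 < f dl)) ?ltr0z // -intrM e.
  have -> : f q * (1 - x i) * f dl = f (q * dl - Bq * G i).
    rewrite /f intrB !intrM -/(f q) -/(f dl) /x.
    have q0 : f q != 0 by rewrite gt_eqF // ltr0z.
    have d0 : f dl != 0 by rewrite gt_eqF // ltr0z.
    rewrite /f !intrM -/(f q) -/(f dl); field; by rewrite q0 d0.
  by rewrite ler_int lerDl.
have hP : f q ^+ n.-1 * (1 + x K / 2%:R) <= f (\prod_(i | i != K) F i).
  apply: le_trans (_ : \prod_(i | i != K) (f q * (1 - x i)) <= _).
    rewrite big_split /= prodr_const cardC1 card_ord.
    by rewrite ler_wpM2l // exprn_ge0 // ler0z ltW.
  rewrite /f rmorph_prod; apply: ler_prod => i _; apply/andP; split; last exact: hF.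
  apply: mulr_ge0; first by rewrite ler0z ltW.
  have := xle i; have n1 : 1 <= (n%:R : rat) by rewrite ler1n.
  nra.
have hD : f q * f dl <= f (F K * dl + Bq * G K).
  have [r /andP[r0 _] e] := step_F_floor K.
  by rewrite /f -intrM ler_int e addrAC subrK lerDl.
have hdet : f q ^+ n * f dl * (1 + x K / 2%:R) <= f (\det (facets step_phi step_Hs)).
  rewrite det_facets_step /f intrM -/(f _) -/(f (_ + _)).
  rewrite -[in f q ^+ n](prednK n_gt0) exprSr.
  have -> : f q ^+ n.-1 * f q * f dl * (1 + x K / 2%:R) =
     (f q ^+ n.-1 * (1 + x K / 2%:R)) * (f q * f dl) by ring.
  apply: ler_pM => //; first by rewrite mulr_ge0 ?exprn_ge0 ?ler0z ?ltW //; lra.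
  by rewrite mulr_ge0 // ler0z ltW.
rewrite /grown; set d' := \det _ in hdet *.
have hm : (8 * n%:Z ^+ 2 + 1) * (q ^+ n * dl) <= 8 * n%:Z ^+ 2 * d'.
  have e1 : f ((8 * n%:Z ^+ 2 + 1) * (q ^+ n * dl)) =
      (8%:R * n%:R ^+ 2 + 1) * (f q ^+ n * f dl).
    by rewrite /f !(intrM, intrD, rmorphXn) /=.
  have e2 : f (8 * n%:Z ^+ 2 * d') = 8%:R * n%:R ^+ 2 * f d'.
    by rewrite /f !(intrM, rmorphXn) /=.
  rewrite -(ler_int rat) -/(f _) -/(f (_ * d')) e1 e2.
  have a0 : 0 <= f q ^+ n * f dl by rewrite mulr_ge0 ?exprn_ge0 // ler0z ltW.
  apply: le_trans (_ : 8%:R * n%:R ^+ 2 * (f q ^+ n * f dl * (1 + x K / 2%:R)) <= _).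
    move: (n%:R ^+ 2 : rat) (f q ^+ n * f dl) a0 (x K) x2 => m a a0 c c2.
    have h1 : 0 <= a * (4%:R * m * c - 1) by apply: mulr_ge0 a0 _; rewrite subr_ge0.
    rewrite -subr_ge0; apply: le_trans h1 _; rewrite le_eqVlt; apply/orP; left.
    by apply/eqP; field.
  apply: ler_wpM2l hdet; apply: mulr_ge0; first exact: ler0n.
  exact/exprn_ge0/ler0n.
have -> : q ^+ (t.+1 * n) = q ^+ (t * n) * q ^+ n by rewrite mulSn exprD mulrC.
rewrite !(exprS _ t).
apply: le_trans (_ : (8 * n%:Z ^+ 2) ^+ t * ((8 * n%:Z ^+ 2 + 1) * (q ^+ n * dl)) <= _).
  have := hg; rewrite /grown -/W -/dl => hg'.
  have -> : (8 * n%:Z ^+ 2 + 1) * (8 * n%:Z ^+ 2 + 1) ^+ t * (q ^+ (t * n) * q ^+ n) =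
    ((8 * n%:Z ^+ 2 + 1) ^+ t * q ^+ (t * n)) * ((8 * n%:Z ^+ 2 + 1) * q ^+ n) by ring.
  have -> : (8 * n%:Z ^+ 2) ^+ t * ((8 * n%:Z ^+ 2 + 1) * (q ^+ n * dl)) =
    ((8 * n%:Z ^+ 2) ^+ t * dl) * ((8 * n%:Z ^+ 2 + 1) * q ^+ n) by ring.
  apply: ler_wpM2r hg'; apply: mulr_ge0; first by apply: addr_ge0.
  exact/exprn_ge0/ltW.
have -> : 8 * n%:Z ^+ 2 * (8 * n%:Z ^+ 2) ^+ t * d' = (8 * n%:Z ^+ 2) ^+ t * (8 * n%:Z ^+ 2 *
  d') by ring.
by rewrite ler_wpM2l // exprn_ge0 //; nia.
Qed.

End Step.

End Simplices.

(** * Conic Caratheodory reduction *)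

(** The extra coordinate 0 counts cuts: it is 1 for a cut and 0 for a slack unit vector, so total
    weight 1 becomes a linear condition. *)
Definition ext n (c : int) (h : 'I_n -> int) (j : 'I_n.+1) : int :=
  if unlift ord0 j is Some k then h k else c.

Lemma ext0 n c (h : 'I_n -> int) : ext c h ord0 = c.
Proof. by rewrite /ext unlift_none. Qed.

Lemma extS n c (h : 'I_n -> int) k : ext c h (lift ord0 k) = h k.
Proof. by rewrite /ext liftK. Qed.

Section Caratheodory.

Local Open Scope ring_scope.

Variables (n : nat) (D : int).
Hypothesis D_ge1 : 1 <= D.

Definition row_ok (b : 'I_n.+1 -> int) (o : option (item n)) : Prop :=
  match o with
  | Some x => b =1 ext 1 x.1.2 /\ forall j, `|x.1.2 j| <= D
  | None => exists v, b =1 ext 0 (fun j => (j == v)%:Z)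
  end.

(** Up to the factor [dl], the sums are the coefficients of [rho] in the basis, so this is
    membership in the cone spanned by the basis rows. *)
Definition in_cone (A : 'I_n.+1 -> 'I_n.+1 -> int) (rho : 'I_n.+1 -> int) :=
  forall i, 0 <= \sum_j rho j * A i j.

(* [A / dl] is the inverse of the basis [B], the sign [sg] making [dl] positive. *)
Record cone_basis (A : 'I_n.+1 -> 'I_n.+1 -> int) (tg : 'I_n.+1 -> option (item n))
    (dl : int) : Prop := ConeBasis {
  cb_gt0 : 0 < dl;
  cb_adj : exists2 B : 'M[int]_n.+1, forall i, row_ok (B i) (tg i) &
    exists2 sg : int, sg ^+ 2 = 1 &
      dl = sg * \det B /\ forall i j, A i j = sg * \adj B j i }.

Lemma row_le b o j : row_ok b o -> `|b j| <= D.
Proof.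
case: o => [x [-> hx]|[v ->]]; rewrite /ext; case: unlift => [k|] //=; try lia.
Qed.

Lemma sign_cases (sg : int) : sg ^+ 2 = 1 -> `|sg| = 1.
Proof. by move=> h; apply/eqP; rewrite -(eqrXn2 (n := 2)) // real_normK ?num_real // h expr1n.
  Qed.

Lemma cone_basis_le A tg dl i j : cone_basis A tg dl ->
  `|A i j| <= n.+1`!%:R * D ^+ n.
Proof.
case=> _ [B hB [sg /sign_cases sg1 [_ ->]]]; rewrite normrM sg1 mul1r.
by apply: adj_bound => // a b; apply: row_le (hB a).
Qed.

Lemma cone_basis_det_le A tg dl : cone_basis A tg dl -> dl <= n.+1`!%:R * D ^+ n.+1.
Proof.
case=> d0 [B hB [sg /sign_cases sg1 [e _]]].
rewrite -(gtr0_norm d0) e normrM sg1 mul1r.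
by apply: det_bound => a b; apply: row_le (hB a).
Qed.

Lemma cone_basis_sum A tg dl j : cone_basis A tg dl ->
  exists2 B : 'I_n.+1 -> 'I_n.+1 -> int, forall i, row_ok (B i) (tg i) &
    \sum_i A i ord0 * B i j = dl *+ (ord0 == j).
Proof.
case=> _ [B hB [sg _ [-> hA]]]; exists (fun i j => B i j) => //.
under eq_bigr do rewrite hA -mulrA.
by rewrite -mulr_sumr adj_mul_sum mulrnAr.
Qed.

Definition pivot_A (A : 'I_n.+1 -> 'I_n.+1 -> int) dl (G : 'I_n.+1 -> int) K i j :=
  (((- G K) * A i j + (G i - dl * (i == K)%:Z) * A K j) %/ dl)%Z.

(** As [G K < 0], replacing row [K] flips the sign of the determinant, so [sg] becomes [- sg] and
    the adjugate update is applied with [s = -1]. The division is exact because its result is again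
    a signed adjugate. *)
Lemma cone_basis_pivot A tg dl (x : item n) K :
  let G i := \sum_j ext 1 x.1.2 j * A i j in
  cone_basis A tg dl -> (forall j, `|x.1.2 j| <= D) -> G K < 0 ->
  cone_basis (pivot_A A dl G K) (fun i => if i == K then Some x else tg i) (- G K) /\
  forall i j, dl * pivot_A A dl G K i j =
    (- G K) * A i j + (G i - dl * (i == K)%:Z) * A K j.
Proof.
move=> G [d0 [B hB [sg sg2 [edl hA]]]] hx GK.
have dl0 : dl != 0 by rewrite gt_eqF.
have GK0 : G K != 0 by rewrite lt_eqF.
have [e1 e2] := adj_update (s := -1) sg2 (sqrrN 1) hA edl dl0 GK0.
have e3 i j : (- G K) * A i j + (G i - dl * (i == K)%:Z) * A K j =
    - sg * \adj (setrow B K (ext 1 x.1.2)) j i * dl.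
  rewrite -[- sg]mulN1r -e2; ring.
have e4 i j : pivot_A A dl G K i j = - sg * \adj (setrow B K (ext 1 x.1.2)) j i.
  by rewrite /pivot_A e3 mulzK.
split; last by move=> i j; rewrite e4 e3 mulrC.
split; first by rewrite oppr_gt0.
exists (setrow B K (ext 1 x.1.2)).
  move=> i; case: eqVneq => [->|ne] /=; first by split=> // j; rewrite mxE eqxx.
  have := hB i; case: (tg i) => [z [h1 h2]|[v h]] /=.
    by split=> // j; rewrite mxE (negbTE ne).
  by exists v => j; rewrite mxE (negbTE ne).
exists (- sg); first by rewrite sqrrN.
by split; [rewrite mulNr -e1 | move=> i j; rewrite e4].
Qed.

(** Let [theta = R K / - G K]. In [rho + theta v] the coefficient of row [K] vanishes, and by the
    ratio test the others are still nonnegative. Since [theta < z], the remainder [(z - theta) v] is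
    a nonnegative multiple of the row that enters. *)
Lemma in_cone_pivot A tg dl (x : item n) K (rho : 'I_n.+1 -> int) z :
  let v := ext 1 x.1.2 in
  let G i := \sum_j v j * A i j in
  let R i := \sum_j rho j * A i j in
  cone_basis A tg dl -> (forall j, `|x.1.2 j| <= D) -> in_cone A rho -> 0 <= z ->
  (exists i, R i + z * G i < 0) -> G K < 0 ->
  (forall i, G i < 0 -> R K * - G i <= R i * - G K) ->
  in_cone (pivot_A A dl G K) (fun j => rho j + z * v j).
Proof.
move=> v G R cb hx hR z0 [i0 hi0] GK hK i.
have [cb' e] := cone_basis_pivot cb hx GK; have d0 := cb_gt0 cb.
rewrite -(pmulr_rge0 _ d0) mulr_sumr.
have eR k : \sum_j (rho j + z * v j) * A k j = R k + z * G k.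
  by rewrite /R /G mulr_sumr -big_split; apply: eq_bigr => j _ /=; ring.
have -> : \sum_j dl * ((rho j + z * v j) * pivot_A A dl G K i j) =
    (- G K) * (R i + z * G i) + (G i - dl * (i == K)%:Z) * (R K + z * G K).
  rewrite -!eR !mulr_sumr -big_split; apply: eq_bigr => j _ /=.
  transitivity ((rho j + z * v j) * (dl * pivot_A A dl G K i j)); first by ring.
  rewrite e -/(G i); ring.
have Ri0 : 0 <= R i0 by apply: hR.
have Gi0 : G i0 < 0.
  by rewrite ltNge; apply/negP => h; have := mulr_ge0 z0 h; lia.
(* The row of smallest ratio is the first to turn negative, so it is negative at [z] as soon as any
   row is. *)
have RK : R K + z * G K < 0.
  have h1 := hK _ Gi0.
  have h2 : R i0 * - G K < (z * - G i0) * - G K by rewrite ltr_pM2r; lia.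
  have h3 : R K * - G i0 < (z * - G K) * - G i0.
    by apply: le_lt_trans h1 _; apply: lt_le_trans h2 _; rewrite mulrAC.
  by move: h3; rewrite ltr_pM2r; lia.
have [->|ne] := eqVneq i K; first by rewrite /= mulr1; nia.
rewrite /= mulr0 subr0.
have -> : - G K * (R i + z * G i) + G i * (R K + z * G K) = R i * - G K - R K * - G i by ring.
have [Gi|Gi] := ltP (G i) 0; first by rewrite subr_ge0 hK.
have h1 : 0 <= R i * - G K by apply: mulr_ge0; [apply: hR | lia].
have h2 : 0 <= R K * G i by apply: mulr_ge0 => //; apply: hR.
by rewrite [R K * _]mulrN opprK addr_ge0.
Qed.

(** The transposed inverse of the basis consisting of [(1, h)] and the vectors [(0, e_v)]; it is
    integral. *)
Definition start_A (h : 'I_n -> int) (i j : 'I_n.+1) : int :=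
  (j == i)%:Z + ext 0 (fun k => - h k) i * (j == ord0)%:Z.

Lemma start_dot (h : 'I_n -> int) (c : 'I_n.+1 -> int) i :
  \sum_j c j * start_A h i j = c i + ext 0 (fun k => - h k) i * c ord0.
Proof.
under eq_bigr do rewrite mulrDr.
rewrite big_split /= (bigD1 i) //= eqxx mulr1 big1 ?addr0 => [|j /negbTE ->]; last first.
  by rewrite mulr0.
congr (_ + _); rewrite (bigD1 ord0) //= ?eqxx mulr1 big1 ?addr0 1?mulrC // => j /negbTE ->.
by rewrite !mulr0.
Qed.

Lemma cone_basis_start (x : item n) : (forall j, `|x.1.2 j| <= D) ->
  cone_basis (start_A x.1.2) (fun i => if i == ord0 then Some x else None) 1.
Proof.
move=> hx; split=> //.
pose b (i j : 'I_n.+1) : int :=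
  if unlift ord0 i is Some v then ext 0 (fun k => (k == v)%:Z) j else ext 1 x.1.2 j.
pose B : 'M[int]_n.+1 := \matrix_(i, j) b i j.
exists B.
  move=> i; case: (unliftP ord0 i) => [v ->|->] /=.
    by exists v => j; rewrite mxE /b liftK.
  by split=> // j; rewrite mxE /b unlift_none.
pose X : 'M[int]_n.+1 := \matrix_(j, i) start_A x.1.2 i j.
have BX : B *m X = 1%:M.
  apply/matrixP => i k; rewrite !mxE.
  rewrite (eq_bigr (fun j => b i j * start_A x.1.2 k j)); last by move=> j _; rewrite !mxE.
  rewrite start_dot /b.
  case: (unliftP ord0 i) => [v ->|->]; case: (unliftP ord0 k) => [w ->|->];
    rewrite ?liftK ?unlift_none ?ext0 ?extS ?mulr0 ?mul0r ?addr0 ?mulr1.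
  - by rewrite (inj_eq lift_inj) eq_sym; case: (v == w).
  - by rewrite eq_sym (negbTE (neq_lift _ _)).
  - by rewrite subrr (negbTE (neq_lift _ _)).
  - by rewrite eqxx.
have d2 : \det B * \det X = 1 by rewrite -det_mulmx BX det1.
(* An integer matrix with an integer inverse has a unit as determinant; its sign is carried along
   instead of being computed. *)
have d1 : (\det B) ^+ 2 = 1.
  have /eqP := congr1 absz d2; rewrite abszM muln_eq1 => /andP[/eqP + _].
  by move: (\det B) => d hd; have [->|->] : d = 1 \/ d = -1 by lia.
have B0 : \det B != 0 by apply: contra_eq_neq d1 => ->; rewrite expr0n.
exists (\det B) => //; split; first by rewrite -expr2 d1.
have <- : \det B *: X = \adj B.
  by apply: adj_unique => //; rewrite -scalemxAr BX scalemx1.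
by move=> i j; rewrite !mxE mulrA -expr2 d1 mul1r.
Qed.

Lemma in_cone_start (x : item n) (phi : 'I_n -> int) z :
  (forall i, 0 <= phi i) -> 0 <= z ->
  in_cone (start_A x.1.2) (fun j => ext 0 phi j + z * ext 1 x.1.2 j).
Proof.
move=> hphi z0 i; rewrite start_dot.
case: (unliftP ord0 i) => [v ->|->]; rewrite ?ext0 ?extS.
  by rewrite add0r mulr1 mulNr (mulrC z) addrK.
by rewrite mul0r addr0 add0r mulr1.
Qed.

(* [rho / rho ord0] is within [2 / N] of the first unit vector, so that
   [A i ord0] is more than -1; and it is an integer. *)
Lemma cone_final A tg dl (rho : 'I_n.+1 -> int) (Qt N : int) :
  cone_basis A tg dl -> in_cone A rho -> 0 < Qt ->
  2 * n%:Z * (n.+1`!%:R * D ^+ n) < N ->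
  (forall k, `|rho (lift ord0 k)| <= 2 * Qt) -> N * Qt <= rho ord0 ->
  forall i, 0 <= A i ord0.
Proof.
move=> cb hR Q0 hN hrho hr0 i; rewrite leNgt; apply/negP => Ai.
have := hR i; rewrite big_ord_recl; apply/negP; rewrite -ltNge.
set M := n.+1`!%:R * D ^+ n in hN.
have h1 : \sum_(k < n) rho (lift ord0 k) * A i (lift ord0 k) <= n%:Z * (2 * Qt * M).
  have -> : n%:Z * (2 * Qt * M) = \sum_(k < n) 2 * Qt * M.
    by rewrite sumr_const card_ord -(natz n) mulr_natl.
  apply: ler_sum => k _; apply: le_trans (ler_norm _) _; rewrite normrM.
  by apply: ler_pM => //; apply: cone_basis_le cb.
have r0 : 0 < rho ord0 by apply: lt_le_trans hr0; rewrite mulr_gt0 //; nia.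
(* Integrality: a negative entry is at most -1. *)
have h2 : rho ord0 * A i ord0 <= - rho ord0 by nia.
have h3 : 2 * n%:Z * M * Qt < N * Qt by rewrite ltr_pM2r.
apply: le_lt_trans (lerD h2 h1) _; rewrite addrC subr_lt0; apply: lt_le_trans hr0;
  apply: le_lt_trans h3.
by rewrite le_eqVlt; apply/orP; left; apply/eqP; ring.
Qed.

(** The numbers [A i ord0 / dl] express the first unit vector in the basis. Coordinate 0 gives the
    total weight of the cuts; in the other coordinates the unit rows contribute nonnegative terms,
    and dropping them leaves an inequality. *)
Lemma cone_weights A tg dl : cone_basis A tg dl -> (forall i, 0 <= A i ord0) ->
  [/\ \sum_(i | tg i) A i ord0 = dl,
      forall i, tg i -> A i ord0 <= dl &
      forall k, \sum_i (if tg i is Some x then A i ord0 * x.1.2 k else 0) <= 0].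
Proof.
move=> cb hA.
have e1 : \sum_(i | tg i) A i ord0 = dl.
  have [B hB] := cone_basis_sum ord0 cb; rewrite eqxx mulr1n => <-.
  rewrite big_mkcond; apply: eq_bigr => i _; have := hB i.
  by case: (tg i) => [x [-> _]|[v ->]] /=; rewrite ext0 ?mulr1 ?mulr0.
split=> //.
  by move=> i hi; rewrite -e1 (bigD1 i) //= lerDl sumr_ge0.
move=> k; have [B hB] := cone_basis_sum (lift ord0 k) cb.
rewrite (negbTE (neq_lift _ _)) mulr0n => e2.
apply: le_trans (_ : _ <= \sum_i A i ord0 * B i (lift ord0 k)) _; last by rewrite e2.
apply: ler_sum => i _; have := hB i.
case: (tg i) => [x [-> _]|[v ->]] /=; rewrite extS //.
by apply: mulr_ge0.
Qed.

End Caratheodory.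

(** * Running the conic reduction *)

Lemma pc_eq A Q s f a v n v' n' :
  pc A Q s f a v n -> v = v' -> n <= n' -> pc A Q s f a v' n'.
Proof.
move=> [b [h1 h2]] e le; exists b; split=> //; exact: ev_fin h2 e le.
Qed.

Lemma enum_ord1S n : enum 'I_n.+1 = ord0 :: map (lift ord0) (enum 'I_n).
Proof. by rewrite enum_ordSl. Qed.

Lemma encl_ext_cons n c (h : 'I_n -> int) :
  VInt c ::: encl h (enum 'I_n) = encl (ext c h) (enum 'I_n.+1).
Proof.
rewrite enum_ord1S encl_cons ext0 /encl -map_comp; congr (VPair _ (enc_list _)).
by apply: eq_map => i /=; rewrite extS.
Qed.

Lemma big_enum_ord n (F : 'I_n -> int) : (\sum_(i <- enum 'I_n) F i = \sum_i F i)%R.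
Proof. by rewrite big_enum. Qed.

Lemma sum_unit n (K : 'I_n) (F : 'I_n -> int) :
  (\sum_i (i == K)%:Z * F i = F K)%R.
Proof. by rewrite (bigD1 K) //= eqxx mul1r big1 ?addr0 // => i /negbTE ->; rewrite mul0r. Qed.

Lemma sum_unit_r n (K : 'I_n) (F : 'I_n -> int) :
  (\sum_i F i * (i == K)%:Z = F K)%R.
Proof. by under eq_bigr do rewrite mulrC; rewrite sum_unit. Qed.

Lemma bits_bool (b : bool) : bits b%:Z <= 1.
Proof. by case: b; rewrite ?bits0 ?bits1. Qed.

Lemma bits_le_norm (a b : int) k : (`|a| <= b)%R -> bits b <= k -> bits a <= k.
Proof. by move=> h; apply: leq_trans; apply: bits_mono; lia. Qed.

Definition enc_items n (Hs : seq (item n)) : data :=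
  encx (fun (x : item n) (i : 'I_n) => x.1.1 i)
    (fun x : item n => encl x.1.2 (enum 'I_n) ::: enc_option (@enc_set n) (Some x.2))
    Hs (enum 'I_n).

Lemma enc_items_cons n (x : item n) Hs : enc_items (x :: Hs) =
  (encl x.1.1 (enum 'I_n) ::: encl x.1.2 (enum 'I_n) :::
    enc_option (@enc_set n) (Some x.2)) ::: enc_items Hs.
Proof. by []. Qed.

Lemma enc_items_nil n : enc_items ([::] : seq (item n)) = VInt 0.
Proof. by []. Qed.

Section Purification.

Context {A : blackbox} {Q : data -> Prop} {s : nat}.
Notation pc := (pc A Q s).
Variables (n k : nat) (D : int).
Hypothesis D_ge1 : (1 <= D)%R.
Notation e1 := (enum 'I_n.+1).
Notation en := (enum 'I_n).
Notation n1 := (n.+2).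

Hypothesis s_ge : 100 * k.+1 * n1 ^ 2 <= s.
Hypothesis D_bits : bits D <= k.
Hypothesis A_bits : bits (n.+1`!%:R * D ^+ n.+1)%R <= k.

Let s1 : 100 * k.+1 * n1 <= s. Proof. by apply: leq_trans s_ge; rewrite -mulnn; nia. Qed.
Let s2 : 100 * k.+1 <= s. Proof. by apply: leq_trans s_ge; rewrite -mulnn; nia. Qed.
Let size_e1 : size e1 = n.+1. Proof. by rewrite size_enum_ord. Qed.
Let size_en : size en = n. Proof. by rewrite size_enum_ord. Qed.

Definition tagd (tg : 'I_n.+1 -> option (item n)) (i : 'I_n.+1) : data :=
  enc_option id (omap (fun x : item n => enc_set x.2) (tg i)).

Definition pur_ctx : data :=
  encl (fun=> 1%R) en ::: encl (fun=> 1%R) e1 :::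
    encl (fun=> 0%R) e1 ::: encl (posn n.+1) e1.

Definition pur_arg (V : 'I_n.+1 -> 'I_n.+1 -> int) tg (dl : int)
    (rho : 'I_n.+1 -> int) (Hs : seq (item n)) : data :=
  encm V e1 e1 ::: encd (tagd tg) e1 ::: VInt dl :::
    encl rho e1 ::: pur_ctx ::: enc_items Hs.

Definition pur_out (V : 'I_n.+1 -> 'I_n.+1 -> int) (tg : 'I_n.+1 -> option (item n))
    (dl : int) : data :=
  enc_list (weighted V ord0 `|dl|%N (fun i => omap (fun x : item n => enc_set x.2) (tg i)) e1).

(** The bound depends only on [n] and [D], whichever cuts are in the basis: bit lengths do not grow
    with the number of pivots. *)
Lemma cone_bits (V : 'I_n.+1 -> 'I_n.+1 -> int) (tg : 'I_n.+1 ->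
  option (item n)) dl i j : cone_basis D V tg dl -> bits (V i j) <= k.
Proof.
move=> cb; apply: bits_le_norm A_bits.
apply: le_trans (cone_basis_le D_ge1 i j cb) _; rewrite exprS mulrCA ler_peMl //.
by apply: mulr_ge0 => //; apply: exprn_ge0; apply: le_trans D_ge1.
Qed.

Lemma cone_det_bits (V : 'I_n.+1 -> 'I_n.+1 -> int) (tg : 'I_n.+1 ->
  option (item n)) dl : cone_basis D V tg dl -> bits dl <= k.
Proof.
move=> cb; apply: bits_le_norm A_bits; rewrite (gtr0_norm (cb_gt0 cb)).
exact: cone_basis_det_le cb.
Qed.

Lemma spec_pur_nil (V : 'I_n.+1 -> 'I_n.+1 -> int) (tg : 'I_n.+1 ->
  option (item n)) dl rho : cone_basis D V tg dl ->
  (forall i, 0 <= V i ord0)%R ->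
  pc f_pur (pur_arg V tg dl rho [::]) (pur_out V tg dl) (200 * k.+1 * n1).
Proof.
move=> cb V0; have dl0 := cb_gt0 cb; have [_ Vle _] := cone_weights cb V0.
have edl : dl = `|dl|%N by rewrite gtz0_abs.
have h : pc f_finish (VInt dl ::: encd (tagd tg) e1 ::: encm V e1 e1)
    (pur_out V tg dl) (100 * k.+1 * n1).
  have := @spec_finish A Q s _ _ e1 (map (lift ord0) en) V ord0 `|dl|%N
    (fun i => omap (fun x : item n => enc_set x.2) (tg i)) k.
  rewrite -enum_ord1S size_e1 -edl; apply.
  - by rewrite absz_gt0 gt_eqF.
  - exact: cone_det_bits cb.
  - by move=> i; case e : (tg i) => // _; rewrite V0 Vle ?e.
  - lia.
eapply pc_intro; [reflexivity | | reflexivity | ].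
  rewrite /pur_arg enc_items_nil; run; exact: h.
simpl; nia.
Qed.

(** Stated relative to the rest of the run: any evaluation of the remaining call extends to one of
    this call. The clause on tags records that every cut in the basis comes from the input list. *)
Lemma spec_pur_cons (V : 'I_n.+1 -> 'I_n.+1 -> int) (tg : 'I_n.+1 ->
  option (item n)) dl rho (x : item n) Hs (z M : int) :
  cone_basis D V tg dl -> in_cone V rho ->
  (forall i, bits (x.1.1 i) <= k) -> (forall i, 0 <= x.1.1 i)%R ->
  (forall j, `|x.1.2 j| <= D)%R ->
  z = (\sum_i x.1.1 i)%R -> (forall j, `|rho j| <= M)%R ->
  (forall j, `|rho j + z * ext 1 x.1.2 j| <= M)%R -> bits M <= k ->
  let rho' j := (rho j + z * ext 1 x.1.2 j)%R in
  exists V' tg' dl', [/\ cone_basis D V' tg' dl', in_cone V' rho',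
    (forall i x', tg' i = Some x' -> x' = x \/ exists i', tg i' = Some x') &
    forall v m, pc f_pur (pur_arg V' tg' dl' rho' Hs) v m ->
      pc f_pur (pur_arg V tg dl rho (x :: Hs)) v (m + 2000 * n1 ^ 2)].
Proof.
move=> cb hR ybits y0 hle ez hM hM' Mb rho'.
have Vb i j : bits (V i j) <= k by apply: cone_bits cb.
have dlb : bits dl <= k by apply: cone_det_bits cb.
have rb j : bits (rho j) <= k by apply: bits_le_norm (hM j) Mb.
have rb' j : bits (rho' j) <= k by apply: bits_le_norm (hM' j) Mb.
have hb j : bits (x.1.2 j) <= k by apply: bits_le_norm (hle j) D_bits.
pose v := ext 1 x.1.2.
have k1 : 0 < k by apply: leq_trans D_bits; rewrite ltnNge bits_leE; lia.
have vb j : bits (v j) <= k.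
  by rewrite /v /ext; case: unlift => [i|]; rewrite ?bits1.
have z0 : (0 <= z)%R by rewrite ez sumr_ge0.
pose k2 := 2 * k * n1.
have z_b : bits z <= k2.
  rewrite ez -big_enum_ord; apply: leq_trans (bits_sum _ ybits) _.
  rewrite size_en /k2; nia.
pose G i := (\sum_j v j * V i j)%R.
pose R i := (\sum_j rho j * V i j)%R.
pose R' i := (\sum_j rho' j * V i j)%R.
have sumb (f : 'I_n.+1 -> int) i : (forall j, bits (f j) <= k) ->
    bits (\sum_j f j * V i j)%R <= k2.
  move=> hf; rewrite -big_enum_ord; apply: leq_trans (bits_dot e1 hf (Vb i)) _.
  rewrite size_e1 /k2; nia.
have Gb i : bits (G i) <= k2 by apply: sumb.
have Rb i : bits (R i) <= k2 by apply: sumb.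
have Rb' i : bits (R' i) <= k2 by apply: sumb.
have R'E i : R' i = (R i + z * G i)%R.
  by rewrite /R /G mulr_sumr -big_split; apply: eq_bigr => j _ /=; rewrite /rho'; ring.
have hdots (f : 'I_n.+1 -> int) : (forall j, bits (f j) <= k) ->
    pc f_dots (encl f e1 ::: encm V e1 e1)
      (encl (fun i => \sum_j f j * V i j)%R e1) (60 * n1 ^ 2).
  move=> hf; apply: pc_eq; first apply: (spec_dots e1 Vb hf).
  - by rewrite size_e1; nia.
  - by apply: encl_ext => i; rewrite big_enum_ord.
  - by rewrite size_e1 -mulnn mulnA.
have hz : pc f_dot (encl (fun=> 1%R) en ::: encl x.1.1 en) (VInt z) (30 * n1).
  apply: pc_eq; first apply: (@spec_dot _ _ _ _ en (fun=> 1%R) x.1.1 k) => //.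
  - by rewrite size_en; nia.
  - by rewrite big_enum_ord ez; congr VInt; apply: eq_bigr => i _; rewrite mul1r.
  - by rewrite size_en; lia.
have hrho' : pc f_vcomb (VInt z ::: VInt 1 ::: VInt 1 :::
    encl v e1 ::: encl rho e1) (encl rho' e1) (40 * n1).
  apply: pc_eq; first apply: (@spec_vcomb _ _ _ _ e1 v rho z 1 1 k2); rewrite ?bits1.
  - by move=> i; apply: leq_trans (vb i) _; rewrite /k2; nia.
  - by move=> i; apply: leq_trans (rb i) _; rewrite /k2; nia.
  - exact: z_b.
  - by rewrite /k2; nia.
  - by rewrite /k2; nia.
  - by rewrite /k2; nia.
  - by apply: encl_ext => j; rewrite divz1 mul1r addrC.
  - by rewrite size_e1.
have idb (i : 'I_n.+1) : bits (Posz i) <= n.+1.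
  by apply: leq_trans (bits_nat _) _; apply: ltnW.
have [k0 [g0 [d0 [hrat0 ok0]]]] : exists k0 g0 d0 : int,
    pc f_ratio (encl R' e1 ::: encl (fun=> 1%R) e1 :::
       encl (posn n.+1) e1)
      (VInt k0 ::: VInt g0 ::: VInt d0) (60 * n1) /\
    (((forall i, 0 <= R' i) /\ g0 = 0) \/
     (exists2 i, R' i < 0 & g0 = - R' i))%R.
  have [|||k0 [g0 [d0 [h1 h2]]]] := @spec_ratio A Q s _ e1 R' (fun=> 1%R)
     (posn n.+1) k2 Rb'.
  - by move=> i; rewrite bits1 /k2; nia.
  - by [].
  - by rewrite /k2; nia.
  exists k0, g0, d0; split; first by move: h1; rewrite size_e1.
  case: h2 => [[h _ -> _]|[K [_ h [_ -> _] _]]]; [left|right; exists K] => //.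
  by split=> // i; apply: h; rewrite mem_enum.
have g0b : bits g0 <= k2.
  by case: ok0 => [[_ ->]|[i _ ->]]; rewrite ?bits0 ?bitsN.
(* If no coefficient became negative, the basis is kept and only [rho] changes. *)
case: ok0 => [[allnn eg0]|[i0 i0neg eg0]].
  exists V, tg, dl; split=> //; first by move=> i x' h; right; exists i.
  move=> w m hw; eapply pc_intro; [reflexivity | | reflexivity | ].
    rewrite /pur_arg /pur_ctx enc_items_cons; run.
    + exact: hz.
    + rewrite encl_ext_cons; exact: hrho'.
    + exact: (hdots _ rb').
    + exact: hrat0.
    + run.
      * by apply: leq_trans g0b _; rewrite /k2; nia.
      * by rewrite bits0.
      * by rewrite eg0 /=; run; exact: hw.
  simpl; nia.
(* A coefficient that was nonnegative and turned negative must have decreased, and [z] is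
   nonnegative. *)
have Gneg : exists i, (G i < 0)%R.
  exists i0; rewrite ltNge; apply/negP => h; have := mulr_ge0 z0 h.
  have := hR i0; rewrite -/(R i0); have := R'E i0; lia.
have [K [hrat GK hK]] : exists K : 'I_n.+1,
    [/\ pc f_ratio (encl G e1 ::: encl R e1 :::
       encl (posn n.+1) e1)
      (VInt (Posz K) ::: VInt (- G K)%R ::: VInt (R K)) (60 * n1),
      (G K < 0)%R & forall i, (G i < 0)%R -> (R K * - G i <= R i * - G K)%R].
  have [|k' [g' [d' [h1 h2]]]] := @spec_ratio A Q s _ e1 G R
     (posn n.+1) k2 Gb Rb hR.
  - by rewrite /k2; nia.
  - case: h2 => [[h _ _ _]|[K [_ GK [e2 e3 e4] hK]]].
      by have [i Gi] := Gneg; have := h i (mem_enum _ i); lia.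
    exists K; split=> //; last by move=> i; apply: hK; rewrite mem_enum.
    by move: h1; rewrite size_e1 e2 e3 e4.
pose u (i : 'I_n.+1) : int := Posz (i == K).
have ub i : bits (u i) <= 1 by apply: bits_bool.
have GKb : bits (- G K)%R <= k2 by rewrite bitsN.
have hunit : pc f_unit (VInt (Posz K) ::: encl (posn n.+1) e1)
    (encl u e1) (30 * n1).
  apply: pc_eq; first apply: (@spec_unit _ _ _ _ e1 (posn n.+1) K n.+1) => //.
  - by apply: leq_trans (idb K) _; nia.
  - by nia.
  - by [].
  - by rewrite size_e1.
have hlin : pc f_lincomb (encl (fun=> 0%R) e1 ::: encl u e1 ::: encm V e1 e1)
    (encl (V K) e1) (100 * n1 ^ 2).
  apply: pc_eq; first apply: (@spec_lincomb _ _ _ _ _ e1 e1 V (fun=> 0%R) u k Vb) => //.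
  - by move=> i; apply: leq_trans (ub i) _.
  - by rewrite size_e1; move: s_ge; rewrite -mulnn; nia.
  - by apply: encl_ext => j; rewrite big_enum_ord sum_unit add0r.
  - by rewrite size_e1 -mulnn mulnA.
have one2 : 1 <= k2 by rewrite /k2; nia.
have k2s : 12 * k2 <= s by rewrite /k2; nia.
have kk2 : k <= k2 by rewrite /k2; nia.
have k2le : k2 <= s by lia.
have hconst (c : int) : bits c <= k2 ->
    pc f_vcomb (VInt c ::: VInt 0 ::: VInt 1 :::
      encl (fun=> 1%R) e1 ::: encl (fun=> 1%R) e1) (encl (fun=> c) e1) (40 * n1).
  move=> hcb; apply: pc_eq.
    apply: (@spec_vcomb _ _ _ _ e1 (fun=> 1%R) (fun=> 1%R) c 0 1 k2);
      rewrite ?bits1 ?bits0 //; by [move=> i; rewrite bits1 | lia].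
  - by apply: encl_ext => j; rewrite divz1 !mulr1 addr0.
  - by rewrite size_e1.
have hgs : pc f_vcomb (VInt 1 ::: VInt (0 - dl)%R ::: VInt 1 :::
    encl G e1 ::: encl u e1)
    (encl (fun i => G i - dl * (i == K)%:Z)%R e1) (40 * n1).
  apply: pc_eq.
    apply: (@spec_vcomb _ _ _ _ e1 G u 1 (0 - dl)%R 1 k2); rewrite ?bits1 ?sub0r ?bitsN //.
    + by move=> i; apply: leq_trans (ub i) _.
    + exact: leq_trans dlb kk2.
    + lia.
  - by apply: encl_ext => i; rewrite divz1 mul1r sub0r mulNr.
  - by rewrite size_e1.
have hmc : pc f_mcomb (encl (V K) e1 ::: encm V e1 e1 :::
    encl (fun=> - G K)%R e1 :::
      encl (fun i => G i - dl * (i == K)%:Z)%R e1 ::: encl (fun=> dl) e1)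
    (encm (pivot_A V dl G K) e1 e1) (100 * n1 ^ 2).
  apply: pc_eq.
    apply: (@spec_mcomb _ _ _ _ _ e1 e1 V (V K) (fun=> - G K)%R
      (fun i => G i - dl * (i == K)%:Z)%R (fun=> dl) (3 * k2)) => //.
    + by move=> i j; have := Vb i j; lia.
    + by move=> j; have := Vb K j; lia.
    + by move=> _; lia.
    + move=> i; apply: leq_trans (bits_B _ _) _; rewrite mulSn; apply: leq_add (Gb i) _.
      apply: leq_trans (bits_M _ _) _; rewrite mul2n -addnn; apply: leq_add.
        exact: leq_trans dlb kk2.
      exact: leq_trans (ub i) one2.
    + by move=> _; lia.
    + lia.
  - by [].
  - by rewrite size_e1 -mulnn mulnA.
pose tg' i := if i == K then Some x else tg i.
have hset : pc f_setk (VInt (Posz K) ::: enc_option (@enc_set n) (Some x.2) :::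
    encl (posn n.+1) e1 ::: encd (tagd tg) e1)
    (encd (tagd tg') e1) (40 * n1).
  apply: pc_eq.
    apply: (@spec_setk _ _ _ _ e1 (posn n.+1) (tagd tg)
       (enc_option (@enc_set n) (Some x.2)) K n.+1) => //; nia.
  - congr enc_list; apply: eq_map => i; rewrite /tagd /tg'.
    by rewrite (inj_eq (can_inj absz_nat)) (inj_eq val_inj); case: eqP.
  - by rewrite size_e1.
have [cb' _] := cone_basis_pivot cb hle GK.
exists (pivot_A V dl G K), tg', (- G K)%R; split=> //.
- have ex : (exists i, R i + z * G i < 0)%R by exists i0; rewrite -R'E.
  exact: (in_cone_pivot D_ge1 cb hle hR z0 ex GK hK).
- move=> i x'; rewrite /tg'; case: eqP => [_ [->]|_ h]; first by left.
  by right; exists i.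
move=> w m hw; eapply pc_intro; [reflexivity | | reflexivity | ].
  rewrite /pur_arg /pur_ctx enc_items_cons; run.
  + exact: hz.
  + rewrite encl_ext_cons; exact: hrho'.
  + exact: (hdots _ rb').
  + exact: hrat0.
  + run.
    * by apply: leq_trans g0b _; rewrite /k2; nia.
    * by rewrite bits0.
    * rewrite leNgt eg0 oppr_gt0 i0neg /=; run.
      -- rewrite encl_ext_cons; exact: (hdots _ vb).
      -- exact: (hdots _ rb).
      -- exact: hrat.
      -- run.
        ++ exact: hunit.
        ++ exact: hlin.
        ++ exact: hconst.
        ++ by rewrite bits0.
        ++ exact: leq_trans dlb (leq_trans kk2 k2le).
        ++ exact: hgs.
        ++ exact: hconst (leq_trans dlb kk2).
        ++ exact: hmc.
        ++ exact: hset.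
        ++ exact: hw.
simpl; nia.
Qed.

Definition rho_end (rho : 'I_n.+1 -> int) (Hs : seq (item n)) (j : 'I_n.+1) : int :=
  (rho j + \sum_(x <- Hs) (\sum_i x.1.1 i) * ext 1 x.1.2 j)%R.

Definition item_ok (x : item n) :=
  [/\ forall i, bits (x.1.1 i) <= k, (forall i, 0 <= x.1.1 i)%R &
      (forall j, `|x.1.2 j| <= D)%R].

(** The potential [|rho j| + D ytot Hs] does not increase when an item is absorbed, so one bound [M]
    serves for all intermediate vectors. *)
Lemma spec_pur (Hs : seq (item n)) V tg dl (rho : 'I_n.+1 -> int) (M N Qt : int) :
  cone_basis D V tg dl -> in_cone V rho ->
  (forall x, x \in Hs -> item_ok x) ->
  (forall j, `|rho j| + D * ytot Hs <= M)%R -> bits M <= k ->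
  (0 < Qt)%R -> (2 * n%:Z * (n.+1`!%:R * D ^+ n) < N)%R ->
  (forall j, `|rho_end rho Hs (lift ord0 j)| <= 2 * Qt)%R ->
  (N * Qt <= rho_end rho Hs ord0)%R ->
  exists V' tg' dl', [/\ cone_basis D V' tg' dl', (forall i, 0 <= V' i ord0)%R,
    (forall i x, tg' i = Some x -> x \in Hs \/ exists i', tg i' = Some x) &
    pc f_pur (pur_arg V tg dl rho Hs) (pur_out V' tg' dl')
      (2000 * n1 ^ 2 * size Hs + 200 * k.+1 * n1)].
Proof.
move=> + + + + Mb Q0 hN; elim: Hs V tg dl rho => [|x Hs IH] V tg dl rho cb hR hok hM hend hend0.
  have V0 : forall i, (0 <= V i ord0)%R.
    apply: (cone_final D_ge1 cb hR Q0 hN).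
      by move=> j; have := hend j; rewrite /rho_end big_nil addr0.
    by move: hend0; rewrite /rho_end big_nil addr0.
  exists V, tg, dl; split=> //; first by move=> i x e; right; exists i.
  by rewrite muln0 add0n; apply: spec_pur_nil.
have [yb y0 hle] := hok x (mem_head _ _).
have hok' z : z \in Hs -> item_ok z by move=> hz; apply: hok; rewrite inE hz orbT.
have D0 : (0 <= D)%R by apply: le_trans D_ge1.
have yt0 : (0 <= ytot Hs)%R.
  rewrite /ytot big_seq; apply: sumr_ge0 => z /hok'[_ z0 _].
  by apply: sumr_ge0.
have ytE : ytot (x :: Hs) = (\sum_i x.1.1 i + ytot Hs)%R by rewrite /ytot big_cons.
have sx0 : (0 <= \sum_i x.1.1 i)%R by apply: sumr_ge0.
set z : int := (\sum_i x.1.1 i)%R in ytE sx0.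
have vle j : (`|ext 1 x.1.2 j| <= D)%R.
  by rewrite /ext; case: unlift => [i|] //.
have Dt0 : (0 <= D * ytot Hs)%R by apply: mulr_ge0.
have step j : (`|rho j + z * ext 1 x.1.2 j| + D * ytot Hs <= M)%R.
  apply: le_trans (hM j); rewrite ytE mulrDr addrA lerD2r.
  apply: le_trans (ler_normD _ _) _; rewrite lerD2l normrM (ger0_norm sx0) mulrC.
  by apply: ler_wpM2r.
have hM1 j : (`|rho j| <= M)%R.
  apply: le_trans (hM j); rewrite lerDl; apply: mulr_ge0 => //.
  by rewrite ytE addr_ge0.
have hM2 j : (`|rho j + z * ext 1 x.1.2 j| <= M)%R.
  by apply: le_trans (step j); rewrite lerDl.
have [V' [tg' [dl' [cb' hR' htg hrun]]]] :=
  spec_pur_cons Hs cb hR yb y0 hle (erefl z) hM1 hM2 Mb.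
have eend j : rho_end (fun j => rho j + z * ext 1 x.1.2 j)%R Hs j =
    rho_end rho (x :: Hs) j by rewrite /rho_end big_cons addrA.
have [||V2 [tg2 [dl2 [cb2 V20 htg2 hrun2]]]] := IH _ _ _ _ cb' hR' hok' step.
- by move=> j; rewrite eend.
- by rewrite eend.
exists V2, tg2, dl2; split=> //.
  move=> i w /htg2[hw|[i' /htg[->|[i2 h]]]]; first by left; rewrite inE hw orbT.
    by left; rewrite mem_head.
  by right; exists i2.
by apply: pc_eq (hrun _ _ hrun2) _ _ => //=; lia.
Qed.

(** The vector [phi] enters through the unit rows, so the final [rho] consists of the total
    multiplicity followed by the column sums of the facets. *)
Lemma spec_purstart (x : item n) (Hs : seq (item n)) (phi : 'I_n -> int) (M N Qt : int) :
  (forall z, z \in x :: Hs -> item_ok z) ->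
  (forall i, 0 <= phi i)%R ->
  (forall j, phi j + D * ytot (x :: Hs) <= M)%R ->
  (D * ytot (x :: Hs) <= M)%R -> bits M <= k ->
  (0 < Qt)%R -> (2 * n%:Z * (n.+1`!%:R * D ^+ n) < N)%R ->
  (forall j, `|phi j + \sum_(z <- x :: Hs) (\sum_i z.1.1 i) * z.1.2 j| <= 2 * Qt)%R ->
  (N * Qt <= ytot (x :: Hs))%R ->
  exists V' tg' dl', [/\ cone_basis D V' tg' dl', (forall i, 0 <= V' i ord0)%R,
    (forall i z, tg' i = Some z -> z \in x :: Hs) &
    pc f_purstart (VInt n ::: encl phi en ::: enc_items (x :: Hs))
      (pur_out V' tg' dl')
      (2000 * n1 ^ 2 * (size Hs).+1 + 200 * k.+1 * n1)].
Proof.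
move=> hok phi0 hM hM0 Mb Q0 hN hend hyt.
have [yb y0 hle] := hok x (mem_head _ _).
have hok' z : z \in Hs -> item_ok z by move=> hz; apply: hok; rewrite inE hz orbT.
have hb j : bits (x.1.2 j) <= k by apply: bits_le_norm (hle j) D_bits.
have k1 : 0 < k by apply: leq_trans D_bits; rewrite ltnNge bits_leE; lia.
have D0 : (0 <= D)%R by apply: le_trans D_ge1.
pose z : int := (\sum_i x.1.1 i)%R.
have z0 : (0 <= z)%R by apply: sumr_ge0.
pose k2 := 2 * k * n1.
have kk2 : k <= k2 by rewrite /k2; nia.
have k2s : 12 * k2 <= s by rewrite /k2; nia.
have k2pos : 0 < k2 by rewrite /k2; nia.
have z_b : bits z <= k2.
  by rewrite /z -big_enum_ord; apply: leq_trans (bits_sum _ yb) _; rewrite size_en /k2; nia.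
have yt0 : (0 <= ytot Hs)%R.
  rewrite /ytot big_seq; apply: sumr_ge0 => w /hok'[_ w0 _].
  by apply: sumr_ge0.
have ytE : ytot (x :: Hs) = (z + ytot Hs)%R by rewrite /ytot big_cons.
have phib j : bits (phi j) <= k.
  apply: bits_le_norm Mb; rewrite ger0_norm //; apply: le_trans (hM j).
  by rewrite lerDl mulr_ge0 // ytE addr_ge0.
pose rho j := (ext 0 phi j + z * ext 1 x.1.2 j)%R.
have cb := cone_basis_start D_ge1 hle.
have hR := in_cone_start x phi0 z0.
have hMr j : (`|rho j| + D * ytot Hs <= M)%R.
  rewrite /rho; case: (unliftP ord0 j) => [i ->|->]; rewrite ?ext0 ?extS.
    apply: le_trans (hM i); rewrite ytE mulrDr addrA lerD2r.
    apply: le_trans (ler_normD _ _) _; rewrite (ger0_norm (phi0 i)) lerD2l.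
    by rewrite normrM (ger0_norm z0) mulrC; apply: ler_wpM2r.
  rewrite add0r mulr1 (ger0_norm z0); apply: le_trans hM0; rewrite ytE mulrDr lerD2r.
  by rewrite ler_peMl.
have eend j : rho_end rho Hs j = (ext 0 phi j + \sum_(w <- x :: Hs) (\sum_i w.1.1 i) * ext 1
  w.1.2 j)%R.
  by rewrite /rho_end /rho big_cons addrA.
have [||V2 [tg2 [dl2 [cb2 V20 htg2 hrun2]]]] :=
    spec_pur cb hR hok' hMr Mb Q0 hN.
- move=> j; rewrite eend extS; under eq_bigr do rewrite extS.
  exact: hend.
- rewrite eend ext0 add0r; under eq_bigr do rewrite ext0 mulr1.
  exact: hyt.
exists V2, tg2, dl2; split=> //.
  move=> i w /htg2[hw|[i' ]]; first by rewrite inE hw orbT.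
  by case: ifP => // _ [<-]; rewrite mem_head.
have hc (T : Type) (r : seq T) c m : size r = m -> m < s ->
    pc f_consts (VInt c ::: VInt m) (encl (fun=> c) r) (30 * m.+1).
  by move=> <-; apply: spec_consts.
have hio : pc f_iota (VInt 0 ::: VInt n.+1)
    (encl (posn n.+1) e1) (30 * n1).
  apply: pc_eq; first apply: (@spec_iota _ _ _ 0 n.+1); first by nia.
  - by rewrite -val_enum_ord /encl -map_comp.
  - by [].
have idb (i : 'I_n.+1) : bits (Posz i) <= n.+1.
  by apply: leq_trans (bits_nat _) _; apply: ltnW.
have ns : n.+1 <= s by nia.
have hun : pc f_unit (VInt 0 ::: encl (posn n.+1) e1)
    (encl (fun j : 'I_n.+1 => Posz (j == ord0)) e1) (30 * n1).
  apply: pc_eq; first by apply: (spec_unit _ idb); rewrite ?bits0.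
  - by apply: encl_ext => i.
  - by rewrite size_e1.
have huns : pc f_units (encl (posn n.+1) e1 :::
     encl (posn n.+1) e1)
    (encm (fun i j : 'I_n.+1 => Posz (j == i)) e1 e1) (60 * n1 ^ 2).
  apply: pc_eq; first apply: (spec_units _ _ idb idb ns).
  - by [].
  - by rewrite size_e1 -mulnn mulnA.
have hneg : pc f_vcomb (VInt (-1)%R ::: VInt 0 ::: VInt 1 :::
     encl x.1.2 en ::: encl x.1.2 en) (encl (fun i => - x.1.2 i)%R en) (40 * n1).
  apply: pc_eq; first apply: (@spec_vcomb _ _ _ _ en x.1.2 x.1.2 (-1)%R 0 1 k);
    rewrite ?bitsN ?bits1 ?bits0 //; try lia.
  - by apply: encl_ext => i; rewrite divz1 mulN1r mul0r addr0.
have hmc : pc f_mcomb (encl (fun j : 'I_n.+1 => Posz (j == ord0)) e1 :::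
    encm (fun i j : 'I_n.+1 => Posz (j == i)) e1 e1 :::
    encl (fun=> 1%R) e1 ::: encl (ext 0 (fun i => - x.1.2 i)%R) e1 :::
      encl (fun=> 1%R) e1)
    (encm (start_A x.1.2) e1 e1) (100 * n1 ^ 2).
  apply: pc_eq.
    apply: (@spec_mcomb _ _ _ _ _ e1 e1 (fun i j : 'I_n.+1 => Posz (j == i))
      (fun j : 'I_n.+1 => Posz (j == ord0)) (fun=> 1%R) (ext 0 (fun i => - x.1.2 i)%R)
      (fun=> 1%R) k).
    + by move=> i j; apply: leq_trans (bits_bool _) _.
    + by move=> j; apply: leq_trans (bits_bool _) _.
    + by move=> _; rewrite bits1.
    + by move=> i; rewrite /ext; case: unlift => [a|]; rewrite ?bits0 // bitsN.
    + by move=> _; rewrite bits1.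
    + lia.
  - by apply: encm_ext => i j; rewrite divz1 mul1r.
  - by rewrite size_e1 -mulnn mulnA.
have hz : pc f_dot (encl (fun=> 1%R) en ::: encl x.1.1 en) (VInt z) (30 * n1).
  apply: pc_eq; first apply: (@spec_dot _ _ _ _ en (fun=> 1%R) x.1.1 k) => //.
  - by rewrite size_en; nia.
  - by rewrite big_enum_ord; congr VInt; apply: eq_bigr => i _; rewrite mul1r.
  - by rewrite size_en; lia.
have hrho : pc f_vcomb (VInt z ::: VInt 1 ::: VInt 1 :::
    encl (ext 1 x.1.2) e1 ::: encl (ext 0 phi) e1) (encl rho e1) (40 * n1).
  apply: pc_eq; first apply: (@spec_vcomb _ _ _ _ e1 (ext 1 x.1.2) (ext 0 phi) z 1 1 k2);
    rewrite ?bits1 //; try lia.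
  - move=> j; apply: leq_trans kk2; rewrite /ext; case: unlift => [i|] //; by rewrite bits1.
  - move=> j; apply: leq_trans kk2; rewrite /ext; case: unlift => [i|] //; by rewrite bits0.
  - by apply: encl_ext => j; rewrite divz1 mul1r addrC.
have htag : enc_option (@enc_set n) (Some x.2) ::: encl (fun=> 0%R) en =
    encd (tagd (fun i => if i == ord0 then Some x else None)) e1.
  rewrite enum_ord1S encd_cons /encd -map_comp; congr (VPair _ (enc_list _)).
have b1 : bits 1 <= s by rewrite bits1; lia.
have nb : bits n <= s by apply: leq_trans (bits_nat _) _; lia.
have en1 : (n%:Z + 1 = n.+1)%R by lia.
eapply pc_intro; [reflexivity | | reflexivity | ].
  rewrite enc_items_cons; run => //.
  all: rewrite /prim_sem ?en1.
  - by apply: (hc _ en); [exact: size_en | lia].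
  - by apply: (hc _ en); [exact: size_en | lia].
  - by apply: (hc _ e1); [exact: size_e1 | lia].
  - by apply: (hc _ e1); [exact: size_e1 | lia].
  - exact: hio.
  - exact: hun.
  - exact: huns.
  - exact: hneg.
  - rewrite encl_ext_cons; exact: hmc.
  - exact: hz.
  - rewrite !encl_ext_cons; exact: hrho.
  - rewrite htag; exact: hrun2.
simpl; nia.
Qed.

End Purification.

(** * Running one simplex step *)

Definition enc_state n (phi : 'I_n -> int) (Hs : seq (item n)) (Qt : int) : data :=
  encm (fun i j => (\adj (facets phi Hs))%R j i) (enum 'I_n) (enum 'I_n) :::
    VInt (\det (facets phi Hs))%R ::: VInt Qt :::
      encl phi (enum 'I_n) ::: enc_items Hs.

Definition enc_par n (q N : int) : data :=
  VInt q ::: VInt (q * N)%R ::: VInt (2 * (n%:Z * n%:Z))%R :::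
    encl (fun=> 1%R) (enum 'I_n) ::: encl (fun=> 0%R) (enum 'I_n) :::
      encl (posn n) (enum 'I_n).

Section Update.

Context {A : blackbox} {Q : data -> Prop} {s : nat}.
Notation pc := (pc A Q s).
Variables (n k : nat) (D N Wm q : int) (kap : nat).
Hypothesis par : params n D N Wm q kap.
Notation en := (enum 'I_n).
Notation n1 := (n.+2).

Hypothesis s_ge : 1000 * k.+1 * n1 ^ 2 <= s.
Hypotheses (D_bits : bits D <= k) (q_bits : bits q <= k) (N_bits : bits N <= k).
Hypothesis M2_bits : bits (2 * (n%:Z * n%:Z))%R <= k.
Hypothesis n_gt0 : 0 < n.

Let size_en : size en = n. Proof. by rewrite size_enum_ord. Qed.

(** Vertex [K] and value [g] are found by the run itself, as the largest value of the cut over the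
    vertices. The new numbers are bounded here in terms of the old state, independently of the
    invariants of the new one. *)
Lemma spec_update t (phi : 'I_n -> int) (Hs : seq (item n)) (h : 'I_n -> int)
    (S : {set 'I_n}) :
  cuts_ok D phi Hs -> t <= tmax n kap -> (ytot Hs < N * q ^+ t)%R ->
  grown q t phi Hs -> (forall j, `|h j| <= D)%R ->
  (\sum_i step_G phi Hs h i <= 0)%R ->
  (forall i j, bits ((\adj (facets phi Hs))%R i j) <= k) ->
  bits (\det (facets phi Hs))%R <= k -> bits (q ^+ t)%R <= k ->
  (forall i, bits (phi i) <= k) ->
  (forall x, x \in Hs -> forall i, bits (x.1.1 i) <= k) ->
  exists K g, [/\ forall i, (step_G phi Hs h i <= g)%R,
    g = 0%R \/ (0 < g)%R /\ g = step_G phi Hs h K,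
    (forall i, bits (step_F N q t phi Hs h g i) <= 12 * k * n1) /\
    bits (step_Bq N q t phi Hs g) <= 3 * k &
    pc f_update (encl h en ::: enc_option (@enc_set n) (Some S) :::
        enc_state phi Hs (q ^+ t)%R ::: enc_par n q N)
      (enc_state (step_phi N q t phi Hs h g) (step_Hs N q t phi Hs h S K g)
        (q ^+ t.+1)%R) (2000 * n1 ^ 2 + 60 * n1 * (size Hs).+1)].
Proof.
move=> ok ht hy hg hle hG Vb dlb Qtb phib yb.
pose W := facets phi Hs; pose dl := (\det W)%R.
pose V i j := (\adj W)%R j i; pose G := step_G phi Hs h.
pose Qt := (q ^+ t)%R; pose M2 := (2 * (n%:Z * n%:Z))%R.
have k1 : 0 < k by apply: leq_trans D_bits; rewrite ltnNge bits_leE; have := par_D par; lia.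
have hb j : bits (h j) <= k by apply: bits_le_norm (hle j) D_bits.
pose k2 := 2 * k * n1.
have kk2 : k <= k2 by rewrite /k2; nia.
have k2s : 400 * k2 <= s by apply: leq_trans s_ge; rewrite /k2 -mulnn; nia.
have Gb i : bits (G i) <= k2.
  rewrite /G /step_G -big_enum_ord; apply: leq_trans (bits_dot en hb (Vb^~ i)) _.
  by rewrite size_en /k2; nia.
have idb (i : 'I_n) : bits (Posz i) <= n.
  by apply: leq_trans (bits_nat _) _; apply: ltnW.
have ns : n <= s by nia.
have hdots : pc f_dots (encl h en ::: encm V en en) (encl G en) (60 * n1 ^ 2).
  apply: pc_eq; first apply: (@spec_dots _ _ _ _ _ en en V h k) => //.
  - by move=> i j; apply: Vb.
  - by rewrite size_en; rewrite /k2 in k2s; nia.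
  - by apply: encl_ext => i; rewrite big_enum_ord.
  - by rewrite size_en -mulnn -mulnA leq_mul2l leq_mul.
have hneg (f : 'I_n -> int) l : (forall i, bits (f i) <= l) -> 4 * l.+1 <= s ->
    pc f_vcomb (VInt (-1)%R ::: VInt 0 ::: VInt 1 :::
     encl f en ::: encl f en) (encl (fun i => - f i)%R en) (40 * n1).
  move=> hf hl; apply: pc_eq.
    apply: (@spec_vcomb _ _ _ _ en f f (-1)%R 0 1 l.+1);
      rewrite ?bitsN ?bits1 ?bits0 //; by move=> i; apply: leqW.
  - by apply: encl_ext => i; rewrite divz1 mulN1r mul0r addr0.
  - by rewrite size_en; lia.
have [K [g [d0 [hrat Gle geq]]]] : exists (K : 'I_n) (g d0 : int),
    [/\ pc f_ratio (encl (fun i => - G i)%R en ::: encl (fun=> 1%R) en :::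
       encl (posn n) en)
      (VInt K ::: VInt g ::: VInt d0) (60 * n1),
      forall i, (G i <= g)%R & g = 0%R \/ (0 < g)%R /\ g = G K].
  have Gb' i : bits (- G i)%R <= k2 by rewrite bitsN.
  have [|||k' [g' [d' [h1 h2]]]] := @spec_ratio A Q s _ en (fun i => - G i)%R (fun=> 1%R)
     (posn n) k2 Gb'.
  - by move=> i; rewrite bits1; lia.
  - by [].
  - by lia.
  rewrite size_en in h1; case: h2 => [[h3 e1 e2 e3]|[K [_ GK [e1 e2 e3] hK]]].
    (* No vertex is on the positive side; the scan returned index 0, which serves as [K], together
       with [g = 0]. *)
    exists (Ordinal n_gt0), g', d'; split; last by left.
      by apply: pc_eq h1 _ _; rewrite ?e1 //; lia.
    by move=> i; have := h3 i (mem_enum _ i); rewrite e2; lia.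
  exists K, g', d'; split.
  - by apply: pc_eq h1 _ _; rewrite ?e1 //; lia.
  - move=> i; have := hK i (mem_enum _ i); rewrite e2; have := GK; lia.
  - by right; rewrite e2 opprK; lia.
have gb : bits g <= k2 by case: geq => [->|[_ ->]]; rewrite ?bits0.
have dl0 : (0 < dl)%R := det_facets_gt0 par ht hy hg geq hG.
have B0 : (0 <= step_B N q t phi Hs g)%R := step_B_ge0 par ht hy hg geq hG.
pose B := step_B N q t phi Hs g; pose Bq := step_Bq N q t phi Hs g.
pose F := step_F N q t phi Hs h g.
have F0 i : (0 < F i)%R := step_F_gt0 par ht hy hg Gle geq hG i.
have Bb : bits B <= 2 * k.
  rewrite /B /step_B; case: ifP => _.
    by apply: leq_trans (bits_M _ _) _; lia.
  by apply: leq_trans (bits_Q _ _) _; apply: leq_trans (bits_M _ _) _; lia.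
have Bqb : bits Bq <= 3 * k.
  by apply: leq_trans (bits_M _ _) _; rewrite -/B; lia.
have qdlb : bits (q * dl)%R <= 2 * k by apply: leq_trans (bits_M _ _) _; rewrite /dl /W; lia.
have nFb i : bits ((Bq * G i - q * dl) %/ dl)%Z <= 6 * k2.
  apply: leq_trans (bits_Q _ _) _; apply: leq_trans (bits_B _ _) _.
  by have := bits_M Bq (G i); have := Gb i; lia.
have Fb i : bits (F i) <= 6 * k2 by rewrite /F /step_F bitsN; apply: nFb.
have b1 : bits 1 = 1 by rewrite bits1.
have hnF : pc f_vcomb (VInt Bq ::: VInt (0 - q * dl)%R ::: VInt dl :::
    encl G en ::: encl (fun=> 1%R) en)
    (encl (fun i => (Bq * G i - q * dl) %/ dl)%Z en) (40 * n1).
  apply: pc_eq.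
    apply: (@spec_vcomb _ _ _ _ en G (fun=> 1%R) Bq (0 - q * dl)%R dl (3 * k2)).
    + by move=> i; have := Gb i; lia.
    + by move=> i; rewrite bits1; lia.
    + by lia.
    + by rewrite sub0r bitsN; lia.
    + by rewrite /dl /W; lia.
    + by lia.
  - by apply: encl_ext => i; rewrite mulr1 sub0r.
  - by rewrite size_en; lia.
have hF : pc f_vcomb (VInt (-1)%R ::: VInt 0 ::: VInt 1 :::
    encl (fun i => (Bq * G i - q * dl) %/ dl)%Z en :::
      encl (fun i => (Bq * G i - q * dl) %/ dl)%Z en) (encl F en) (40 * n1).
  by apply: (hneg _ (6 * k2)) => //; lia.
pose u (i : 'I_n) : int := Posz (i == K).
have ub i : bits (u i) <= 1 by apply: bits_bool.
have hunit : pc f_unit (VInt (Posz K) ::: encl (posn n) en)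
    (encl u en) (30 * n1).
  apply: pc_eq; first apply: (@spec_unit _ _ _ _ en (posn n) K n) => //.
  - exact: leq_trans (idb K) ns.
  - by [].
  - by rewrite size_en; lia.
have hdotu (f : 'I_n -> int) l : (forall i, bits (f i) <= l) -> 2 * l.+1 * n1 <= s ->
    pc f_dot (encl f en ::: encl u en) (VInt (f K)) (30 * n1).
  move=> hf hl; apply: pc_eq; first apply: (@spec_dot _ _ _ _ en f u l.+1) => //.
  - by move=> i; apply: leqW.
  - by move=> i; apply: leq_trans (ub i) _.
  - by rewrite size_en; apply: leq_trans hl; rewrite leq_mul.
  - by rewrite big_enum_ord sum_unit_r.
  - by rewrite size_en; lia.
have k2n : 100 * k2.+1 * n1 <= s.
  by apply: leq_trans s_ge; rewrite /k2 -mulnn; nia.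
pose G' i := (Bq * G i + F K * dl * (i == K)%:Z)%R.
have FKdlb : bits (F K * dl)%R <= 7 * k2.
  by apply: leq_trans (bits_M _ _) _; have := Fb K; rewrite /dl /W; lia.
have G'b i : bits (G' i) <= 12 * k2.
  apply: leq_trans (bits_D _ _) _; have := bits_M Bq (G i); have := Gb i.
  by have := bits_M (F K * dl)%R (i == K); have := ub i; rewrite /u; lia.
have hG' : pc f_vcomb (VInt Bq ::: VInt (F K * dl)%R ::: VInt 1 :::
    encl G en ::: encl u en) (encl G' en) (40 * n1).
  apply: pc_eq.
    apply: (@spec_vcomb _ _ _ _ en G u Bq (F K * dl)%R 1 (7 * k2)).
    + by move=> i; have := Gb i; lia.
    + by move=> i; have := ub i; lia.
    + by lia.
    + by [].
    + by rewrite bits1; lia.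
    + by lia.
  - by apply: encl_ext => i; rewrite divz1.
  - by rewrite size_en; lia.
have hlin : pc f_lincomb (encl (fun=> 0%R) en ::: encl u en ::: encm V en en)
    (encl (V K) en) (100 * n1 ^ 2).
  apply: pc_eq; first apply: (@spec_lincomb _ _ _ _ _ en en V (fun=> 0%R) u k) => //.
  - by move=> i j; apply: Vb.
  - by move=> i; apply: leq_trans (ub i) _.
  - by rewrite size_en; rewrite /k2 in k2n; nia.
  - by apply: encl_ext => j; rewrite big_enum_ord sum_unit add0r.
  - by rewrite size_en -mulnn -mulnA leq_mul2l leq_mul.
have hconst (c : int) l : bits c <= l -> 4 * l.+1 <= s ->
    pc f_vcomb (VInt c ::: VInt 0 ::: VInt 1 :::
      encl (fun=> 1%R) en ::: encl (fun=> 1%R) en) (encl (fun=> c) en) (40 * n1).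
  move=> hcb hl; apply: pc_eq.
    apply: (@spec_vcomb _ _ _ _ en (fun=> 1%R) (fun=> 1%R) c 0 1 l.+1);
      rewrite ?bits1 ?bits0 //; by [move=> i; rewrite bits1 | apply: leqW].
  - by apply: encl_ext => j; rewrite divz1 !mulr1 addr0.
  - by rewrite size_en; lia.
have hgs : pc f_vcomb (VInt (-1)%R ::: VInt dl ::: VInt 1 :::
    encl G' en ::: encl u en)
    (encl (fun i => - (G' i - dl * (i == K)%:Z))%R en) (40 * n1).
  apply: pc_eq.
    apply: (@spec_vcomb _ _ _ _ en G' u (-1)%R dl 1 (12 * k2)) => //.
    + by move=> i; have := ub i; lia.
    + by rewrite bitsN b1; lia.
    + by rewrite /dl /W; lia.
    + by rewrite b1; lia.
    + by lia.
  - by apply: encl_ext => i; rewrite divz1 mulN1r opprB addrC.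
  - by rewrite size_en; lia.
pose h' := step_row N q t phi Hs h K g.
have G'E i : (G' i = \sum_j h' j * V i j)%R by rewrite /h' step_row_adj.
have G'K0 : (0 < G' K)%R.
  have [r /andP[r0 _] e] := step_F_floor par ht hy hg geq hG K.
  rewrite /G' eqxx mulr1 e -/W -/dl addrC -addrA.
  have : (0 < q * dl)%R by rewrite mulr_gt0 //; have := par_q par; lia.
  rewrite -/Bq -/G; lia.
(* The matrix after the rotation of row [K] and before the scaling; the quotient by [dl] is exact by
   the adjugate update with both signs 1. *)
have [edet eadj] : (G' K = \det (setrow W K h') /\
  forall i j, ((G' K * V i j + - (G' i - dl * (i == K)%:Z) * V K j) %/ dl)%Z =
     \adj (setrow W K h') j i)%R.
  have := @adj_update n W V K h' 1 1 dl (expr1n _ _) (expr1n _ _) => /=.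
  rewrite -G'E; case.
  - by move=> i j; rewrite mul1r.
  - by rewrite mul1r.
  - by rewrite gt_eqF.
  - by rewrite gt_eqF.
  move=> e1 e2; split; first by rewrite e1 mul1r.
  move=> i j; have := e2 i j; rewrite !mul1r mulN1r -G'E => ->.
  by rewrite mulzK // gt_eqF.
pose W1 := setrow W K h'.
have gsb i : bits (G' i - dl * (i == K)%:Z)%R <= 14 * k2.
  apply: leq_trans (bits_B _ _) _; apply: leq_trans (leq_add (G'b i) (bits_M _ _)) _.
  have d1 : bits dl <= k := dlb; have d2 : bits (i == K) <= 1 := ub i; lia.
have W1b i j : bits ((\adj W1)%R j i) <= 30 * k2.
  rewrite -eadj; apply: leq_trans (bits_Q _ _) _; apply: leq_trans (bits_D _ _) _.
  apply: leq_trans (leq_add (bits_M _ _) (bits_M _ _)) _; rewrite bitsN.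
  have v1 : bits (V i j) <= k := Vb j i; have v2 : bits (V K j) <= k := Vb j K.
  have := G'b K; have := gsb i; lia.
have hA1 : pc f_mcomb (encl (V K) en ::: encm V en en :::
    encl (fun=> G' K) en :::
      encl (fun i => - (G' i - dl * (i == K)%:Z))%R en ::: encl (fun=> dl) en)
    (encm (fun i j => (\adj W1)%R j i) en en) (100 * n1 ^ 2).
  apply: pc_eq.
    apply: (@spec_mcomb _ _ _ _ _ en en V (V K) (fun=> G' K)
      (fun i => - (G' i - dl * (i == K)%:Z))%R (fun=> dl) (14 * k2)).
    + by move=> i j; have := Vb j i; rewrite /V /W; lia.
    + by move=> j; have := Vb j K; rewrite /V /W; lia.
    + by move=> _; have := G'b K; lia.
    + by move=> i; rewrite bitsN.
    + by move=> _; rewrite /dl /W; lia.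
    + by lia.
  - by apply: encm_ext => i j; rewrite eadj.
  - by rewrite size_en -mulnn -mulnA leq_mul2l leq_mul.
pose Ft := step_scale N q t phi Hs h K g.
have Ft0 i : (0 < Ft i)%R by rewrite /Ft /step_scale; case: ifP.
have Ftb i : bits (Ft i) <= 6 * k2.
  by rewrite /Ft /step_scale; case: ifP => _; [rewrite bits1; lia | apply: Fb].
have hFt : pc f_vcomb (VInt 1 ::: VInt (1 - F K)%R ::: VInt 1 :::
    encl F en ::: encl u en) (encl Ft en) (40 * n1).
  apply: pc_eq.
    apply: (@spec_vcomb _ _ _ _ en F u 1 (1 - F K)%R 1 (7 * k2)).
    + by move=> i; have := Fb i; lia.
    + by move=> i; have := ub i; lia.
    + by rewrite b1; lia.
    + by apply: leq_trans (bits_B _ _) _; rewrite b1; have := Fb K; lia.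
    + by rewrite b1; lia.
    + by lia.
  - apply: encl_ext => i; rewrite divz1 mul1r /u /Ft /step_scale -/(F i).
    by case: eqP => [->|_] /=; rewrite ?mulr1 ?mulr0 ?addr0 //; lia.
  - by rewrite size_en; lia.
pose P := (\prod_i Ft i)%R.
have Pb : bits P <= 6 * k2 * n1.
  rewrite /P -big_enum; apply: leq_trans (bits_prod _ Ftb) _; rewrite size_en; lia.
have hP : pc f_prod (encl Ft en) (VInt P) (20 * n1).
  apply: pc_eq; first apply: (@spec_prod _ _ _ _ en Ft (6 * k2)) => //.
  - by rewrite size_en; lia.
  - by rewrite big_enum.
  - by rewrite size_en; lia.
have k2n1 : 4 * (6 * k2 * n1 + 30 * k2) <= s.
  by rewrite /k2; apply: leq_trans s_ge; rewrite -mulnn; nia.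
pose phi' := step_phi N q t phi Hs h g; pose Hs' := step_Hs N q t phi Hs h S K g.
have eW' : facets phi' Hs' = scalerows Ft W1 by apply: facets_stepE.
have hA2 : pc f_mcomb (encl (fun=> 0%R) en :::
    encm (fun i j => (\adj W1)%R j i) en en :::
    encl (fun=> P) en ::: encl (fun=> 0%R) en ::: encl Ft en)
    (encm (fun i j => (\adj (facets phi' Hs'))%R j i) en en) (100 * n1 ^ 2).
  apply: pc_eq.
    apply: (@spec_mcomb _ _ _ _ _ en en (fun i j => (\adj W1)%R j i) (fun=> 0%R) (fun=> P)
      (fun=> 0%R) Ft (6 * k2 * n1 + 30 * k2)) => //.
    + by move=> i j; apply: leq_trans (W1b i j) _; apply: leq_addl.
    + by move=> _; apply: leq_trans Pb _; apply: leq_addr.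
    + by move=> i; apply: leq_trans (Ftb i) (leq_trans (leq_pmulr _ _) (leq_addr _ _)).
  - apply: encm_ext => i j; rewrite mulr0 addr0 eW' /P -adj_scalerows.
    + by rewrite mulrC mulzK // gt_eqF.
    + by move=> l; rewrite gt_eqF.
    + by rewrite -edet gt_eqF.
  - by rewrite size_en -mulnn -mulnA leq_mul2l leq_mul.
have hphi : pc f_vmul (encl F en ::: encl phi en) (encl phi' en) (30 * n1).
  apply: pc_eq; first apply: (@spec_vmul _ _ _ _ en F phi (6 * k2)) => //.
  - by move=> i; have := phib i; lia.
  - by lia.
  - by [].
  - by rewrite size_en; lia.
have hHs : pc f_hscale (encl F en ::: enc_items Hs)
    (enc_items (map (scale_item F) Hs)) (60 * n1 * (size Hs).+1).
  apply: pc_eq; first apply: (@spec_hscale _ _ _ _ _ Hs en (fun (x : item n) (i : 'I_n) =>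
    x.1.1 i) _ F (6 * k2)) => //.
  - by move=> x hx i; apply: leq_trans (yb x hx i) _; lia.
  - by lia.
  - rewrite /enc_items /encx -map_comp; congr enc_list; apply: eq_map => x /=.
    by congr (VPair _ _); apply: encl_ext => i; rewrite ffunE.
  - by rewrite size_en leq_mul2r leq_mul2l leqnSn !orbT.
have hcol : pc f_vcomb (VInt Bq ::: VInt 0 ::: VInt 1 :::
    encl u en ::: encl u en) (encl [ffun i => Bq * (i == K)%:Z]%R en) (40 * n1).
  apply: pc_eq; first apply: (@spec_vcomb _ _ _ _ en u u Bq 0 1 (3 * k2));
    rewrite ?bits1 ?bits0 //; try lia.
  - by move=> i; have := ub i; lia.
  - by move=> i; have := ub i; lia.
  - by apply: encl_ext => i; rewrite divz1 mul0r addr0 ffunE.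
exists K, g; split=> //.
  by split=> // i; apply: leq_trans (Fb i) _; rewrite /k2; clear; lia.
have qtb : bits Qt <= k := Qtb.
have M2b : bits M2 <= k := M2_bits.
have b0 : bits 0 = 0 := bits0.
have dlb' : bits dl <= k := dlb.
have Qgb : bits (Qt * g)%R <= k + k2.
  by apply: leq_trans (bits_M _ _) _; apply: leq_add.
have MQgb : bits (M2 * (Qt * g))%R <= 2 * k + k2.
  by apply: leq_trans (bits_M _ _) _; rewrite mul2n -addnn -addnA leq_add.
have qNb : bits (q * N)%R <= 2 * k.
  by apply: leq_trans (bits_M _ _) _; rewrite mul2n -addnn leq_add.
have qNMb : bits (q * N * (M2 * (Qt * g)))%R <= 4 * k + k2.
  by apply: leq_trans (bits_M _ _) _; apply: leq_trans (leq_add qNb MQgb) _; lia.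
have PGb : bits P <= s /\ bits (G' K) <= s.
  by have := G'b K; split; lia.
eapply pc_intro; [reflexivity | | | ].
- rewrite /enc_state /enc_par; run.
  + exact: hdots.
  + by apply: (hneg G k2) => //; lia.
  + exact: hrat.
  run; rewrite /prim_sem -/W -/dl -/Qt -/M2; try lia.
  + refine (_ : ev A Q s _ _ (VInt B) 10).
    rewrite /B /step_B -/Qt -/M2 -/W -/dl; case: ifP => _.
      by eapply ev_fin; [run | reflexivity | ].
    eapply ev_fin; [run; rewrite /prim_sem -/W -/dl -/Qt -/M2; lia | reflexivity | by []].
  + by lia.
  + by rewrite bits0.
  + exact: hnF.
  + exact: hF.
  + exact: hunit.
  + by apply: (hdotu _ (6 * k2)) => //; lia.
  + by have := Fb K; lia.
  + exact: hG'.
  + by apply: (hdotu _ (12 * k2)) => //; lia.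
  + exact: hlin.
  + by apply: (hconst _ (12 * k2)) => //; lia.
  + exact: hgs.
  + by apply: (hconst _ k) => //; lia.
  + exact: hA1.
  + by rewrite bits1; lia.
  + by have := Fb K; lia.
  + exact: hFt.
  + exact: hP.
  + by apply: (hconst _ (6 * k2 * n1)) => //; lia.
  + exact: hA2.
  + by have := G'b K; lia.
  + by have := PGb.2.
  + exact: hphi.
  + exact: hcol.
  + exact: hHs.
- rewrite /enc_state -/phi' -/Hs' eW' det_scalerows -/P -edet /prim_sem -exprS -eW'.
  congr (VPair _ (VPair _ (VPair _ (VPair _ _)))).
  rewrite /Hs' /step_Hs enc_items_cons /=; congr (VPair (VPair _ (VPair _ _)) _).
  by apply: encl_ext => j; rewrite ffunE.
- have n1le : n1 <= n1 ^ 2 by rewrite -mulnn leq_pmulr.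
  by move: (n1 ^ 2) n1le => X hX; lia.
Qed.

End Update.

(** * Cuts from answers of the black box *)

Section Cuts.

Local Open Scope ring_scope.

Variables (R : realType) (E : center_space) (alpha : R) (rad : 'I_(npts E) -> rat).
Hypothesis rad_gt0 : forall v, 0 < rad v.
Notation n := (npts E).

Lemma big_min_setmin (q : 'I_n -> rat) x r :
  \big[Order.min/+oo%E]_(s <- x :: r) (ratr (q s) : R)%:E = (ratr (setmin q x r))%:E.
Proof.
elim: r x => [|y r IH] x; first by rewrite big_seq1.
rewrite big_cons IH /= /Order.min lte_fin ltr_rat.
by case: (ltgtP (q x) (setmin q y r)) => [||->].
Qed.

Section OneSet.

Variables (S : {set 'I_n}) (x : 'I_n) (r : seq 'I_n).
Hypothesis enumS : enum S = x :: r.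

(** The smallest factor at which [S] covers [v]. *)
Definition reach v : rat := setmin (dist v) x r / rad v.
Definition reach_num v : int := numq (setmin (dist v) x r) * denq (rad v).
Definition reach_den v : int := denq (setmin (dist v) x r) * numq (rad v).

Lemma coveredE (a : R) v : covered a rad v S = (ratr (reach v) <= a).
Proof.
rewrite /covered /set_dist -big_enum enumS big_min_setmin lee_fin.
by rewrite /reach rmorphM fmorphV [RHS]ler_pdivrMr ?ltr0q.
Qed.

Lemma reach_le u v :
  (reach_num v * reach_den u <= reach_num u * reach_den v) = (reach v <= reach u).
Proof.
have nr w : 0 < numq (rad w) by rewrite numq_gt0.
have e w : reach w = (reach_num w)%:~R / (reach_den w)%:~R.
  rewrite /reach /reach_num /reach_den !intrM -mulf_div divq_num_den; congr (_ * _).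
  by rewrite -[in LHS](divq_num_den (rad w)) invf_div.
have d w : 0 < ((reach_den w)%:~R : rat) by rewrite ltr0z mulr_gt0 ?denq_gt0.
rewrite !e [RHS]ler_pdivrMr // [X in _ = (_ <= X)]mulrAC [RHS]ler_pdivlMr //.
by rewrite -!intrM ler_int.
Qed.

Variables (mu : 'I_n -> int) (m : int).
Hypothesis mu_ge0 : forall v, 0 <= mu v.

Let low v := lighter (enum 'I_n) reach_num reach_den mu v.

Lemma lowE v : low v = \sum_(u | reach u < reach v) mu u.
Proof.
rewrite /low /lighter big_enum /= [RHS]big_mkcond; apply: eq_bigr => u _.
by rewrite reach_le ltNge; case: leP.
Qed.

Hypothesis heavy : m < \sum_(v | covered alpha rad v S) mu v.

(* The program does not know [alpha]. Still, if a point were not covered, all the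
   covered weight, which exceeds [m], would have a smaller reach than it. *)
Lemma low_covered v : low v <= m -> covered alpha rad v S.
Proof.
rewrite lowE coveredE => h; rewrite leNgt; apply/negP => hv.
have : \sum_(v | covered alpha rad v S) mu v <= \sum_(u | reach u < reach v) mu u.
  rewrite big_mkcond [X in _ <= X]big_mkcond; apply: ler_sum => u _.
  case: ifP => [|_]; last by case: ifP.
  by rewrite coveredE => hu; rewrite -(ltr_rat R) (le_lt_trans hu hv).
by move: heavy h; lia.
Qed.

(** If some point is not low, take one of smallest reach. All points of smaller reach are low, and
    their weight, which is the [low] value of that point, exceeds [m]. *)
Lemma low_heavy : m < \sum_(v | low v <= m) mu v.
Proof.
have [/forallP h|] := boolP [forall v, low v <= m].
  apply: lt_le_trans heavy _; rewrite big_mkcond [X in _ <= X]big_mkcond.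
  by apply: ler_sum => v _; rewrite h; case: ifP.
rewrite negb_forall => /existsP[v0 hv0].
pose v1 := [arg min_(v < v0 | ~~ (low v <= m)) reach v]%O.
have [hv1 hmin] : ~~ (low v1 <= m) /\ forall u, ~~ (low u <= m) -> reach v1 <= reach u.
  by rewrite /v1; case: arg_minP.
rewrite -ltNge lowE in hv1; apply: lt_le_trans hv1 _.
rewrite big_mkcond [X in _ <= X]big_mkcond; apply: ler_sum => u _.
case: ifP => [hu|_]; last by case: ifP.
by case: ifP => // /negbT /hmin; rewrite leNgt hu.
Qed.

End OneSet.

Lemma covered_self (S : {set 'I_n}) v : v \in S -> covered (1 : R) rad v S.
Proof.
move=> vS; case e : (enum S) => [|x r]; first by move: vS; rewrite -mem_enum e.
rewrite (coveredE e) -(rmorph1 (ratr : rat -> R)) ler_rat.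
rewrite ler_pdivrMr // mul1r; apply: le_trans (ltW (rad_gt0 v)).
have <- : dist v v = 0 by apply/dist_eq0.
by apply: setmin_le; rewrite -e mem_enum.
Qed.

End Cuts.

Section Instance.

Local Open Scope ring_scope.

Variables (R : realType) (E : center_space) (I : lottery E).
Notation n := (npts E).

Definition common_den : int := \prod_v denq (lprob I v).
Definition scaled_prob v : int := numq (lprob I v) * (common_den %/ denq (lprob I v))%Z.

Lemma common_den_gt0 : 0 < common_den.
Proof. by apply: prodr_gt0 => v _; apply: denq_gt0. Qed.

Lemma scaled_probE v : (scaled_prob v)%:~R = common_den%:~R * lprob I v :> rat.
Proof.
have [e he] : exists e, common_den = e * denq (lprob I v).
  by exists (\prod_(u | u != v) denq (lprob I u)); rewrite /common_den (bigD1 v) //= mulrC.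
by rewrite /scaled_prob he mulzK ?denq_neq0 // !intrM numqE; ring.
Qed.

Lemma scaled_prob_itv v : 0 <= scaled_prob v <= common_den.
Proof.
have D0 : 0 < common_den%:~R :> rat by rewrite ltr0z common_den_gt0.
have /andP[p0 p1] := lprob_itv I v.
rewrite -(ler0z rat) -(ler_int rat) scaled_probE pmulr_rge0 // p0 /=.
by rewrite ger_pMr.
Qed.

(* A set covering integral weight more than [(X - 1) / D] covers at least
   [X / D], where [X] is the cost. If the cost is nonpositive, any set will do. *)
Definition cost_of (c : 'I_n -> int) : int := \sum_v scaled_prob v * posz (c v).
Definition query_wt (c : 'I_n -> int) v : int := if cost_of c <= 0 then 1 else posz (c v).
Definition query_thr (c : 'I_n -> int) : int :=
  if cost_of c <= 0 then 0 else ((cost_of c - 1) %/ common_den)%Z.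

Lemma posz_ge0 z : 0 <= posz z.
Proof. by rewrite /posz; case: ifP. Qed.

Lemma query_wt_ge0 c v : 0 <= query_wt c v.
Proof. by rewrite /query_wt; case: ifP => // _; apply: posz_ge0. Qed.

Lemma query_thr_ge0 c : 0 <= query_thr c.
Proof.
rewrite /query_thr; case: ifP => // /negbT; rewrite -ltNge => h.
by rewrite divz_ge0 ?common_den_gt0 //; lia.
Qed.

Lemma query_rat_wt_ge0 c v : 0 <= ((query_wt c v)%:~R : rat).
Proof. by rewrite ler0z query_wt_ge0. Qed.

Lemma query_rat_thr_ge0 c : 0 <= ((query_thr c)%:~R : rat).
Proof. by rewrite ler0z query_thr_ge0. Qed.

Definition query (c : 'I_n -> int) : fractional E :=
  Fractional (lrad_gt0 I) (query_rat_wt_ge0 c) (query_rat_thr_ge0 c).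

Lemma weight_coveredE (a : R) c S : weight_covered a (query c) S =
  (\sum_(v | covered a (lrad I) v S) query_wt c v)%:~R.
Proof. by rewrite /weight_covered rmorph_sum. Qed.

(** The low points have integral weight above [(cost - 1) / D], so [D] times this weight is at least
    the cost, which dominates the product of the scaled demands with [c]. For nonpositive cost it is
    enough that only points with [c >= 0] are chosen. *)
Lemma cut_valid (alpha : R) c (S : {set 'I_n}) x r : enum S = x :: r ->
  query_thr c < \sum_(v | covered alpha (lrad I) v S) query_wt c v ->
  let low v := lighter (enum 'I_n) (reach_num (lrad I) x r) (reach_den (lrad I) x r)
    (query_wt c) v in
  let b v := (0 <= c v) && (low v <= query_thr c) in
  (forall v, b v -> covered alpha (lrad I) v S) /\
  \sum_v (if b v then scaled_prob v - common_den else scaled_prob v) * c v <= 0.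
Proof.
move=> eS hv low b.
have cov v : b v -> covered alpha (lrad I) v S.
  by case/andP => _; apply: (low_covered (lrad_gt0 I) eS (query_wt_ge0 c) hv).
have hlow : query_thr c < \sum_(v | low v <= query_thr c) query_wt c v.
  exact: (low_heavy (lrad_gt0 I) x r (query_wt_ge0 c) hv).
split=> //.
have -> : \sum_v (if b v then scaled_prob v - common_den else scaled_prob v) * c v =
    \sum_v scaled_prob v * c v - common_den * \sum_(v | b v) c v.
  rewrite [\sum_(v | b v) _]big_mkcond mulr_sumr -sumrB; apply: eq_bigr => v _.
  by case: (b v); ring.
have h1 : \sum_v scaled_prob v * c v <= cost_of c.
  apply: ler_sum => v _; have /andP[p0 _] := scaled_prob_itv v.
  by apply: ler_wpM2l => //; rewrite /posz; case: ifP => // /negbT; rewrite -ltNge => /ltW.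
have D0 := common_den_gt0.
have h2 : 0 <= \sum_(v | b v) c v by apply: sumr_ge0 => v /andP[].
rewrite subr_le0; have [X0|X0] := leP (cost_of c) 0.
  by apply: le_trans h1 (le_trans X0 _); rewrite mulr_ge0 // ltW.
apply: le_trans h1 _.
have wE v : query_wt c v = posz (c v) by rewrite /query_wt leNgt X0.
have {}hlow : ((cost_of c - 1) %/ common_den)%Z < \sum_(v | b v) c v.
  have <- : query_thr c = ((cost_of c - 1) %/ common_den)%Z.
    by rewrite /query_thr leNgt X0.
  have -> : \sum_(v | b v) c v = \sum_(v | low v <= query_thr c) query_wt c v.
    rewrite big_mkcond [RHS]big_mkcond; apply: eq_bigr => v _; rewrite wE /b /posz.
    by case: (0 <= c v) => //=; case: ifP.
  exact: hlow.
have := divz_eq (cost_of c - 1) common_den.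
have := ltz_pmod (cost_of c - 1) D0.
move: hlow; move: (_ %/ _)%Z (_ %% _)%Z (\sum_(v | b v) c v) => a t w h3 h4 h5.
have : (a + 1) * common_den <= w * common_den by rewrite ler_pM2r //; lia.
lia.
Qed.

(** Averaging: under a 1-approximate distribution the expected covered weight, times [D], is at
    least the cost, but every set of the family reaches at most the cost minus 1. *)
Lemma none_sound c :
  (~ exists2 S, S \in fam E & fthr (query c) < weight_covered (1 : R) (query c) S) ->
  ~ exists P : {set 'I_n} -> R, lottery_approx 1 I P.
Proof.
move=> hn [P [[P0 P1 Pfam] hP]].
have hS S : S \in fam E ->
    \sum_(v | covered (1 : R) (lrad I) v S) query_wt c v <= query_thr c.
  move=> hSf; rewrite leNgt; apply/negP => h; apply: hn; exists S => //.
  by rewrite weight_coveredE ltr_int.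
(* For nonpositive cost all weights are 1 and the threshold is 0. A nonempty set covers its own
   points, so a refusal means that the family is empty and carries no distribution. *)
have [X0|X0] := leP (cost_of c) 0.
  have fam0 S : S \notin fam E.
    apply/negP => hSf; have /set0Pn[v vS] := fam_nonempty hSf.
    have := hS S hSf; rewrite /query_thr X0; apply/negP; rewrite -ltNge.
    rewrite (bigD1 v) ?covered_self //=; last exact: lrad_gt0.
    rewrite {1}/query_wt X0; apply: lt_le_trans (_ : 1 <= _) => //.
    by rewrite lerDl sumr_ge0 // => u _; apply: query_wt_ge0.
  move: P1; rewrite big1 => [/eqP|S _]; last by rewrite Pfam.
  by rewrite eq_sym oner_eq0.
have D0 := common_den_gt0.
pose X := cost_of c; pose mu := query_wt c.
have muE v : mu v = posz (c v) by rewrite /mu /query_wt leNgt X0.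
have h1 S : S \in fam E -> common_den * \sum_(v | covered (1 : R) (lrad I) v S) mu v <= X - 1.
  have tE : query_thr c = ((X - 1) %/ common_den)%Z by rewrite /query_thr leNgt X0.
  move=> /hS; rewrite tE => h.
  apply: le_trans (_ : common_den * ((X - 1) %/ common_den)%Z <= _).
    by rewrite ler_pM2l.
  by rewrite mulrC lez_floor // gt_eqF.
pose f (z : int) : R := z%:~R.
have f0 v : 0 <= f (mu v) by rewrite ler0z query_wt_ge0.
have h2 : f X <= \sum_S P S * f (common_den * \sum_(v | covered (1 : R) (lrad I) v S) mu v).
  have -> : f X = \sum_v f common_den * f (mu v) * ratr (lprob I v).
    rewrite /f /X /cost_of rmorph_sum /=; apply: eq_bigr => v _.
    have e : (scaled_prob v)%:~R = common_den%:~R * ratr (lprob I v) :> R.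
      by rewrite -!(ratr_int R) -rmorphM -scaled_probE.
    by rewrite intrM -muE e; ring.
  have -> : \sum_S P S * f (common_den * \sum_(v | covered (1 : R) (lrad I) v S) mu v) =
      \sum_v f common_den * f (mu v) * \sum_(S | covered (1 : R) (lrad I) v S) P S.
    under [RHS]eq_bigr do rewrite big_mkcond mulr_sumr.
    rewrite exchange_big /=; apply: eq_bigr => S _.
    rewrite /f intrM rmorph_sum /= mulrCA mulrA mulrC big_mkcond mulr_suml.
    apply: eq_bigr => v _; case: ifP => _; rewrite ?mul0r ?mulr0 //; ring.
  apply: ler_sum => v _; apply: ler_wpM2l (hP v).
  by rewrite mulr_ge0 // ler0z ltW.
have h3 : \sum_S P S * f (common_den * \sum_(v |
  covered (1 : R) (lrad I) v S) mu v) <= f (X - 1).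
  have -> : f (X - 1) = \sum_S P S * f (X - 1) by rewrite -mulr_suml P1 mul1r.
  apply: ler_sum => S _.
  have [hSf|hSf] := boolP (S \in fam E); last by rewrite Pfam // !mul0r.
  by apply: ler_wpM2l => //; rewrite /f ler_int; apply: h1.
by have := le_trans h2 h3; rewrite /f ler_int; lia.
Qed.

End Instance.

(** * Running a query *)

Lemma enc_lotteryE (E : center_space) (I : lottery E) : enc_lottery I =
  VInt (npts E) ::: enc_dist E ::: encq (lrad I) (enum 'I_(npts E)) :::
    encq (lprob I) (enum 'I_(npts E)) ::: fam_spec E ::: VInt 0.
Proof. by []. Qed.

Lemma enc_fractionalE (E : center_space) (J : fractional E) : enc_fractional J =
  VInt (npts E) ::: enc_dist E ::: encq (frad J) (enum 'I_(npts E)) :::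
    encq (fwt J) (enum 'I_(npts E)) ::: enc_rat (fthr J) :::
      fam_spec E ::: VInt 0.
Proof. by []. Qed.

Lemma dsize_encq_int T (r : seq T) (f : T -> int) k : (forall i, bits (f i) <= k) ->
  dsize (encq (fun i => (f i)%:~R)%R r) <= (k + 5) * (size r).+1.
Proof.
move=> hf; elim: r => [|x r IH]; first by rewrite /= bits0; lia.
rewrite encq_cons numq_int denq_int /= bits1; have := hf x; lia.
Qed.

(** The running time of the black box is only controlled on encodings of genuine instances over the
    same space and of bounded size. *)
Definition allowed (E : center_space) (s : nat) (q : data) : Prop :=
  exists J : fractional E, q = enc_fractional J /\ dsize (enc_fractional J) <= s.

Section Query.

Variables (R : realType) (alpha : R) (E : center_space) (I : lottery E).
Variables (A : blackbox) (s k : nat).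
Hypothesis approx : fractional_approx_alg E alpha A.
Notation n := (npts E).
Notation en := (enum 'I_n).
Notation n1 := (n.+2).
Notation pc := (pc A (allowed E s) s).
Notation D := (common_den I).
Notation pint := (scaled_prob I).

Hypothesis s_ge : dsize (enc_lottery I) + 100 * k.+1 * n1 ^ 2 <= s.
Hypothesis dist_num : forall i j, bits (numq (@dist E i j)) <= k.
Hypothesis dist_den : forall i j, bits (denq (@dist E i j)) <= k.
Hypothesis rad_num : forall i, bits (numq (lrad I i)) <= k.
Hypothesis rad_den : forall i, bits (denq (lrad I i)) <= k.
Hypothesis D_bits : bits D <= k.

Let size_en : size en = n. Proof. by rewrite size_enum_ord. Qed.

Lemma pint_bits v : bits (pint v) <= k.
Proof.
apply: bits_le_norm D_bits; have /andP[h0 h1] := scaled_prob_itv I v.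
by rewrite ger0_norm.
Qed.

Definition query_arg (c : 'I_n -> int) : data :=
  encl c en ::: encl pint en ::: VInt D :::
    encl (fun=> 1%R) en ::: enc_lottery I.

Lemma spec_query c : (forall v, bits (c v) <= k) ->
  (pc f_query (query_arg c) (VInt 0) (2000 * n1 ^ 3) /\
     ~ exists P : {set 'I_n} -> R, lottery_approx 1 I P) \/
  exists (S : {set 'I_n}) (h : 'I_n -> int), [/\ S \in fam E,
    forall v, h v = pint v \/ h v = (pint v - D)%R /\ covered alpha (lrad I) v S,
    (\sum_v h v * c v <= 0)%R &
    pc f_query (query_arg c) (encl h en ::: enc_option (@enc_set n) (Some S))
      (2000 * n1 ^ 3)].
Proof.
move=> cb; have s_ge' : 100 * k.+1 * n1 ^ 2 <= s by apply: leq_trans s_ge; apply: leq_addl.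
have k1 : 0 < k.
  by apply: leq_trans D_bits; rewrite ltnNge bits_leE; have := common_den_gt0 I; lia.
have s1 : 100 * k.+1 * n1 <= s by apply: leq_trans s_ge'; rewrite -mulnn; nia.
have ns : n < s by nia.
have mub v : bits (posz (c v)) <= k by rewrite /posz; case: ifP; rewrite ?bits0.
pose X := cost_of I c.
have Xb : bits X <= 2 * k * n.
  rewrite /X /cost_of -big_enum_ord; apply: leq_trans (bits_dot en pint_bits mub) _.
  by rewrite size_en; lia.
have wtb v : bits (query_wt I c v) <= k by rewrite /query_wt; case: ifP => // _; rewrite bits1.
pose m := query_thr I c.
have mb : bits m <= 2 * k * n1.
  rewrite /m /query_thr; case: ifP => _; first by rewrite bits0.
  apply: leq_trans (bits_Q _ _) _; apply: leq_trans (bits_B _ _) _.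
  by have := Xb; rewrite bits1 /X; nia.
have hpos : pc f_pos (encl c en) (encl (fun v => posz (c v)) en) (20 * n1).
  by apply: pc_eq; first apply: (spec_pos en cb); [nia | | rewrite size_en; lia].
have hX : pc f_dot (encl pint en ::: encl (fun v => posz (c v)) en) (VInt X) (30 * n1).
  apply: pc_eq; first apply: (spec_dot pint_bits mub).
  - by rewrite size_en; nia.
  - by rewrite big_enum_ord.
  - by rewrite size_en; lia.
have hwrap : pc f_wrap (encl (query_wt I c) en) (encq (fwt (query I c)) en) (20 * n1).
  by apply: pc_eq; first apply: spec_wrap; [ | rewrite size_en; lia].
have hq : VInt n ::: enc_dist E ::: encq (lrad I) en :::
    encq (fwt (query I c)) en ::: (VInt m ::: VInt 1) :::
      fam_spec E ::: VInt 0 = enc_fractional (query I c).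
  by rewrite enc_fractionalE /= /enc_rat numq_int denq_int.
(* The query shares the metric, the radii and the family with the input; only weights of at most [k]
   bits and a threshold are new. *)
have hqs : dsize (enc_fractional (query I c)) <= s.
  apply: leq_trans s_ge; rewrite -hq enc_lotteryE; cbn [dsize].
  have h1 := dsize_encq_int en wtb; rewrite size_en in h1.
  have h3 : (k + 5) * n.+1 + 2 * k * n1 + 10 <= 100 * k.+1 * (n1 * n1).
    by clear; nia.
  have h2 : dsize (encq (fwt (query I c)) en) <= (k + 5) * n.+1 by exact: h1.
  rewrite bits1 -mulnn; move: h2 mb h3.
  move: (dsize (encq (fwt _) _)) (bits m) (100 * _) (_ * n.+1) (2 * k * n1) => a1 a2 a3 a4 a5.
  lia.
have hall : allowed E s (enc_fractional (query I c)) by exists (query I c).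
have Xs : bits X <= s by apply: leq_trans Xb _; nia.
have Ds : bits D <= s by apply: leq_trans D_bits _; nia.
have X1s : bits (X - 1)%R <= s.
  by apply: leq_trans (bits_B _ _) _; rewrite bits1; move: Xb; nia.
have [o ho hsol] := approx (query I c).
have nn : n1 <= n1 ^ 3 by rewrite expnS leq_pmulr // expn_gt0.
case: o ho hsol => [S|] ho hsol; last first.
  left; split; last exact: (none_sound (R := R) (c := c)).
  eapply pc_intro; [reflexivity | | reflexivity | ].
    rewrite /query_arg enc_lotteryE; run.
    + exact: hpos.
    + exact: hX.
    + exact: Xs.
    + by rewrite bits0.
    + refine (_ : ev _ _ _ _ _ (encl (query_wt I c) en ::: VInt m) 12).
      rewrite /m /query_wt /query_thr -/X; case: ifP => hX0.
        by eapply ev_fin; [run | reflexivity | ].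
      eapply ev_fin; [run; rewrite /prim_sem ?bits1; try lia; exact: X1s | reflexivity | by []].
    + run.
      * eapply ev_fin; [eapply ev_ask; [run; exact: hwrap | rewrite hq; exact: hall |
          rewrite hq; exact: hqs] | rewrite hq; exact: ho | exact: leqnn].
      * by rewrite /enc_option; run.
  by move: (n1 ^ 3) nn => N3 nn; simpl; lia.
have [Sf hv] := hsol.
right; case eS : (enum S) => [|x r].
  have /set0Pn[v] := fam_nonempty Sf; by rewrite -mem_enum eS.
rewrite weight_coveredE /= ltr_int in hv.
have [hcov hcut] := cut_valid eS hv.
pose Xn v := reach_num (lrad I) x r v; pose Xd v := reach_den (lrad I) x r v.
pose low v := lighter en Xn Xd (query_wt I c) v.
pose h v : int := if (0 <= c v)%R && (low v <= m)%R then (pint v - D)%R else pint v.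
exists S, h; split=> //.
  by move=> v; rewrite /h; case: ifP => hb; [right; split=> //; apply: hcov | left].
have Xnb v : bits (Xn v) <= 2 * k.
  rewrite /Xn /reach_num; have [z _ ->] := setmin_in (dist v) x r.
  by apply: leq_trans (bits_M _ _) _; rewrite mul2n -addnn leq_add.
have Xdb v : bits (Xd v) <= 2 * k.
  rewrite /Xd /reach_den; have [z _ ->] := setmin_in (dist v) x r.
  by apply: leq_trans (bits_M _ _) _; rewrite mul2n -addnn leq_add.
have szr : size r < n.
  have : size (enum S) <= n by rewrite -cardE -[X in _ <= X]card_ord max_card.
  by rewrite eS.
have hrho : pc f_rhos (encl (posn n) (x :: r) :::
      enc_dist E ::: encq (lrad I) en) (encp Xn Xd en) (500 * n1 ^ 3).
  apply: pc_eq; first apply: (spec_rhos en x r dist_num dist_den rad_num rad_den) => //.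
  - by nia.
  - by [].
  - rewrite size_en !expnS expn0 muln1; move: szr ns {nn}; clear.
    move: (size r) => a ha _.
    have h1 : n + 5 <= 5 * n1 by lia.
    have h2 : 100 * (n + 5) <= 500 * n1 by lia.
    rewrite -mulnA (leq_trans (leq_mul h2 (leq_mul (_ : a.+1 <= n1) (_ : n.+1 <= n1)))) //;
      first by lia.
    by rewrite !mulnA.
have hh : pc f_hvec (VInt m ::: VInt D ::: encl (query_wt I c) en :::
      encp Xn Xd en ::: encp Xn Xd en ::: encl c en ::: encl pint en)
    (encl h en) (200 * n1 ^ 3).
  have kk : k <= 2 * k * n1 by clear; nia.
  apply: pc_eq; first apply: (@spec_hvec _ _ _ _ en en Xn Xd (query_wt I c) c pint m D (2 * k
    * n1)).
  - by move=> v; apply: leq_trans (Xnb v) _; clear; nia.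
  - by move=> v; apply: leq_trans (Xdb v) _; clear; nia.
  - by move=> v; apply: leq_trans (wtb v) kk.
  - by move=> v; apply: leq_trans (cb v) kk.
  - by move=> v; apply: leq_trans (pint_bits v) kk.
  - exact: mb.
  - exact: leq_trans D_bits kk.
  - by rewrite size_en; apply: leq_trans s_ge'; rewrite -mulnn; clear; nia.
  - by [].
  - by rewrite size_en !expnS expn0 muln1; clear; nia.
have hSE : enc_set S = encl (posn n) (x :: r) by rewrite -eS.
eapply pc_intro; [reflexivity | | | ].
- rewrite /query_arg enc_lotteryE; run.
  + exact: hpos.
  + exact: hX.
  + exact: Xs.
  + by rewrite bits0.
  + refine (_ : ev _ _ _ _ _ (encl (query_wt I c) en ::: VInt m) 12).
    rewrite /m /query_wt /query_thr -/X; case: ifP => hX0.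
      by eapply ev_fin; [run | reflexivity | ].
    eapply ev_fin; [run; rewrite /prim_sem ?bits1; try lia; exact: X1s | reflexivity | by []].
  + run.
    * eapply ev_fin; [eapply ev_ask; [run; exact: hwrap | rewrite hq; exact: hall |
          rewrite hq; exact: hqs] | rewrite hq; exact: ho | exact: leqnn].
    * rewrite /enc_option; run.
      -- rewrite hSE; exact: hrho.
      -- exact: hh.
- by [].
- by move: (n1 ^ 3) nn => N3 nn; simpl; lia.
Qed.

End Query.

(** * Running the main loop *)

Lemma bits_sum_in (T : eqType) (r : seq T) (f : T -> int) k :
  (forall i, i \in r -> bits (f i) <= k) -> bits (\sum_(i <- r) f i)%R <= k * size r.
Proof.
move=> h; rewrite big_seq big_mkcond; apply: bits_sum => i.
by case: ifP => [/h|]; rewrite ?bits0.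
Qed.

Lemma bits_sum_ord n (f : 'I_n -> int) k :
  (forall i, bits (f i) <= k) -> bits (\sum_i f i)%R <= k * n.
Proof.
by move=> h; rewrite -big_enum_ord; have := bits_sum (enum 'I_n) h; rewrite size_enum_ord.
Qed.

Section Loop.

Variables (R : realType) (alpha : R) (E : center_space) (I : lottery E).
Variables (A : blackbox) (s k : nat).
Hypothesis approx : fractional_approx_alg E alpha A.
Notation n := (npts E).
Notation en := (enum 'I_n).
Notation n1 := (n.+2).
Notation pc := (pc A (allowed E s) s).
Notation D := (common_den I).
Notation pint := (scaled_prob I).

Variables (N Wm q : int) (kap : nat).
Hypothesis par : params n D N Wm q kap.
Notation tm := (tmax n kap).
Hypothesis N_large : (2 * n%:Z * (n.+1`!%:R * D ^+ n) < N)%R.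

Hypothesis s_ge : dsize (enc_lottery I) + 3000 * k.+1 * n1 ^ 4 * tm.+2 <= s.
Hypothesis dist_num : forall i j, bits (numq (@dist E i j)) <= k.
Hypothesis dist_den : forall i j, bits (denq (@dist E i j)) <= k.
Hypothesis rad_num : forall i, bits (numq (lrad I i)) <= k.
Hypothesis rad_den : forall i, bits (denq (lrad I i)) <= k.
Hypothesis q_bits : bits q <= k.
Hypothesis M2_bits : bits (2 * (n%:Z * n%:Z))%R <= k.
Hypothesis det_bits : bits (n`!%:R * (Wm * q ^+ tm) ^+ n.+1)%R <= k.

Let size_en : size en = n. Proof. by rewrite size_enum_ord. Qed.

(* The two alternatives are [h = D * prob - D * 1_C] for some set [C] of points
   [alpha]-covered by [S], with [C] itself not recorded. *)
Definition sound_item (z : item n) : Prop :=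
  z.2 \in fam E /\ forall v, z.1.2 v = pint v \/
    z.1.2 v = (pint v - D)%R /\ covered alpha (lrad I) v z.2.

Definition loop_out (v : data) : Prop :=
  (v = VInt 0 /\ ~ exists P : {set 'I_n} -> R, lottery_approx 1 I P) \/
  exists V tg dl, [/\ cone_basis D V tg dl, (forall i, 0 <= V i ord0)%R,
    (forall i z, tg i = Some z -> sound_item z) &
    v = pur_out V tg dl ::: VInt 0].

Definition loop_arg (phi : 'I_n -> int) (Hs : seq (item n)) t : data :=
  enc_state phi Hs (q ^+ t)%R ::: enc_par n q N ::: encl pint en :::
    VInt D ::: VInt N ::: enc_lottery I.

(** The cost of an iteration times the number of iterations that may remain, plus the cost of the
    final reduction. *)
Definition loop_cost t :=
  5000 * n1 ^ 3 * tm.+2 * (tm.+1 - t) + 5000 * k.+1 * n1 ^ 3 * tm.+2.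

Let D1 : (1 <= D)%R := par_D par.
Let N1 : (1 <= N)%R := par_N par.
Let q1 : (1 <= q)%R := par_q par.

Let Wm_ge : (1 + D + N + D * N <= Wm)%R.
Proof.
have : (0 <= (D - 1) * (N - 1))%R by apply: mulr_ge0; have := D1; have := N1; lia.
by have := par_Wm par; lia.
Qed.

Let Wm_gt : (1 + N < Wm)%R /\ (1 + D < Wm)%R /\ (2 <= Wm)%R.
Proof.
have : (0 < D * N)%R by apply: mulr_gt0; have := D1; have := N1; lia.
by have := Wm_ge; have := D1; have := N1; lia.
Qed.

Let qt_gt0 t : (0 < q ^+ t)%R. Proof. by apply: exprn_gt0; lia. Qed.

Let Wq_ge a t : (a <= Wm)%R -> (a * q ^+ t <= Wm * q ^+ t)%R.
Proof. by move=> h; apply: ler_wpM2r => //; apply: ltW. Qed.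

Let Wq_ge1 t : (1 <= Wm * q ^+ t)%R.
Proof.
apply: le_trans (_ : 1 * q ^+ t <= _)%R; first by have := qt_gt0 t; lia.
by apply: Wq_ge; have := Wm_gt; lia.
Qed.

Let qt_le t : t <= tm -> (q ^+ t <= q ^+ tm)%R.
Proof. by move=> h; apply: ler_weXn2l. Qed.

(** Determinant, adjugate, [phi] and multiplicities are all of this form, so one hypothesis controls
    every bit length. The exponent [n.+1] makes room for linear quantities even when [n = 0]. *)
Lemma pow_bits (z : int) m t : m <= n.+1 -> t <= tm ->
  (`|z| <= n`!%:R * (Wm * q ^+ t) ^+ m)%R -> bits z <= k.
Proof.
move=> hm ht hz; apply: bits_le_norm det_bits; apply: le_trans hz _.
have f0 : (0 <= n`!%:R :> int)%R by rewrite ler0n.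
apply: ler_wpM2l => //.
have h1 := Wq_ge1 t.
apply: le_trans (_ : (Wm * q ^+ t) ^+ n.+1 <= _)%R; first exact: ler_weXn2l.
apply: lerXn2r; rewrite ?nnegrE.
- by lia.
- by have := Wq_ge1 tm; lia.
by apply: ler_wpM2l; [have := Wm_gt; lia | exact: qt_le].
Qed.

Lemma lin_bits z t : t <= tm -> (`|z| <= Wm * q ^+ t)%R -> bits z <= k.
Proof.
move=> ht hz; apply: (@pow_bits z 1 t) => //; rewrite expr1.
apply: le_trans hz _; rewrite ler_peMl ?ler1n ?fact_gt0 //.
by have := Wq_ge1 t; lia.
Qed.

(** The induction hypothesis is a premise, required only while [t < tm]; the growth of the
    determinant guarantees this bound whenever a cut is found. *)
Lemma spec_loop_step t phi Hs :
  cuts_ok D phi Hs -> centered Wm q t phi Hs -> t <= tm ->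
  (ytot Hs < N * q ^+ t)%R -> grown q t phi Hs -> size Hs = t ->
  (forall z, z \in Hs -> sound_item z) ->
  (forall phi' Hs', t < tm -> cuts_ok D phi' Hs' -> centered Wm q t.+1 phi' Hs' ->
     (ytot Hs' < N * q ^+ t.+1)%R -> grown q t.+1 phi' Hs' -> size Hs' = t.+1 ->
     (forall z, z \in Hs' -> sound_item z) ->
     exists v, loop_out v /\ pc f_loop (loop_arg phi' Hs' t.+1) v (loop_cost t.+1)) ->
  exists v, loop_out v /\ pc f_loop (loop_arg phi Hs t) v (loop_cost t).
Proof.
move=> ok hc ht hy hg hsz hgood IH.
have k1 : 0 < k.
  by apply: leq_trans q_bits; rewrite ltnNge bits_leE; have := q1; lia.
have n1g : 2 <= n1 by [].
pose X := k.+1 * n1 ^ 2 * tm.+2.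
pose B := n1 ^ 3 * tm.+2.
have costE : loop_cost t = 5000 * (B * (tm.+1 - t)) + 5000 * (k.+1 * B).
  by rewrite /loop_cost /B !mulnA.
have B_n1 : n1 * tm.+2 <= B by rewrite /B leq_mul2r orbC -[X in X <= _]expn1 leq_exp2l.
have B_n2 : n1 ^ 2 * tm.+2 <= B by rewrite /B leq_mul2r orbC leq_exp2l.
have B_n3 : n1 ^ 3 <= B by rewrite /B leq_pmulr.
have n23 : n1 ^ 2 <= n1 ^ 3 by rewrite leq_exp2l.
have n13 : n1 <= n1 ^ 3 by rewrite -[X in X <= _]expn1 leq_exp2l.
have B_t : B <= B * (tm.+1 - t) by rewrite leq_pmulr // subn_gt0.
have s1 : 3000 * k.+1 * n1 ^ 4 * tm.+2 <= s by apply: leq_trans s_ge; apply: leq_addl.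
have s_X : 3000 * X <= s.
  apply: leq_trans s1; rewrite /X (expnD n1 2 2).
  have : 0 < n1 ^ 2 by rewrite expn_gt0.
  by move: (n1 ^ 2) => a ha; move: (k.+1) (tm.+2) => u v; clear -ha; nia.
have s_nn : 3000 * (k.+1 * n1 ^ 4) <= s.
  by apply: leq_trans s1; clear; nia.
have s_n3 : 3000 * (k.+1 * n1 ^ 3) <= s.
  by apply: leq_trans s_nn; rewrite (expnS n1 3); clear; nia.
have s_n2 : 3000 * (k.+1 * n1 ^ 2) <= s.
  by apply: leq_trans s_n3; rewrite (expnS n1 2); clear; nia.
have s_n1 : 3000 * (k.+1 * n1) <= s.
  by apply: leq_trans s_n2; rewrite -mulnn; clear; nia.
have Db : bits D <= k.
  by apply: (@lin_bits _ 0) => //; rewrite expr0 mulr1; have := D1; have := Wm_gt; lia.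
have Nb : bits N <= k.
  by apply: (@lin_bits _ 0) => //; rewrite expr0 mulr1; have := N1; have := Wm_gt; lia.
have Qtb : bits (q ^+ t)%R <= k.
  apply: (lin_bits ht); rewrite gtr0_norm //.
  have h1 : (1 * q ^+ t <= Wm * q ^+ t)%R by apply: Wq_ge; have := Wm_gt; lia.
  by lia.
have Fle i j : (`|facets phi Hs i j| <= Wm * q ^+ t)%R by apply: (facets_le par).
have Wq1 := Wq_ge1 t.
have Vb i j : bits ((\adj (facets phi Hs))%R i j) <= k.
  by apply: (@pow_bits _ n.-1 t) => //; [lia | apply: adj_bound].
have dlb : bits (\det (facets phi Hs))%R <= k.
  by apply: (@pow_bits _ n t) => //; apply: det_bound.
have phib i : bits (phi i) <= k.
  apply: (lin_bits ht); have := phi_le par i ok hc ht; have := phi_gt0 ok i.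
  have h1 : (D * ytot Hs <= D * (N * q ^+ t))%R by apply: ler_wpM2l; have := D1; lia.
  have h2 : ((2 + D * N) * q ^+ t <= Wm * q ^+ t)%R.
    by apply: Wq_ge; have := D1; have := N1; have := Wm_ge; lia.
  by move: h1 h2; rewrite mulrDl mulrA; lia.
have yb x : x \in Hs -> forall i, bits (x.1.1 i) <= k.
  move=> hx i; apply: (lin_bits ht); have := y_le_ytot i ok hx; have := y_ge0 ok hx i.
  have h1 : (N * q ^+ t <= Wm * q ^+ t)%R by apply: Wq_ge; have := Wm_gt; have := D1; lia.
  by lia.
pose V i j := (\adj (facets phi Hs))%R j i.
pose c j := (\sum_i V i j)%R.
have cb j : bits (c j) <= k * n1.
  rewrite /c -big_enum_ord; apply: leq_trans (bits_sum en (fun i => Vb j i)) _.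
  by rewrite size_en leq_mul2l; apply/orP; right; lia.
have hlin : pc f_lincomb (encl (fun=> 0%R) en ::: encl (fun=> 1%R) en :::
    encm V en en) (encl c en) (100 * n1 ^ 2).
  apply: pc_eq; first apply: (@spec_lincomb _ _ _ _ _ en en V (fun=> 0%R) (fun=> 1%R) k) => //.
  - by move=> i j; apply: Vb.
  - by rewrite size_en; apply: leq_trans s_n1; clear; nia.
  - by apply: encl_ext => j; rewrite add0r big_enum_ord; apply: eq_bigr => i _; rewrite mul1r.
  - by rewrite size_en -mulnn -mulnA leq_mul2l leq_mul.
have kk : k <= k * n1 by rewrite leq_pmulr.
have hs_q : dsize (enc_lottery I) + 100 * (k * n1).+1 * n1 ^ 2 <= s.
  apply: leq_trans s_ge; rewrite leq_add2l.
  apply: leq_trans (_ : 3000 * k.+1 * n1 ^ 4 * 1 <= _); last by rewrite leq_mul2l orbT.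
  by rewrite !expnS expn0; clear; nia.
have := @spec_query R alpha E I A s (k * n1) approx hs_q
  (fun i j => leq_trans (dist_num i j) kk) (fun i j => leq_trans (dist_den i j) kk)
  (fun i => leq_trans (rad_num i) kk) (fun i => leq_trans (rad_den i) kk)
  (leq_trans Db kk) c cb.
case=> [[hq none]|[S [h [Sf hh hcut hq]]]].
  exists (VInt 0); split; first by left.
  eapply pc_intro; [reflexivity | | reflexivity | ].
    rewrite /loop_arg enc_lotteryE /enc_state /enc_par; run.
    - exact: hlin.
    - by rewrite -enc_lotteryE; exact: hq.
    - by run.
  rewrite costE; move: B_n3 B_t n23 n13; rewrite /=.
  by move: (n1 ^ 3) (n1 ^ 2) (k.+1 * B) (B * _) => a1 a2 a3 a4; clear; lia.
(* The answer is a nonempty member of the family. *)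
have n_gt0 : 0 < n by have /set0Pn[v _] := fam_nonempty Sf; apply: leq_ltn_trans (ltn_ord v).
have t_lt : t < tm := grown_time par n_gt0 ok hc ht hy hg.
have hD j : (`|h j| <= D)%R.
  by have /andP[p0 p1] := scaled_prob_itv I j; case: (hh j) => [->|[-> _]]; lia.
have hG : (\sum_i step_G phi Hs h i <= 0)%R.
  apply: le_trans hcut; rewrite /step_G exchange_big /= le_eqVlt; apply/orP; left.
  by apply/eqP; apply: eq_bigr => j _; rewrite /c /V mulr_sumr.
have s_up : 1000 * k.+1 * n1 ^ 2 <= s by apply: leq_trans s_n2; clear; nia.
have [K [g [Gle geq [Fb Bqb] hup]]] :=
  spec_update (A := A) (Q := allowed E s) par s_up Db q_bits Nb M2_bits n_gt0 S ok ht hy hg hD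
    hG
    Vb dlb Qtb phib yb.
have ok' := cuts_ok_step par S ok ht hy hg hD Gle geq hG.
have hc' := centered_step par S ok hc ht hy hg geq hG.
have hg' := grown_step par (S := S) ok hc ht hy hg hD Gle geq hG.
move: ok' hc' hg' hup.
set phi' := step_phi _ _ _ _ _ _ _; set Hs' := step_Hs _ _ _ _ _ _ _ _ _ => ok' hc' hg' hup.
have sz' : size Hs' = t.+1 by rewrite /Hs' /step_Hs /= size_map hsz.
(* At most [12 * k * n1] bits come from the scaling factor and [k] from the scaled number. The
   bounds through [Wm] cannot be used here, since the total multiplicity may just have passed
   [N * q ^+ t.+1]. *)
pose k3 := 13 * k * n1.
have phib' i : bits (phi' i) <= k3.
  apply: leq_trans (bits_M _ _) _; apply: leq_trans (leq_add (Fb i) (phib i)) _.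
  by rewrite /k3; clear; nia.
have yb' x : x \in Hs' -> forall i, bits (x.1.1 i) <= k3.
  rewrite /Hs' /step_Hs inE => /orP[/eqP -> i|/mapP[z hz -> i]] /=; rewrite ffunE.
    apply: leq_trans (bits_M _ _) _; apply: leq_trans (leq_add Bqb (bits_bool _)) _.
    by rewrite /k3; move: k1; clear; nia.
  apply: leq_trans (bits_M _ _) _; apply: leq_trans (leq_add (Fb i) (yb z hz i)) _.
  by rewrite /k3; clear; nia.
have good' z : z \in Hs' -> sound_item z.
  rewrite /Hs' /step_Hs inE => /orP[/eqP ->|/mapP[x hx ->]] /=; last exact: (hgood x hx).
  by split=> // v; rewrite ffunE.
have ytb : bits (ytot Hs') <= k3 * n * t.+1.
  rewrite -sz'; apply: bits_sum_in => x hx.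
  by apply: bits_sum_ord; apply: yb'.
have hht : pc f_htot (encl (fun=> 1%R) en ::: enc_items Hs') (VInt (ytot Hs'))
    (60 * n1 * tm.+2).
  apply: pc_eq; first apply: (@spec_htot _ _ _ _ _ Hs' en (fun (x : item n) (i : 'I_n) =>
    x.1.1 i) _ k3 yb').
  - rewrite size_en sz'; apply: leq_trans (_ : 3000 * X <= _) => //.
    apply: leq_trans (_ : 2 * (13 * k.+1 * n1) * n1 * tm.+2 <= _).
      have h1 : k3.+1 <= 13 * k.+1 * n1 by rewrite /k3; clear; nia.
      by apply: leq_mul; [apply: leq_mul; [apply: leq_mul | exact: leqW] | lia].
    by rewrite /X -mulnn; clear; nia.
  - by congr VInt; apply: eq_bigr => x _; rewrite big_enum_ord.
  - by rewrite size_en sz' !leq_mul //; lia.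
have Qt'b : bits (q ^+ t.+1)%R <= 2 * k.
  by rewrite exprS; apply: leq_trans (bits_M _ _) _; rewrite mul2n -addnn leq_add.
have NQb : bits (N * q ^+ t.+1)%R <= 3 * k.
  by apply: leq_trans (bits_M _ _) _; rewrite (_ : 3 * k = k + 2 * k) ?leq_add //; clear; lia.
have ks : 3 * k <= s by apply: leq_trans s_n1; clear; nia.
have yt_le : k3 * n * t.+1 <= 13 * k * n1 ^ 2 * tm.+2.
  by rewrite -mulnn mulnA /k3; apply: leq_mul; [apply: leq_mul => //; apply: ltnW |
    apply: leqW].
have ytX : k3 * n * t.+1 <= 13 * X.
  by apply: leq_trans yt_le _; rewrite /X; clear; nia.
have yts : bits (ytot Hs') <= s by apply: leq_trans ytb _; lia.
have hs : forall x, x <= 3 * k -> x <= s by move=> x hx; lia.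
have [hle|hgt] := leP (N * q ^+ t.+1)%R (ytot Hs').
  (* The reduction needs a larger bit bound, because its vectors involve the sum of all [n * t.+1]
     multiplicities. *)
  pose kp := 20 * k * n1 ^ 2 * tm.+2.
  pose M := (D * ytot Hs' + \sum_i phi' i)%R.
  have n2g : n1 <= n1 ^ 2 by rewrite -[X in X <= _]expn1 leq_exp2l.
  have kkp : k + n1 <= kp.
    have h1 : k * n1 <= k * n1 ^ 2 * tm.+2 by rewrite -mulnA leq_mul2l (leq_trans n2g) ?orbT
      // leq_pmulr.
    by rewrite /kp -!mulnA mulnA; move: h1 k1; clear; nia.
  have hs_p : 100 * kp.+1 * n1 ^ 2 <= s.
    apply: leq_trans s1; rewrite /kp (expnD n1 2 2).
    have h1 : 0 < n1 ^ 2 by rewrite expn_gt0.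
    by move: (n1 ^ 2) h1 => a h1; move: (tm) => u; clear -h1; nia.
  have Db' : bits D <= kp by apply: leq_trans Db _; lia.
  have Ab : bits (n.+1`!%:R * D ^+ n.+1)%R <= kp.
    rewrite factS natrM -mulrA; apply: leq_trans (bits_M _ _) _.
    apply: leq_trans (leq_add (_ : _ <= n1) (_ : _ <= k)) _; [ | | lia].
      by rewrite natz; apply: leq_trans (bits_nat _) _.
    apply: (@pow_bits _ n.+1 0) => //; rewrite expr0 mulr1.
    have D0 : (0 <= D)%R by have := D1; lia.
    rewrite ger0_norm ?mulr_ge0 ?exprn_ge0 //.
    apply: ler_wpM2l => //; apply: lerXn2r; rewrite ?nnegrE //; have := Wm_gt; lia.
  have Mb : bits M <= kp.
    apply: leq_trans (bits_D _ _) _; apply: leq_trans (leq_add (bits_M _ _) (leqnn _)) _.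
    have h1 : bits (\sum_i phi' i)%R <= k3 * n.
      by apply: bits_sum_ord.
    have h2 : k3 * n + k <= 7 * k * n1 ^ 2 * tm.+2.
      have : k3 * n + k <= 14 * k * n1 ^ 2 by rewrite /k3 -mulnn; clear; nia.
      by move: (n1 ^ 2) (tm) => a u; clear; nia.
    have -> : kp = 13 * k * n1 ^ 2 * tm.+2 + 7 * k * n1 ^ 2 * tm.+2.
      by rewrite -!mulnDl.
    have h3 := leq_trans ytb yt_le.
    by rewrite addnAC addnC leq_add //; lia.
  have [] := @spec_purstart A (allowed E s) s n kp D D1 hs_p Db' Ab
    (([ffun i => step_Bq N q t phi Hs g * (i == K)%:Z], finfun h, S) : item n)%R
    (map (scale_item (step_F N q t phi Hs h g)) Hs) phi' M N (q ^+ t.+1)%R; rewrite -/Hs'.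
  - move=> z hz; split; [ | exact: (y_ge0 ok' hz) | exact: (h_le ok' hz)].
    by move=> i; apply: leq_trans (yb' z hz i) _; rewrite /k3 /kp -mulnn; clear; nia.
  - by move=> i; apply/ltW/(phi_gt0 ok').
  - move=> j; rewrite /M addrC lerD2l (bigD1 j) //= lerDl.
    by apply: sumr_ge0 => i _; apply/ltW/(phi_gt0 ok').
  - by rewrite /M lerDl; apply: sumr_ge0 => i _; apply/ltW/(phi_gt0 ok').
  - exact: Mb.
  - exact: qt_gt0.
  - exact: N_large.
  (* The last coordinates of the final [rho] are the column sums of the new facets, which centering
     keeps within [2 * q ^+ t.+1]. *)
  - move=> j; have := centered_sum par j hc' t_lt.
    rewrite colsumE; move: (_ + \sum_(x <- Hs') _)%R (q ^+ t.+1)%R; clear; lia.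
  - exact: hle.
  move=> V' [tg' [dl' [cb' V0' tgs hpur]]].
  exists (pur_out V' tg' dl' ::: VInt 0); split.
    by right; exists V', tg', dl'; split=> // i z /tgs /good'.
  eapply pc_intro; [reflexivity | | | ].
    rewrite /loop_arg enc_lotteryE {1}/enc_state {1}/enc_par; run.
    - exact: hlin.
    - by rewrite -enc_lotteryE; exact: hq.
    - run; first exact: hup.
      rewrite /enc_state; run.
      + by apply: hs; lia.
      + by apply: hs; lia.
      + exact: hht.
      + by apply: hs.
      + exact: yts.
      + rewrite /prim_sem hle; run; exact: hpur.
  - by [].
  have kpn : kp.+1 * n1 <= 20 * (k * B) + B.
    rewrite mulSn addnC leq_add //; last exact: leq_trans n13 B_n3.
    by rewrite /kp /B (expnSr n1 2); clear; nia.
  have h1 : n1 ^ 2 * t.+1 <= B.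
    by apply: leq_trans B_n2; rewrite leq_mul2l; apply/orP; right; lia.
  have h2 : n1 * t.+1 <= B.
    by apply: leq_trans B_n1; rewrite leq_mul2l; apply/orP; right; lia.
  rewrite costE size_map hsz.
  move: B_n1 B_n3 B_t n23 n13 kpn h1 h2; rewrite mulSn.
  move: (n1 ^ 3) (n1 ^ 2) (k * B) (B * _) => a1 a2 a3 a4.
  by clear; lia.
have [v [hv hpc]] := IH phi' Hs' t_lt ok' hc' hgt (hg' hgt) sz' good'.
exists v; split=> //.
eapply pc_intro; [reflexivity | | | ].
  rewrite /loop_arg enc_lotteryE {1}/enc_state {1}/enc_par; run.
  - exact: hlin.
  - by rewrite -enc_lotteryE; exact: hq.
  - run; first exact: hup.
    rewrite /enc_state; run.
    + by apply: hs; lia.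
    + by apply: hs; lia.
    + exact: hht.
    + by apply: hs.
    + exact: yts.
    + rewrite /prim_sem leNgt hgt /=; run; exact: hpc.
- by [].
have h2 : n1 * t.+1 <= B.
  by apply: leq_trans B_n1; rewrite leq_mul2l; apply/orP; right; lia.
have h3 : B * (tm.+1 - t) = B * (tm.+1 - t.+1) + B.
  by rewrite -mulnSr; congr (B * _); lia.
have h4 : loop_cost t.+1 = 5000 * (B * (tm.+1 - t.+1)) + 5000 * (k.+1 * B).
  by rewrite /loop_cost /B !mulnA.
rewrite costE h4 hsz /=; move: h3 B_n1 B_n3 n23 n13 h2.
move: (n1 ^ 3) (n1 ^ 2) (k.+1 * B) (B * _) (B * _) => a1 a2 a3 a4 a5.
by clear; lia.
Qed.

Lemma spec_loop t phi Hs :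
  cuts_ok D phi Hs -> centered Wm q t phi Hs -> t <= tm ->
  (ytot Hs < N * q ^+ t)%R -> grown q t phi Hs -> size Hs = t ->
  (forall z, z \in Hs -> sound_item z) ->
  exists v, loop_out v /\ pc f_loop (loop_arg phi Hs t) v (loop_cost t).
Proof.
have [m hm] := ubnP (tm - t); elim: m t phi Hs hm => // m IH t phi Hs hm *.
by apply: spec_loop_step => // phi' Hs' ht *; apply: IH => //; lia.
Qed.

End Loop.

(** * Choice of the constants *)

Section Constants.

Variables (n : nat) (D : int).
Hypothesis D_ge1 : (1 <= D)%R.
Local Open Scope ring_scope.

(** The base exceeds [4 n] and [4 D], so its power [N] dominates [(n+1)! D ^ n 4 ^ (n+1)], and one
    more factor gives a bound [Wm] on facets. The exponent [n + 4] of [q] leaves five factors beyond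
    [Wm ^ (n - 1)] for the polynomial and factorial terms of [par_slope]. *)
Definition par_base : int := 4 * ((n%:Z + 1) * (D + 1)).
Definition par_N_of : int := par_base ^+ n.+1.
Definition par_W_of : int := par_base * par_N_of.
Definition par_q_of : int := par_W_of ^+ (n + 4).
Definition par_kap_of : nat := bits (n`!%:R * par_W_of ^+ n).
Notation b := par_base.
Notation N := par_N_of.
Notation Wm := par_W_of.
Notation q := par_q_of.

Lemma fact_le_exp m : (m`! <= m ^ m)%N.
Proof.
elim: m => // m IH; rewrite factS expnS leq_mul2l /=.
by apply: leq_trans IH _; case: m => // m; rewrite leq_exp2r.
Qed.

Let b_ge : 4 * (n%:Z + 1) <= b /\ 4 * (D + 1) <= b.
Proof. by rewrite /b; split; nia. Qed.

Let N_ge : b <= N.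
Proof. by rewrite /N exprS ler_peMr ?exprn_ege1 //; have := b_ge; lia. Qed.

Let W_ge : 8 * N <= Wm.
Proof. by rewrite /Wm ler_wpM2r //; have := N_ge; have := b_ge; lia. Qed.

Let W_ge1 : 1 <= Wm.
Proof. by have := W_ge; have := N_ge; have := b_ge; lia. Qed.

Let fact_le_N : n.+1`!%:R * D ^+ n * 4 ^+ n.+1 <= N :> int.
Proof.
rewrite /N /b exprMn [leLHS]mulrC ler_wpM2l ?exprn_ge0 // exprMn.
apply: ler_pM; rewrite ?exprn_ge0 //; try lia.
  rewrite (_ : n%:Z + 1 = (n.+1)%:R); last by rewrite natz; lia.
  by rewrite -natrX ler_nat fact_le_exp.
apply: le_trans (_ : (D + 1) ^+ n <= _).
  by apply: lerXn2r; rewrite ?nnegrE; lia.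
by apply: ler_weXn2l; lia.
Qed.

Lemma par_N_large : 2 * n%:Z * (n.+1`!%:R * D ^+ n) < N.
Proof.
apply: lt_le_trans fact_le_N; rewrite mulrC ltr_pM2l.
  by rewrite exprS; have := @ltn_expl 4 n isT; rewrite -(ltr_nat int) natrX !natz; lia.
by rewrite mulr_gt0 ?exprn_gt0 ?ltr0n ?fact_gt0 //; lia.
Qed.

Lemma par_fact : n`!%:R <= N.
Proof.
apply: le_trans fact_le_N; rewrite -mulrA factS natrM -[leLHS]mul1r -mulrA.
have h1 : 1 <= (n.+1%:R : int) by rewrite ler1n.
have h2 : 1 <= D ^+ n * 4 ^+ n.+1 by rewrite mulr_ege1 // exprn_ege1.
apply: ler_pM => //; by rewrite ler_peMr // ler0n.
Qed.

Lemma params_of : params n D N Wm q par_kap_of.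
Proof.
have hb := b_ge; have hN := N_ge; have hW := W_ge; have hW1 := W_ge1; have hf := par_fact.
have f0 : (1 <= n`!%:R :> int) by rewrite ler1n fact_gt0.
split=> //; try lia.
- by rewrite exprn_ege1.
- rewrite /Wm; have : 4 * (D + 1) * N <= b * N by rewrite ler_wpM2r //; lia.
  by have : 0 <= D * N; [apply: mulr_ge0; lia | lia].
(* Bounding a bit length by the number itself is enough, since [q] contains [Wm ^ n] and four
   further factors. *)
- have hk : par_kap_of%:Z <= n`!%:R * Wm ^+ n.
    have p0 : 0 <= n`!%:R * Wm ^+ n by rewrite mulr_ge0 ?exprn_ge0 //; lia.
    rewrite /par_kap_of -[X in bits X](gez0_abs p0) -[leRHS](gez0_abs p0) lez_nat.
    exact: bits_nat.
  rewrite /tmax !PoszM; apply: le_trans (_ : (2 * n%:Z) ^+ 3 * (n`!%:R * Wm ^+ n) * Wm <= _).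
    rewrite ler_wpM2r //; first by lia.
    rewrite (_ : _ * n%:Z = (2 * n%:Z) ^+ 3 * par_kap_of%:Z).
      by rewrite ler_wpM2l // exprn_ge0.
    by rewrite !exprS expr0; ring.
  rewrite (_ : q = Wm ^+ 3 * Wm ^+ n * Wm); last by rewrite /q -exprD -exprSr; congr (_ ^+ _);
    lia.
  rewrite ler_wpM2r ?(le_trans _ hW1) // mulrA ler_wpM2r ?exprn_ge0 ?(le_trans _ hW1) //.
  apply: le_trans (_ : b ^+ 3 * N ^+ 3 <= _); last by rewrite -exprMn.
  apply: ler_pM; rewrite ?exprn_ge0 //.
    by apply: lerXn2r; rewrite ?nnegrE; lia.
  by apply: le_trans hf _; rewrite ler_eXnr //; lia.
- case: (posnP n) => [n0|n0].
    by rewrite n0 expr0n /= !(mulr0, mul0r) exprn_ge0 ?(le_trans _ hW1).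
  rewrite (_ : q = Wm * Wm * Wm * Wm * Wm * Wm ^+ n.-1); last first.
    by rewrite /q (_ : (n + 4 = 5 + n.-1)%N) ?exprD; [ring | lia].
  apply: ler_wpM2r; first by rewrite exprn_ge0 ?(le_trans _ hW1).
  rewrite (_ : 2 * n%:Z ^+ 2 * n%:Z * D * n`!%:R =
     (2 * n%:Z) * n%:Z * n%:Z * D * n`!%:R); last by ring.
  apply: ler_pM; [ | by lia | | by lia].
    by rewrite !mulr_ge0 //; lia.
  apply: ler_pM; [ | by lia | | by lia].
    by rewrite !mulr_ge0 //; lia.
  by rewrite !ler_pM ?mulr_ge0 //; lia.
have p0 : 0 <= n`!%:R * Wm ^+ n by rewrite mulr_ge0 ?exprn_ge0 //; lia.
rewrite -[ltLHS](gez0_abs p0) -natz -natrX ltr_nat; exact: bits_lt.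
Qed.

End Constants.

(** * The entry procedure *)

Lemma facets_start n : facets (fun=> 1%R) ([::] : seq (item n)) = 1%:M%R.
Proof. by apply/matrixP => i j; rewrite !mxE big_nil addr0. Qed.

Lemma adj_scalar1 n : (\adj (1%:M : 'M[int]_n) = 1%:M)%R.
Proof. by have := mul_mx_adj (1%:M : 'M[int]_n)%R; rewrite mul1mx det1. Qed.

Section Main.

Variables (R : realType) (alpha : R) (E : center_space) (I : lottery E).
Variables (A : blackbox) (s k : nat).
Hypothesis approx : fractional_approx_alg E alpha A.
Notation n := (npts E).
Notation en := (enum 'I_n).
Notation n1 := (n.+2).
Notation pc := (pc A (allowed E s) s).
Notation D := (common_den I).
Notation pint := (scaled_prob I).
Notation b := (par_base n D).
Notation N := (par_N_of n D).
Notation Wm := (par_W_of n D).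
Notation q := (par_q_of n D).
Notation kap := (par_kap_of n D).
Notation tm := (tmax n kap).

Hypothesis s_ge : dsize (enc_lottery I) + 3000 * k.+1 * n1 ^ 4 * tm.+2 <= s.
Hypothesis dist_num : forall i j, bits (numq (@dist E i j)) <= k.
Hypothesis dist_den : forall i j, bits (denq (@dist E i j)) <= k.
Hypothesis rad_num : forall i, bits (numq (lrad I i)) <= k.
Hypothesis rad_den : forall i, bits (denq (lrad I i)) <= k.
Hypothesis prob_num : forall i, bits (numq (lprob I i)) <= k.
Hypothesis prob_den : forall i, bits (denq (lprob I i)) <= k.
Hypothesis q_bits : bits q <= k.
Hypothesis M2_bits : bits (2 * (n%:Z * n%:Z))%R <= k.
Hypothesis det_bits : bits (n`!%:R * (Wm * q ^+ tm) ^+ n.+1)%R <= k.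

Let D1 : (1 <= D)%R. Proof. by have := common_den_gt0 I; lia. Qed.
Let par := params_of n D1.

(** The loop starts from the nonnegative orthant, whose facets form the identity matrix: there are
    no cuts, the determinant is 1, and the column sums are exactly [q ^ 0]. *)
Lemma spec_main : exists v, loop_out alpha I v /\
  pc f_main (enc_lottery I) v (3000 * n1 ^ 2 + loop_cost E k kap 0).
Proof.
have size_en : size en = n by rewrite size_enum_ord.
have s0 : 3000 * k.+1 * n1 * n1 <= s.
  apply: leq_trans s_ge; rewrite -[X in X <= _]add0n; apply: leq_add => //.
  rewrite (expnD n1 2 2) -[X in X <= _]muln1 leq_mul // -mulnA -mulnn.
  by rewrite leq_mul2l leq_pmulr.
have ns : 1000 * k.+1 * n1 <= s by apply: leq_trans s0; clear; nia.
have ns1 : 1000 * n1 <= s by apply: leq_trans ns; clear; nia.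
have ks : 1000 * k.+1 <= s by apply: leq_trans ns; clear; nia.
have lin z : (`|z| <= Wm)%R -> bits z <= k.
  move=> hz; apply: (lin_bits par (par_N_large n D1) s_ge q_bits M2_bits det_bits (leq0n _)).
  by rewrite expr0 mulr1.
have N1 := par_N par.
have hW : (D <= Wm)%R /\ (N <= Wm)%R.
  have := par_Wm par; have := D1; move: N1.
  move: D N Wm => d m w h1 h2 h3.
  have : (d <= d * m)%R by rewrite ler_peMr //; lia.
  have : (m <= d * m)%R by rewrite ler_peMl //; lia.
  by lia.
have Db : bits D <= k by apply: lin; lia.
have Nb : bits N <= k by apply: lin; lia.
have Wb : bits Wm <= k by apply: lin; lia.
have bb : bits b <= k.
  have b0 : (0 <= b)%R by rewrite !mulr_ge0 //; have := D1; lia.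
  by apply: lin; rewrite ger0_norm // ler_peMr.
have hD : pc f_dens (encq (lprob I) en) (VInt D) (30 * n1).
  apply: pc_eq; first apply: (spec_dens prob_den).
  - by rewrite size_en; move: ns; clear; nia.
  - by rewrite big_enum.
  - by rewrite size_en; lia.
have hpint : pc f_scale (VInt D ::: encq (lprob I) en) (encl pint en) (40 * n1).
  apply: pc_eq; first apply: (@spec_scale _ _ _ _ en (lprob I) D k prob_den prob_num Db).
  - by lia.
  - by [].
  - by rewrite size_en; lia.
have hconsts z : pc f_consts (VInt z ::: VInt n) (encl (fun=> z) en) (30 * n1).
  apply: pc_eq; first (rewrite -{1}size_en; apply: (@spec_consts _ _ _ _ en z)).
  - by rewrite size_en; lia.
  - by [].
  - by rewrite size_en; lia.
have hids : pc f_iota (VInt 0 ::: VInt n) (encl (posn n) en) (30 * n1).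
  apply: pc_eq; first apply: (@spec_iota _ _ _ 0 n); first by lia.
    by rewrite -val_enum_ord /encl -map_comp.
  by lia.
have hpow z m l : bits z <= l -> (l * m.+1).+1 + m <= s ->
    pc f_consts (VInt z ::: VInt m) (encl (fun=> z) (enum 'I_m)) (30 * m.+1) /\
    pc f_prod (encl (fun=> z) (enum 'I_m)) (VInt (z ^+ m)%R) (20 * m.+1).
  move=> hz hs; have sm : size (enum 'I_m) = m by rewrite size_enum_ord.
  split; apply: pc_eq.
  - by rewrite -{1}sm; apply: (@spec_consts _ _ _ _ (enum 'I_m) z); rewrite sm; lia.
  - by [].
  - by rewrite sm.
  - by apply: (@spec_prod _ _ _ _ (enum 'I_m) (fun=> z) l) => //; rewrite sm; lia.
  - by rewrite big_enum prodr_const card_ord.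
  - by rewrite sm.
have [|hbs hN] := hpow b n.+1 k bb; first by move: ns; clear; nia.
have [|hWs hq] := hpow Wm (n + 4) k Wb; first by move: ns; clear; nia.
have hunits : pc f_units (encl (posn n) en :::
    encl (posn n) en)
    (encm (fun i j => (\adj (facets (fun=> 1%R) ([::] : seq (item n))))%R j i) en en)
    (60 * n1 ^ 2).
  apply: pc_eq; first apply: (@spec_units _ _ _ _ _ en en (posn n)
    (posn n) n).
  - by move=> i; apply: leq_trans (bits_nat _) _; apply: ltnW.
  - by move=> i; apply: leq_trans (bits_nat _) _; apply: ltnW.
  - by lia.
  - by apply: encm_ext => i j; rewrite facets_start adj_scalar1 mxE -val_eqE natz.
  - by rewrite size_en -mulnn -mulnA leq_mul2l leq_mul.
have [|||||||v [hv hl]] := spec_loop approx par (par_N_large n D1) s_ge dist_num dist_den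
  rad_num rad_den q_bits M2_bits det_bits (t := 0) (phi := fun=> 1%R) (Hs := [::]).
- by [].
- move=> j; rewrite colsumE big_nil addr0 expr0 subrr normr0 mulr0.
  by rewrite !mul0r.
- by [].
- by rewrite /ytot big_nil mulr_gt0 //; lia.
- by rewrite /grown facets_start det1.
- by [].
- by [].
have bn : bits n <= n by apply: bits_nat.
have b1 : bits (Posz 1) <= 1 by rewrite bits1.
have b2 : bits (Posz 2) <= 2 by apply: (bits_nat 2).
have b4 : bits (Posz 4) <= 4 by apply: (bits_nat 4).
have c1 : bits (Posz n + Posz 1)%R <= n + 1 by apply: leq_trans (bits_D _ _) _; lia.
have c2 : bits (D + Posz 1)%R <= k + 1 by apply: leq_trans (bits_D _ _) _; lia.
have c3 : bits ((Posz n + Posz 1) * (D + Posz 1))%R <= n + k + 2.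
  by apply: leq_trans (bits_M _ _) _; lia.
exists v; split=> //.
eapply pc_intro; [reflexivity | | by [] | ].
  rewrite enc_lotteryE; run.
  - exact: hD.
  - exact: hpint.
  - exact: hconsts.
  - exact: hconsts.
  - exact: hids.
  1-10: rewrite /prim_sem; clear -bn b1 b2 b4 c1 c2 c3 Db ns1 ks.
  - by lia.
  - by lia.
  - by lia.
  - by lia.
  - by apply: leq_trans c1 _; lia.
  - by apply: leq_trans c2 _; lia.
  - by lia.
  - by apply: leq_trans c3 _; lia.
  - by lia.
  - by lia.
  - rewrite [X in VPair _ (VInt X)](_ : _ = Posz n.+1); first exact: hbs.
    by rewrite /prim_sem; lia.
  - exact: hN.
  - by apply: leq_trans bb _; lia.
  - by apply: leq_trans Nb _; lia.
  - by lia.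
  - by lia.
  - exact: hWs.
  - exact: hq.
  - exact: hunits.
  - by apply: leq_trans q_bits _; lia.
  - by apply: leq_trans Nb _; lia.
  - by lia.
  - by lia.
  - by lia.
  - by rewrite /prim_sem; move: (bits_M n n) bn ns1; clear; lia.
  - by move: hl; rewrite /loop_arg /enc_state expr0 facets_start det1; exact.
rewrite addSn; move: (loop_cost _ _ _ _) => c; rewrite -mulnn; clear; nia.
Qed.
End Main.

(** * From the weights of the cuts to a distribution *)

Section Distribution.

Local Open Scope ring_scope.

Variables (R : realType) (alpha : R) (E : center_space) (I : lottery E).
Notation n := (npts E).
Notation D := (common_den I).
Notation pint := (scaled_prob I).

Variables (V : 'I_n.+1 -> 'I_n.+1 -> int) (tg : 'I_n.+1 -> option (item n)) (dl : int).
Hypothesis cb : cone_basis D V tg dl.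
Hypothesis V_ge0 : forall i, 0 <= V i ord0.
Hypothesis tg_sound : forall i z, tg i = Some z -> sound_item alpha I z.

Definition weight i : rat := (V i ord0)%:~R / (Posz `|dl|%N)%:~R.

Definition support_list : seq ({set 'I_n} * rat) :=
  pmap (fun i => omap (fun z : item n => (z.2, weight i)) (tg i)) (enum 'I_n.+1).

Lemma enc_support_list :
  pur_out V tg dl ::: VInt 0 = enc_option (@enc_lot n) (Some support_list).
Proof.
rewrite /pur_out /weighted /enc_lot /support_list /=; congr (enc_list _ ::: _).
by elim: (enum _) => //= i r IH; case: (tg i) => [z|] //=; rewrite IH.
Qed.

Lemma big_support_list (F : {set 'I_n} -> rat -> R) :
  \sum_(x <- support_list) F x.1 x.2 =
  \sum_i (if tg i is Some z then F z.2 (weight i) else 0).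
Proof.
rewrite /support_list -[RHS]big_enum /=.
elim: (enum _) => [|i r IH]; first by rewrite !big_nil.
by rewrite [RHS]big_cons /= -IH; case: (tg i) => [z|] /=; rewrite ?big_cons ?add0r.
Qed.

Lemma weight_ge0 i : 0 <= weight i.
Proof. by rewrite divr_ge0 // ler0z. Qed.

Lemma lot_distr_sum (p : pred {set 'I_n}) :
  \sum_(S | p S) lot_distr R support_list S =
  \sum_i (if tg i is Some z then if p z.2 then ratr (weight i) else 0 else 0).
Proof.
rewrite -(big_support_list (fun S x => if p S then ratr x else 0)).
rewrite /lot_distr (exchange_big_dep xpredT) //= big_mkcond /=.
apply: eq_bigr => x _; case: ifP => px.
  by rewrite (big_pred1 x.1) // => S; rewrite /= eq_sym andbC; case: eqP => // ->.
by apply: big_pred0 => S; apply/andP => -[pS /eqP e]; rewrite e pS in px.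
Qed.

Lemma lot_distr_support S : lot_distr R support_list S =
  \sum_i (if tg i is Some z then if z.2 == S then ratr (weight i) else 0 else 0).
Proof. by rewrite -(lot_distr_sum (pred1 S)) big_pred1_eq. Qed.

(** At each point [v] a cut is at least [D prob(v)], minus [D] if its set covers [v]; it may be
    larger, as covered points can be missing from the recorded cut. The weighted cuts sum to at most
    0, and division by [D * dl] gives the demanded probability. *)
Lemma support_list_approx : lottery_approx alpha I (lot_distr R support_list).
Proof.
have dl0 := cb_gt0 cb; have [e1 _ e3] := cone_weights cb V_ge0.
have edl : (Posz `|dl|%N)%:~R = dl%:~R :> rat by rewrite gtz0_abs.
have d0 : 0 < (dl%:~R : rat) by rewrite ltr0z.
have w0 i : 0 <= (ratr (weight i) : R) by rewrite ler0q weight_ge0.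
have sumE (p : pred {set 'I_n}) : \sum_(S | p S) lot_distr R support_list S =
    ratr ((\sum_i (if tg i is Some z then if p z.2 then V i ord0 else 0 else 0))%:~R / dl%:~R).
  rewrite lot_distr_sum rmorph_sum /= mulr_suml rmorph_sum /=; apply: eq_bigr => i _.
  case: (tg i) => [z|]; last by rewrite mul0r rmorph0.
  by case: ifP => _; rewrite ?mul0r ?rmorph0 // /weight edl.
split.
  split.
  - move=> S; rewrite lot_distr_support; apply: sumr_ge0 => i _.
    by case: (tg i) => // z; case: ifP.
  - rewrite (sumE xpredT) /= (_ : (\sum_i _) = dl) ?divff ?rmorph1 ?gt_eqF //.
    by rewrite -[RHS]e1 [RHS]big_mkcond; apply: eq_bigr => i _; case: (tg i).
  - move=> S Sf; rewrite lot_distr_support big1 // => i _.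
    case e : (tg i) => [z|] //; case: eqP => // ez.
    by have [zf _] := tg_sound e; rewrite -ez zf in Sf.
move=> v; rewrite (sumE (fun S => covered alpha (lrad I) v S)) ler_rat ler_pdivlMr //.
set s := \sum_i _; have D0 : 0 < (D%:~R : rat) by rewrite ltr0z common_den_gt0.
rewrite -(ler_pM2l D0) mulrA -scaled_probE -!intrM ler_int.
suff : \sum_i (if tg i is Some x then V i ord0 * x.1.2 v else 0) >=
    pint v * dl - D * s by have := e3 v; lia.
rewrite -e1 /s !mulr_sumr big_mkcond -sumrB; apply: ler_sum => i _.
case e : (tg i) => [z|] /=; last by rewrite mulr0 subr0.
have Vi := V_ge0 i; have [_ /(_ v)] := tg_sound e.
case=> [->|[-> ->]]; last by rewrite mulrBr lerB // mulrC.
rewrite mulrC; case: ifP => _; last by rewrite mulr0 subr0.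
by rewrite gerBl mulr_ge0 // ltW // common_den_gt0.
Qed.

End Distribution.

(** * Polynomial bounds and the conclusion *)

Lemma dsize_enc_list (T : eqType) (f : T -> data) (r : seq T) :
  size r <= dsize (enc_list (map f r)) /\
  forall x, x \in r -> dsize (f x) <= dsize (enc_list (map f r)).
Proof.
elim: r => [|y r [IH1 IH2]] //=; split; first by lia.
by move=> x; rewrite inE => /orP[/eqP ->|/IH2]; lia.
Qed.

Lemma dsize_encq_mem (T : eqType) (q : T -> rat) (r : seq T) x : x \in r ->
  bits (numq (q x)) <= dsize (encq q r) /\ bits (denq (q x)) <= dsize (encq q r).
Proof.
move=> hx; have [_ /(_ x hx)] := dsize_enc_list (fun x => enc_rat (q x)) r.
by rewrite -/(encq q r) /=; split; lia.
Qed.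

Lemma bits_exp (z : int) m : bits (z ^+ m)%R <= (bits z * m).+1.
Proof.
have := bits_prod (f := fun=> z) (enum 'I_m) (fun=> leqnn (bits z)).
by rewrite size_enum_ord big_enum prodr_const card_ord.
Qed.

Section PolynomialBounds.

Variables (E : center_space) (I : lottery E) (L : nat).
Hypothesis L_ge : dsize (enc_lottery I) + 10 <= L.
Notation n := (npts E).
Notation n1 := (n.+2).
Notation D := (common_den I).
Notation b := (par_base n D).
Notation N := (par_N_of n D).
Notation Wm := (par_W_of n D).
Notation q := (par_q_of n D).
Notation kap := (par_kap_of n D).
Notation tm := (tmax n kap).

(** Bounds are tracked as exponents of [L >= 10]: a sum raises the exponent by one, a product adds
    exponents, and numeric constants are absorbed by small powers. *)
Let pow_le x i j : i <= j -> x <= L ^ i -> x <= L ^ j.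
Proof. by move=> h hx; apply: leq_trans hx _; rewrite leq_pexp2l //; lia. Qed.

Let pow_add x y i : x <= L ^ i -> y <= L ^ i -> x + y <= L ^ i.+1.
Proof.
move=> hx hy; rewrite expnS; apply: leq_trans (leq_add hx hy) _.
by rewrite addnn -mul2n leq_mul2r orbC; apply/orP; left; lia.
Qed.

Let pow_mul x y i j : x <= L ^ i -> y <= L ^ j -> x * y <= L ^ (i + j).
Proof. by move=> hx hy; rewrite expnD leq_mul. Qed.

Let pow_small x i : x <= 10 -> x <= L ^ i.+1.
Proof. by move=> hx; apply: (@pow_le _ 1) => //; rewrite expn1; lia. Qed.

Let pow_S x i : x <= L ^ i.+1 -> x.+1 <= L ^ i.+2.
Proof. by move=> hx; rewrite -addn1; apply: pow_add => //; apply: pow_small. Qed.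

Let pow_big x i : x <= 5000 -> x <= L ^ i.+4.
Proof.
move=> hx; apply: (@pow_le _ 4) => //; apply: leq_trans (_ : 10 ^ 4 <= _) => //.
  by apply: leq_trans hx _.
by rewrite leq_exp2r //; lia.
Qed.

Lemma input_bits : [/\ n + 5 <= L,
  (forall i j, bits (numq (@dist E i j)) <= L) /\ (forall i j, bits (denq (@dist E i j)) <= L),
  (forall i, bits (numq (lrad I i)) <= L) /\ (forall i, bits (denq (lrad I i)) <= L) &
  (forall i, bits (numq (lprob I i)) <= L) /\ (forall i, bits (denq (lprob I i)) <= L)].
Proof.
have := L_ge; rewrite enc_lotteryE /= => h.
have he i : i \in enum 'I_n by rewrite mem_enum.
have [h1 h2] := dsize_enc_list (fun i => encq (@dist E i) (enum 'I_n)) (enum 'I_n).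
have hd i j := dsize_encq_mem (@dist E i) (he j).
have hr i := dsize_encq_mem (lrad I) (he i).
have hp i := dsize_encq_mem (lprob I) (he i).
rewrite -/(enc_dist E) size_enum_ord in h1 h2.
have [le_d le_r le_p] : [/\ dsize (enc_dist E) <= L,
    dsize (encq (lrad I) (enum 'I_n)) <= L & dsize (encq (lprob I) (enum 'I_n)) <= L].
  by split; lia.
split; first by lia.
- by split=> i j; have [a1 a2] := hd i j;
    [apply: leq_trans a1 _ | apply: leq_trans a2 _]; apply: leq_trans (h2 i (he i)) le_d.
- by split=> i; have [a1 a2] := hr i; [apply: leq_trans a1 le_r | apply: leq_trans a2 le_r].
- by split=> i; have [a1 a2] := hp i; [apply: leq_trans a1 le_p | apply: leq_trans a2 le_p].
Qed.

(** Following the constants from [D] through [N], [Wm], [q] and [kap] to [tm] gives exponent 24 for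
    the bit bound [k], and then 60 both for the room [s] and for the number of steps. *)
Lemma machine_bounds : [/\ bits q <= L ^ 24, bits (2 * (n%:Z * n%:Z))%R <= L ^ 24,
  bits (n`!%:R * (Wm * q ^+ tm) ^+ n.+1)%R <= L ^ 24,
  dsize (enc_lottery I) + 3000 * (L ^ 24).+1 * n1 ^ 4 * tm.+2 <= L ^ 60 &
  3000 * n1 ^ 2 + loop_cost E (L ^ 24) kap 0 + 2 <= L ^ 60].
Proof.
have [nL _ _ [_ hden]] := input_bits.
have n0 : n <= L ^ 1 by rewrite expn1; lia.
have n2 : n1 <= L ^ 1 by rewrite expn1; lia.
have n4 : n + 5 <= L ^ 1 by rewrite expn1.
have mulS x m i : x <= L ^ i -> m.+1 <= L -> 0 < i -> (x * m).+1 <= L ^ i.+1.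
  move=> hx hm hi; apply: leq_trans (_ : (L ^ i * m).+1 <= _);
    first by rewrite ltnS leq_mul2r hx orbT.
  rewrite expnSr; apply: leq_trans (_ : L ^ i * m.+1 <= _); last by rewrite leq_mul2l hm orbT.
  by rewrite mulnS; have : 0 < L ^ i; [rewrite expn_gt0; lia | lia].
have Db : bits D <= L ^ 2.
  have h1 : bits D <= (L * n).+1.
    by have := bits_prod (enum 'I_n) hden; rewrite size_enum_ord big_enum.
  by apply: leq_trans h1 _; apply: mulS; rewrite ?expn1 //; lia.
have D1 : (1 <= D)%R by have := common_den_gt0 I; lia.
have bb : bits b <= L ^ 5.
  apply: leq_trans (bits_M _ _) _; apply: pow_add.
    by apply: pow_small; apply: leq_trans (bits_nat 4) _.
  apply: leq_trans (bits_M _ _) _; apply: pow_add.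
    apply: leq_trans (bits_D _ _) _; apply: pow_add; last by rewrite bits1 pow_small.
    by apply: leq_trans (bits_nat _) _; apply: pow_le n0.
  by apply: leq_trans (bits_D _ _) _; apply: pow_add => //; rewrite bits1 pow_small.
have Nb : bits N <= L ^ 6.
  by apply: leq_trans (bits_exp _ _) _; apply: mulS => //; lia.
have Wb : bits Wm <= L ^ 7.
  by apply: leq_trans (bits_M _ _) _; apply: pow_add => //; apply: pow_le bb.
have qb : bits q <= L ^ 8.
  by apply: leq_trans (bits_exp _ _) _; apply: mulS => //; lia.
have fb : bits (n`!%:R)%R <= L ^ 6.
  by apply: bits_le_norm Nb; rewrite ger0_norm ?ler0n // par_fact.
have kb : kap <= L ^ 9.
  apply: leq_trans (bits_M _ _) _; apply: pow_add; first exact: pow_le fb.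
  by apply: leq_trans (bits_exp _ _) _; apply: mulS => //; lia.
have tb : tm <= L ^ (1 + 2 + 9).
  by apply: pow_mul kb; apply: pow_mul; [apply: pow_small | rewrite leq_exp2r //; lia].
have tb2 : tm.+2 <= L ^ 14 by apply: pow_S; apply: pow_S.
have qtb : bits (Wm * q ^+ tm)%R <= L ^ (12 + 8).+2.
  apply: leq_trans (bits_M _ _) _; apply: pow_add; first exact: pow_le Wb.
  apply: leq_trans (bits_exp _ _) _; rewrite mulnC; apply: pow_S.
  exact: (pow_mul tb qb).
have big : bits (n`!%:R * (Wm * q ^+ tm) ^+ n.+1)%R <= L ^ 24.
  apply: leq_trans (bits_M _ _) _; apply: pow_add; first exact: pow_le fb.
  by apply: leq_trans (bits_exp _ _) _; apply: mulS => //; lia.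
have k1 : (L ^ 24).+1 <= L ^ 25 by apply: pow_S.
have c1 : 3000 <= L ^ 4 by apply: pow_big.
have c2 : 5000 <= L ^ 4 by apply: pow_big.
have n13 : n1 ^ 3 <= L ^ 3 by rewrite leq_exp2r //; lia.
have n14 : n1 ^ 4 <= L ^ 4 by rewrite leq_exp2r //; lia.
have n12 : n1 ^ 2 <= L ^ 2 by rewrite leq_exp2r //; lia.
split=> //.
- exact: pow_le qb.
- apply: leq_trans (bits_M _ _) _; apply: pow_add.
    by apply: pow_small; apply: leq_trans (bits_nat 2) _.
  apply: leq_trans (bits_M _ _) _; apply: pow_add.
    by apply: leq_trans (bits_nat _) _; apply: pow_le n0.
  by apply: leq_trans (bits_nat _) _; apply: pow_le n0.
- apply: pow_add; last first.
    apply: (@pow_le _ (4 + 25 + 4 + 14)) => //; apply: pow_mul tb2; apply: pow_mul n14.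
    exact: pow_mul.
  by apply: (@pow_le _ 1) => //; rewrite expn1; have := L_ge; lia.
apply: pow_add; last exact: pow_small.
apply: pow_add.
  by apply: (@pow_le _ (4 + 2)) => //; apply: pow_mul.
rewrite /loop_cost subn0; apply: pow_add.
  apply: (@pow_le _ (4 + 3 + 14 + 14)) => //; apply: pow_mul; last exact: ltnW.
  by apply: pow_mul tb2; apply: pow_mul.
apply: (@pow_le _ (4 + 25 + 3 + 14)) => //; apply: pow_mul tb2; apply: pow_mul n13.
exact: pow_mul.
Qed.

End PolynomialBounds.

Lemma horner_pow_shift (m c l : nat) :
  ((('X + c%:P) ^+ m : {poly nat}).[l])%R = (l + c) ^ m.
Proof. by rewrite horner_exp hornerD hornerX hornerC natrXE. Qed.

(** With [s = L ^ i] this absorbs the cost [(s + 2) ^ 2 + T] of a single step into a power of [L]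
    times [T], for [T >= 1]. *)
Lemma expn_square_succ L i : 10 <= L -> 0 < i -> (L ^ i).+2 ^ 2 + 1 <= L ^ (2 * i).+1.
Proof.
move=> hL i0; rewrite (expnS L) [leqRHS]mulnC (mulnC 2 i) expnM.
have : 10 <= L ^ i.
  by apply: (leq_trans hL); rewrite -[X in X <= _]expn1 leq_pexp2l // (leq_trans _ hL).
move: (L ^ i) => x hx; apply: leq_trans (_ : x ^ 2 * 10 <= _);
  last by rewrite leq_mul2l hL orbT.
by rewrite -!mulnn; nia.
Qed.

Theorem theorem6p6 (R : realType) :
  exists (M : program) (p : {poly nat}),
  forall (alpha : R) (E : center_space) (I : lottery E) (A : blackbox),
  fractional_approx_alg E alpha A ->
  exists (o : option (seq ({set 'I_(npts E)} * rat))) (t : nat),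
  [/\ run A M (enc_lottery I) (enc_option (@enc_lot (npts E)) o) t,
      lottery_solution alpha I o &
      forall T : nat, (0 < T)%N ->
        (forall J : fractional E,
           (dsize (enc_fractional J) <= p.[dsize (enc_lottery I)]%R)%N ->
           (bbtime A (enc_fractional J) <= T)%N) ->
        (t <= p.[dsize (enc_lottery I)]%R * T)%N].
Proof.
(* The exponent 60 counts the steps and [(2 * 60).+1] is the cost of one step at [s = L ^ 60]; the
   same polynomial bounds the size of the queries. *)
exists prog, (('X + 10%:P) ^+ (60 + (2 * 60).+1))%R => alpha E I A approx.
rewrite horner_pow_shift; pose L := dsize (enc_lottery I) + 10; rewrite -/L.
have L10 : 10 <= L by apply: leq_addl.
have [_ [h1 h2] [h3 h4] [h5 h6]] := input_bits (leqnn L).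
have [b1 b2 b3 b4 b5] := machine_bounds (leqnn L).
have LS i : 0 < i -> L <= L ^ i by move=> i0; rewrite -[X in X <= _]expn1 leq_pexp2l //; lia.
have bk z : bits z <= L -> bits z <= L ^ 24 by move=> h; apply: leq_trans h (LS _ _).
have [v [hv hpc]] := spec_main approx b4 (fun i j => bk _ (h1 i j)) (fun i j => bk _ (h2 i j))
  (fun i => bk _ (h3 i)) (fun i => bk _ (h4 i)) (fun i => bk _ (h5 i)) (fun i => bk _ (h6 i))
  b1 b2 b3.
have [t ht cost] : ev A (allowed E (L ^ 60)) (L ^ 60) [:: enc_lottery I]
    (ECall f_main (EVar 0)) v (L ^ 60).
  eapply ev_fin; [eapply ev_call; [run | exact: hpc] | reflexivity | ].
  by move: b5; lia.
have [o ho hsol] : exists2 o, v = enc_option (@enc_lot (npts E)) o & lottery_solution alpha I o.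
  case: hv => [[-> none]|[V [tg [dl [cb V0 hs ->]]]]]; first by exists None.
  exists (Some (support_list V tg dl)); first exact: enc_support_list.
  exact: support_list_approx.
exists o, t; split=> //; first by rewrite -ho.
move=> T T0 hT; apply: leq_trans (cost T _) _.
  move=> q [J [-> hJ]]; apply: hT; apply: leq_trans hJ _.
  by rewrite leq_pexp2l ?leq_addr //; lia.
rewrite [in leqRHS]expnD -mulnA leq_mul2l; apply/orP; right.
apply: leq_trans (_ : ((L ^ 60).+2 ^ 2 + 1) * T <= _).
  by rewrite mulnDl mul1n leq_add2r leq_pmulr.
by rewrite leq_mul2r expn_square_succ ?orbT.
Qed.
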